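(* Let $\ell<m$, $\ell=o(1/\delta)$, and let $M\in[0,1]^{m\times \ell}$ have singular value decomposition $M=U\Sigma V^\dagger$, where $\Sigma=\mathrm{diag}(s_1(M),\dots,s_\ell(M))$ with $s_1(M)\ge\dots\ge s_\ell(M)\ge 0$. Let $A=\mathcal{P}_\Omega(M+X)$, where each entry of $M+X$ is observed independently with probability $\delta$. Assume that there exists $k\le \ell$ such that $s_k(M)=\omega(\sqrt{m})$, $\frac{s_k(M)}{s_{k+1}(M)}=\omega(1)$, and $\frac{\delta s_k^2(M)}{\sqrt{m\ell\log \ell}}=\omega(1)$. Let $\hat V_{1:k}$ be the output of the algorithm SPCA with input $A$ and $k>0$. Then, with high probability, $$\|(V_{1:k})^\dagger\cdot(\hat V_{1:k})_\bot\|_2=o(1).$$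
   Context: Asymptotics: all quantities ($\delta$, $k$, $M$, ...) may vary as the matrix dimensions tend to infinity; $o,O,\omega,\Omega,\Theta$ refer to this limit, and ''with high probability'' means with probability tending to $1$. Notation: $A^\dagger$ is the transpose of $A$; $s_1(A)\ge s_2(A)\ge\dots$ are the singular values; $\|\cdot\|_2$ is the operator norm. $A_i$ is the $i$-th column of $A$, and $A_{a:b}$ is the submatrix of columns $a,\dots,b$. $A_\bot$ denotes a matrix whose columns form an orthonormal basis of the orthogonal complement of the column span of $A$. $\mathrm{diag}(B)$ of a square matrix $B$ is the diagonal matrix with the same diagonal as $B$. Observation model: $M$ is a deterministic matrix with entries in $[0,1]$; $X$ is a noise matrix with independent zero-mean entries such that $M_{ij}+X_{ij}\in[0,1]$. $\Omega$ is the random set of observed entries, each entry belonging to $\Omega$ independently with probability $\delta$. $[\mathcal{P}_\Omega(Y)]_{ij}=Y_{ij}$ if $(i,j)\in\Omega$ and $0$ otherwise. Algorithm SPCA, with input $A\in[0,1]^{m\times\ell}$ and $k$: (1) $\hat\delta\leftarrow\frac{1}{m\ell}\sum_{(i,j)}1(A_{ij}>0)$; (2) (trimming) $\tilde A\leftarrow$ the matrix $A$ with rows having more than $\max\{10,10\hat\delta\ell\}$ non-zero entries erased; (3) $\Phi\leftarrow\tilde A^\dagger\tilde A-\mathrm{diag}(\tilde A^\dagger\tilde A)$; (4) output $\hat V_{1:k}\leftarrow \mathrm{QR}(\Phi,k)$. Algorithm QR, with input $\Phi$ (of size $\ell\times\ell$) and $k$: choose at random $k$ orthonormal vectors forming the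 $\ell\times k$ matrix $Q^{(0)}$; for $\tau=1,\dots,\lceil 10\log\ell\rceil$, let $Q^{(\tau)}R^{(\tau)}$ be the QR decomposition of $\Phi Q^{(\tau-1)}$; output the last $Q^{(\tau)}$. *)

(* Defs.v *)
(* MathComp / MathComp-Analysis, over an arbitrary R : realType. *)
From HB Require Import structures.
From mathcomp Require Import all_boot all_order all_algebra.
From mathcomp Require Import all_classical all_reals all_analysis.

Set Implicit Arguments.
Unset Strict Implicit.
Unset Printing Implicit Defensive.

Import Order.TTheory GRing.Theory Num.Theory.
Import numFieldNormedType.Exports.

Local Open Scope classical_set_scope.
Local Open Scope ring_scope.

Section Asymptotics.
Context {R : realType}.

Definition is_littleo (u v : nat -> R) : Prop :=
  (u : nat -> R^o) =o_\oo (v : nat -> R^o).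

(* u = omega(v). For u and v of nonnegative values this says that u / v tends
   to infinity, the ratio being read as +oo at the indices where only v
   vanishes. *)
Definition is_littleomega (u v : nat -> R) : Prop := is_littleo v u.

(* "With high probability, Y_n = o(1)". The good event E n is a measurable
   subset of {|Y_n| <= eps_n}, so that Y n itself need not be measurable. *)
Definition whp_o1 (d : nat -> measure_display)
    (T : forall n, measurableType (d n)) (P : forall n, probability (T n) R)
    (Y : forall n, T n -> R) : Prop :=
  exists eps : nat -> R, eps @ \oo --> (0 : R) /\
  exists E : forall n, set (T n),
    [/\ forall n, measurable (E n),
        forall n t, E n t -> `|Y n t| <= eps n
      & (fun n => P n (E n)) @ \oo --> (1%E : \bar R)].

End Asymptotics.

Section LinearAlgebra.
Context {R : realType}.

Definition enorm n (x : 'cV[R]_n) : R := Num.sqrt (\sum_(i < n) x i 0 ^+ 2).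

Definition opnorm m n (A : 'M[R]_(m, n)) : R :=
  sup [set enorm (A *m x) | x in [set x : 'cV[R]_n | enorm x <= 1]].

Definition orthonormal_cols m n (A : 'M[R]_(m, n)) : Prop := A^T *m A = 1%:M.

Definition is_svd m l (M : 'M[R]_(m, l))
    (U : 'M[R]_(m, l)) (s : seq R) (V : 'M[R]_l) : Prop :=
  [/\ orthonormal_cols U, orthonormal_cols V,
      [/\ size s = l, sorted >=%R s & all (>= 0) s]
    & M = U *m diag_mx (\row_(i < l) s`_i) *m V^T].

(* The i-th singular value, counted from 1; it is 0 beyond the last one. *)
Definition singval (s : seq R) (i : nat) : R := s`_i.-1.

Definition first_cols l n k (hk : (k <= n)%N) (V : 'M[R]_(l, n)) :
  'M[R]_(l, k) := colsub (widen_ord hk) V.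

(* The rows of kermx B span the row vectors u with u *m B = 0, that is, the
   transpose of the orthogonal complement of the column span of B. *)
Definition is_perp l k p (B : 'M[R]_(l, k)) (W : 'M[R]_(l, p)) : Prop :=
  orthonormal_cols W /\ (W^T == kermx B)%MS.

(* R^T is lower triangular, i.e., R is upper triangular. No sign is imposed on
   the diagonal of R, and B may be rank deficient. *)
Definition is_qr l k (B Q : 'M[R]_(l, k)) (Rf : 'M[R]_k) : Prop :=
  [/\ B = Q *m Rf, orthonormal_cols Q & is_trig_mx Rf^T].

End LinearAlgebra.

Section Algorithms.
Context {R : realType}.

Definition qr_iterations (l : nat) : nat :=
  `|Num.ceil (10%:R * ln (l%:R : R))|%N.

(* Q is a possible output of QR(Phi, k) started at Q0. *)
Definition qr_output l k (Phi : 'M[R]_l) (Q0 Q : 'M[R]_(l, k)) : Prop :=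
  exists (Qs : nat -> 'M[R]_(l, k)) (Rs : nat -> 'M[R]_k),
    [/\ Qs 0%N = Q0,
        forall tau, (tau < qr_iterations l)%N ->
          is_qr (Phi *m Qs tau) (Qs tau.+1) (Rs tau.+1)
      & Q = Qs (qr_iterations l)].

Definition delta_hat m l (A : 'M[R]_(m, l)) : R :=
  (m%:R * l%:R)^-1 * \sum_(i < m) \sum_(j < l) (0 < A i j)%R%:R.

Definition row_weight m l (A : 'M[R]_(m, l)) (i : 'I_m) : nat :=
  #|[set j | A i j != 0]%SET|.

(* Erased rows are set to zero. *)
Definition trimming m l (A : 'M[R]_(m, l)) : 'M[R]_(m, l) :=
  \matrix_(i, j)
    if Num.max 10%:R (10%:R * delta_hat A * l%:R) < (row_weight A i)%:R
    then 0 else A i j.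

Definition diag_part l (B : 'M[R]_l) : 'M[R]_l := diag_mx (\row_i B i i).

Definition spca_Phi m l (A : 'M[R]_(m, l)) : 'M[R]_l :=
  let B := (trimming A)^T *m trimming A in B - diag_part B.

(* Vhat is a possible output of SPCA on A and k, when the random initial
   matrix of QR is Q0. *)
Definition spca_output m l k (A : 'M[R]_(m, l)) (Q0 Vhat : 'M[R]_(l, k)) :
  Prop := qr_output (spca_Phi A) Q0 Vhat.

End Algorithms.

Section Model.
Context {R : realType} {d : measure_display} {T : measurableType d}.
Variable P : probability T R.

Definition mutually_independent (I : finType) (G : I -> set (set T)) : Prop :=
  forall (J : {set I}) (E : I -> set T), (forall i, i \in J -> G i (E i)) ->
    P (\bigcap_(i in [set` J]) E i) = (\prod_(i in J) P (E i))%E.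

(* The Borel sets of matrices, generated by the entries. *)
Definition borel_mx p q : set (set 'M[R]_(p, q)) :=
  <<s \bigcup_(ij in [set: 'I_p * 'I_q])
        preimage_set_system setT (fun B : 'M[R]_(p, q) => B ij.1 ij.2)
          measurable >>.

(* Q has the uniform (Haar) law on the l x k matrices with orthonormal columns,
   the only law on them that is invariant under the orthogonal group. *)
Definition uniform_orthonormal l k (Q : T -> 'M[R]_(l, k)) : Prop :=
  [/\ forall t, orthonormal_cols (Q t),
      forall B, borel_mx B -> measurable (Q @^-1` B)
    & forall O : 'M[R]_l, orthonormal_cols O -> forall B, borel_mx B ->
        P [set t | B (O *m Q t)] = P (Q @^-1` B)].

Definition proj_obs m l (Om : {set 'I_m * 'I_l}) (Y : 'M[R]_(m, l)) :
  'M[R]_(m, l) := \matrix_(i, j) if (i, j) \in Om then Y i j else 0.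

Definition sigma_of m l k (X : T -> 'M[R]_(m, l))
    (Om : T -> {set 'I_m * 'I_l}) (Q0 : T -> 'M[R]_(l, k))
    (i : ('I_m * 'I_l) + ('I_m * 'I_l) + unit) : set (set T) :=
  match i with
  | inl (inl (i, j)) => g_sigma_algebra_preimage (fun t => X t i j)
  | inl (inr (i, j)) => g_sigma_algebra_preimage (fun t => (i, j) \in Om t)
  | inr _ => preimage_set_system setT Q0 (@borel_mx l k)
  end.

(* The joint law of the noise X, the set Om of observed entries and the initial
   matrix Q0 of QR: the entries of X, the indicators of Om and the matrix Q0
   are mutually independent. *)
Record random_model m l k (M : 'M[R]_(m, l)) (delta : R)
    (X : T -> 'M[R]_(m, l)) (Om : T -> {set 'I_m * 'I_l})
    (Q0 : T -> 'M[R]_(l, k)) : Prop := RandomModel {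
  noise_measurable : forall i j, measurable_fun setT (fun t => X t i j);
  noise_range : forall t i j, 0 <= (M + X t) i j <= 1;
  noise_mean0 : forall i j, ('E_P[fun t => X t i j] = 0)%E;
  obs_measurable : forall i j, measurable [set t | (i, j) \in Om t];
  obs_proba : forall i j, P [set t | (i, j) \in Om t] = delta%:E;
  init_uniform : uniform_orthonormal Q0;
  model_independent : mutually_independent (sigma_of X Om Q0) }.

End Model.

(* Main.v *)
Require Import Defs.
From HB Require Import structures.
From mathcomp Require Import all_boot all_order all_algebra.
From mathcomp Require Import all_classical all_reals all_analysis.
From mathcomp Require Import measurable_realfun.
From mathcomp Require Import ring lra zify.

Set Implicit Arguments.
Unset Strict Implicit.
Unset Printing Implicit Defensive.

Import Order.TTheory GRing.Theory Num.Theory.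
Import numFieldNormedType.Exports.

Local Open Scope classical_set_scope.
Local Open Scope ring_scope.

(** Write [Phi] for the matrix iterated by QR.  On the event that the trimming
    threshold is 10, which has high probability since [l * delta] tends to 0,
    [Phi] is the sum over the rows [a] of the observed matrix of the
    off-diagonal parts of the outer products of [a] with itself, restricted to
    the rows with at most 10 nonzero entries.  The proof has four parts.

    Concentration ([deviation], [mean_near]).  The rows are independent, each
    term has norm at most 10, and the sum of their squares has row sums of order
    [m * l * delta ^ 2], with exponential moments.  Symmetrization and
    Khintchine's inequality in trace form, [khintchine_opnorm], bound the
    mean fluctuation of [Phi] by [600 * delta * sqrt (m * l * ln l)].  The mean of
    [Phi] is [C^T C] up to an error of order [m * delta ^ 2], where [C] is
    [delta * M] with its [i]-th row multiplied by the square root of a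
    probability close to 1, roughly that of keeping the row.  Both errors are
    negligible against [(delta * s_k) ^ 2].  Passing from [delta * M] to [C]
    may change the Gram matrix by much more than [(delta * s_k) ^ 2], because
    nothing bounds [s_1 / s_k]; but multiplying rows does not move the row space
    of the leading part of [M], see [near_gram_rows].

    Power iteration ([power_iteration]).  If [Phi] is close to [C^T C], then the
    cone of the vectors that are close to the column span of [V1] is invariant
    under [Phi], which expands them by a large factor ([cone_iter]), and the
    vectors orthogonal to [Phi ^ N V1] are contracted by [Phi ^ N]
    ([bottom_iter]).  These two facts replace the spectral decomposition of
    [Phi].  They give the conclusion as soon as [Q0^T Phi ^ N V1] is not too
    degenerate: the ratio of the two factors tends to 0, so over [10 ln l]
    iterations it beats any power of [l].

    Random start ([uniform_well_conditioned]).  For a fixed [W] with orthonormal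
    columns, [W^T Q0] is well conditioned up to a power of [l]: by invariance, a
    column of [W] can be replaced with the normalized projection of any integer
    vector away from the other columns, and few integer vectors are almost
    orthogonal to a given unit vector.

    Conditioning on [Phi] ([cell_prob]).  The matrix [W] spanning
    [Phi ^ N V1] is random but independent of [Q0].  Rounding the entries of the
    observed matrix up to a fine grid splits the probability space into finitely
    many cells, on each of which [Phi] is almost constant; the cells have
    product weights and are independent of [Q0].  Hence all expectations above
    are finite sums, and [Q0] meets one matrix [W] per cell. *)

(** * Euclidean norms and operator norms *)

Section Euclid.
Context {R : realType}.

Definition dot n (x y : 'cV[R]_n) : R := (x^T *m y) 0 0.

Lemma dotE n (x y : 'cV[R]_n) : dot x y = \sum_i x i 0 * y i 0.
Proof. by rewrite /dot mxE; apply: eq_bigr => i _; rewrite mxE. Qed.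

Lemma dotC n (x y : 'cV[R]_n) : dot x y = dot y x.
Proof. by rewrite !dotE; apply: eq_bigr => i _; rewrite mulrC. Qed.

Lemma dotDr n (x y z : 'cV[R]_n) : dot x (y + z) = dot x y + dot x z.
Proof. by rewrite /dot mulmxDr mxE. Qed.

Lemma dotDl n (x y z : 'cV[R]_n) : dot (x + y) z = dot x z + dot y z.
Proof. by rewrite !(dotC _ z) dotDr. Qed.

Lemma dotNr n (x y : 'cV[R]_n) : dot x (- y) = - dot x y.
Proof. by rewrite /dot mulmxN mxE. Qed.

Lemma dotBr n (x y z : 'cV[R]_n) : dot x (y - z) = dot x y - dot x z.
Proof. by rewrite dotDr dotNr. Qed.

Lemma dotBl n (x y z : 'cV[R]_n) : dot (x - y) z = dot x z - dot y z.
Proof. by rewrite !(dotC _ z) dotBr. Qed.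

Lemma dotZr n a (x y : 'cV[R]_n) : dot x (a *: y) = a * dot x y.
Proof. by rewrite /dot -scalemxAr mxE. Qed.

Lemma dotZl n a (x y : 'cV[R]_n) : dot (a *: x) y = a * dot x y.
Proof. by rewrite !(dotC _ y) dotZr. Qed.

Lemma dot0r n (x : 'cV[R]_n) : dot x 0 = 0.
Proof. by rewrite /dot mulmx0 mxE. Qed.

Lemma dot0l n (x : 'cV[R]_n) : dot 0 x = 0.
Proof. by rewrite dotC dot0r. Qed.

Lemma dot_sumr n (I : Type) (r : seq I) (P : pred I) (x : 'cV[R]_n) F :
  dot x (\sum_(i <- r | P i) F i) = \sum_(i <- r | P i) dot x (F i).
Proof. by rewrite /dot mulmx_sumr summxE. Qed.

Lemma dot_mull m n (A : 'M[R]_(m, n)) x y : dot (A *m x) y = dot x (A^T *m y).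
Proof. by rewrite /dot trmx_mul mulmxA. Qed.

Lemma dot_mulr m n (A : 'M[R]_(m, n)) x y : dot x (A *m y) = dot (A^T *m x) y.
Proof. by rewrite dotC dot_mull dotC. Qed.

Lemma dot_ge0 n (x : 'cV[R]_n) : 0 <= dot x x.
Proof. by rewrite dotE sumr_ge0 // => i _; rewrite -expr2 sqr_ge0. Qed.

Lemma enormE n (x : 'cV[R]_n) : enorm x = Num.sqrt (dot x x).
Proof.
by rewrite /enorm dotE; congr Num.sqrt; apply: eq_bigr => i _; rewrite expr2.
Qed.

Lemma enorm_ge0 n (x : 'cV[R]_n) : 0 <= enorm x.
Proof. exact: sqrtr_ge0. Qed.

Lemma enorm_sqr n (x : 'cV[R]_n) : enorm x ^+ 2 = dot x x.
Proof. by rewrite enormE sqr_sqrtr // dot_ge0. Qed.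

Lemma enorm_sum n (x : 'cV[R]_n) : enorm x ^+ 2 = \sum_i x i 0 ^+ 2.
Proof. by rewrite enorm_sqr dotE; apply: eq_bigr => i _; rewrite expr2. Qed.

Lemma enorm0 n : enorm (0 : 'cV[R]_n) = 0.
Proof. by rewrite enormE dot0r sqrtr0. Qed.

Lemma enorm_eq0 n (x : 'cV[R]_n) : enorm x = 0 -> x = 0.
Proof.
move=> x0; have := enorm_sum x; rewrite x0 expr0n /= => /esym/eqP.
rewrite psumr_eq0; last by move=> i _; rewrite sqr_ge0.
move=> /allP h; apply/colP => i; rewrite mxE.
by apply/eqP; rewrite -sqrf_eq0; apply: h; rewrite mem_index_enum.
Qed.

Lemma enorm_gt0 n (x : 'cV[R]_n) : x != 0 -> 0 < enorm x.
Proof.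
by move=> x0; rewrite lt0r enorm_ge0 andbT; apply: contra x0 => /eqP/enorm_eq0 ->.
Qed.

Lemma enormZ n a (x : 'cV[R]_n) : enorm (a *: x) = `|a| * enorm x.
Proof.
by rewrite !enormE dotZl dotZr mulrA -expr2 sqrtrM ?sqr_ge0 // sqrtr_sqr.
Qed.

Lemma enormN n (x : 'cV[R]_n) : enorm (- x) = enorm x.
Proof. by rewrite -scaleN1r enormZ normrN1 mul1r. Qed.

(** From the sign of the form at [dot y (B y) x - dot x (B y) y] and at its
    mirror, and at [x - dot x (B y) y] when both diagonal values vanish. *)
Lemma psd_cauchy n (B : 'M[R]_n) (x y : 'cV[R]_n) :
  B^T = B -> (forall z, 0 <= dot z (B *m z)) ->
  dot x (B *m y) ^+ 2 <= dot x (B *m x) * dot y (B *m y).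
Proof.
move=> symB psd.
set a := dot x (B *m x); set b := dot x (B *m y); set c := dot y (B *m y).
have byx : dot y (B *m x) = b by rewrite dot_mulr symB dotC.
have key s t : 0 <= s ^+ 2 * a + 2%:R * s * t * b + t ^+ 2 * c.
  have := psd (s *: x + t *: y).
  rewrite mulmxDr -!scalemxAr !(dotDr, dotDl) !(dotZl, dotZr) byx -/a -/b -/c.
  by congr (_ <= _); ring.
have a0 : 0 <= a by exact: psd.
have c0 : 0 <= c by exact: psd.
have := key c (- b); have := key (- b) a; have := key 1 (- b); have := key (- b) 1.
move=> h1 h2 h3 h4.
have [cp|cn] := ltP 0 c.
  rewrite -subr_ge0 -(pmulr_rge0 _ cp).
  by move: h4; congr (_ <= _); ring.
have c00 : c = 0 by apply/eqP; rewrite eq_le cn.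
have [ap|an] := ltP 0 a.
  rewrite -subr_ge0 -(pmulr_rge0 _ ap).
  by move: h3; congr (_ <= _); ring.
have a00 : a = 0 by apply/eqP; rewrite eq_le an.
by move: h2; rewrite c00 a00 !mulr0 addr0; nra.
Qed.

Lemma cauchy_sqr n (x y : 'cV[R]_n) : dot x y ^+ 2 <= dot x x * dot y y.
Proof.
have := @psd_cauchy n 1%:M x y; rewrite !mul1mx; apply; first by rewrite trmx1.
by move=> z; rewrite mul1mx dot_ge0.
Qed.

Lemma cauchy_abs n (x y : 'cV[R]_n) : `|dot x y| <= enorm x * enorm y.
Proof.
rewrite -ler_sqr ?nnegrE ?mulr_ge0 ?enorm_ge0 //.
by rewrite exprMn !enorm_sqr -normrX ger0_norm ?sqr_ge0 // cauchy_sqr.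
Qed.

Lemma cauchy n (x y : 'cV[R]_n) : dot x y <= enorm x * enorm y.
Proof. exact: le_trans (ler_norm _) (cauchy_abs _ _). Qed.

Lemma cauchy_ge n (x y : 'cV[R]_n) : - (enorm x * enorm y) <= dot x y.
Proof. by have := cauchy_abs x y; rewrite ler_norml => /andP[]. Qed.

Lemma enormD n (x y : 'cV[R]_n) : enorm (x + y) <= enorm x + enorm y.
Proof.
rewrite -ler_sqr ?nnegrE ?addr_ge0 ?enorm_ge0 //.
rewrite sqrrD !enorm_sqr dotDl !dotDr (dotC y x).
by have := cauchy x y; rewrite mulr2n; lra.
Qed.

Lemma enormB_ge n (x y : 'cV[R]_n) : enorm x - enorm y <= enorm (x - y).
Proof. by have := enormD (x - y) y; rewrite subrK; lra. Qed.

Lemma enorm_isom m n (W : 'M[R]_(m, n)) x :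
  orthonormal_cols W -> enorm (W *m x) = enorm x.
Proof. by move=> hW; rewrite !enormE dot_mull mulmxA hW mul1mx. Qed.

Lemma enorm_orthoD n (x y : 'cV[R]_n) :
  dot x y = 0 -> enorm (x + y) ^+ 2 = enorm x ^+ 2 + enorm y ^+ 2.
Proof. by move=> h; rewrite !enorm_sqr dotDl !dotDr (dotC y x) h addr0 add0r. Qed.

Lemma enorm_trmul m n (W : 'M[R]_(m, n)) x :
  orthonormal_cols W -> enorm (W^T *m x) <= enorm x.
Proof.
move=> hW; set y := W^T *m x.
have h : dot y y <= enorm x * enorm y.
  by rewrite {1}/y dot_mull trmxK -(enorm_isom y hW) cauchy.
have := enorm_ge0 y; have := enorm_ge0 x; move: h; rewrite -enorm_sqr; nra.
Qed.

Lemma unitmx_inj n (A : 'M[R]_n) :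
  (forall x : 'cV_n, A *m x = 0 -> x = 0) -> A \in unitmx.
Proof.
move=> inj; rewrite -unitmx_tr -row_free_unit; apply/row_freeP.
have /eqP h : kermx A^T == 0.
  apply/eqP/row_matrixP => i; rewrite row0.
  apply: trmx_inj; rewrite trmx0; apply: inj.
  by apply: trmx_inj; rewrite trmx_mul trmxK trmx0 -row_mul mulmx_ker row0.
have := mxrank_ker A^T; rewrite h mxrank0 => /esym/eqP.
by rewrite subn_eq0 => hr; apply/row_freeP; rewrite /row_free eqn_leq rank_leq_row hr.
Qed.

(** If a square matrix is bounded below, so is its transpose: solving
    [A^T d = c] gives [|c|^2 = dot (A c) d]. *)
Lemma trmx_bounded_below n (A : 'M[R]_n) (r : R) : 0 < r ->
  (forall d : 'cV_n, r * enorm d <= enorm (A^T *m d)) ->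
  A \in unitmx /\ forall c : 'cV_n, r * enorm c <= enorm (A *m c).
Proof.
move=> r0 h.
have u : A^T \in unitmx.
  apply: unitmx_inj => x x0; apply: enorm_eq0; have := h x.
  by rewrite x0 enorm0 => hx; have := enorm_ge0 x; nra.
split; first by rewrite -unitmx_tr.
move=> c; set d := invmx A^T *m c.
have hd : A^T *m d = c by rewrite mulmxA mulmxV // mul1mx.
have := h d; rewrite hd => hrd.
have hc : enorm c ^+ 2 <= enorm (A *m c) * enorm d.
  by rewrite enorm_sqr -{2}hd -dot_mull cauchy.
have [c0|c0] := eqVneq (enorm c) 0.
  by rewrite (enorm_eq0 c0) mulmx0 enorm0 mulr0.
have cp : 0 < enorm c by rewrite lt0r c0 enorm_ge0.
rewrite -(ler_pM2r cp).
have := enorm_ge0 (A *m c); nra.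
Qed.

Lemma opnorm_le m n (A : 'M[R]_(m, n)) (c : R) : 0 <= c ->
  (forall x, enorm (A *m x) <= c * enorm x) -> opnorm A <= c.
Proof.
move=> c0 h; apply: ge_sup.
  by exists (enorm (A *m 0)), 0 => //=; rewrite enorm0.
move=> _ [x /= x1 <-]; apply: le_trans (h x) _.
by rewrite -[leRHS]mulr1 ler_wpM2l.
Qed.

Lemma weighted_cauchy (I : finType) (b x : I -> R) : (forall i, 0 <= b i) ->
  (\sum_i b i * x i) ^+ 2 <= (\sum_i b i) * \sum_i b i * x i ^+ 2.
Proof.
move=> b0.
pose u : 'cV[R]_#|I| := \col_i Num.sqrt (b (enum_val i)).
pose v : 'cV[R]_#|I| := \col_i (Num.sqrt (b (enum_val i)) * x (enum_val i)).
have E (F : I -> R) : \sum_i F i = \sum_(i < #|I|) F (enum_val i).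
  by rewrite -(big_enum_val (A := I)) /=; apply: eq_bigl.
have := cauchy_sqr u v; rewrite !dotE !E.
congr (_ ^+ 2 <= _ * _); apply: eq_bigr => i _; rewrite !mxE.
- by rewrite mulrA -expr2 sqr_sqrtr.
- by rewrite -expr2 sqr_sqrtr.
- by rewrite -expr2 exprMn sqr_sqrtr.
Qed.

(** Schur's test: Cauchy-Schwarz on each row, weighted by the absolute values
    of its entries, and then the same bound on the columns by symmetry. *)
Lemma schur_test n (B : 'M[R]_n) (r : R) : B^T = B ->
  (forall j, \sum_p `|B j p| <= r) -> forall x, enorm (B *m x) <= r * enorm x.
Proof.
move=> symB hr x.
case: n => [|n] in B symB hr x *.
  have z (y : 'cV[R]_0) : enorm y = 0 by rewrite /enorm big_ord0 sqrtr0.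
  by rewrite !z mulr0.
have r0 : 0 <= r by apply: le_trans (hr 0); rewrite sumr_ge0.
rewrite -ler_sqr ?nnegrE ?mulr_ge0 ?enorm_ge0 //.
rewrite exprMn !enorm_sum.
apply: (@le_trans _ _ (\sum_j r * \sum_p `|B j p| * x p 0 ^+ 2)).
  apply: ler_sum => j _; rewrite mxE.
  have -> : \sum_p B j p * x p 0 = \sum_p `|B j p| * (Num.sg (B j p) * x p 0).
    by apply: eq_bigr => p _; rewrite mulrA [`|_| * _]mulrC -numEsg.
  apply: le_trans (weighted_cauchy _ _) _ => //.
  apply: (@le_trans _ _ ((\sum_p `|B j p|) * \sum_p `|B j p| * x p 0 ^+ 2)).
    rewrite ler_wpM2l ?sumr_ge0 //; apply: ler_sum => p _.
    rewrite ler_wpM2l // exprMn -[leRHS]mul1r ler_wpM2r ?sqr_ge0 //.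
    by rewrite sqr_sg lern1 leq_b1.
  by rewrite ler_wpM2r // sumr_ge0 // => p _; rewrite mulr_ge0 ?sqr_ge0.
rewrite -mulr_sumr expr2 -mulrA ler_wpM2l // exchange_big /= mulr_sumr.
apply: ler_sum => p _; rewrite -mulr_suml ler_wpM2r ?sqr_ge0 //.
apply: le_trans (hr p); apply: ler_sum => j _.
by rewrite -{1}symB mxE.
Qed.

Lemma frobenius_ge m n (A : 'M[R]_(m, n)) x :
  enorm (A *m x) ^+ 2 <= (\sum_i \sum_j A i j ^+ 2) * enorm x ^+ 2.
Proof.
rewrite enorm_sum mulr_suml; apply: ler_sum => i _.
have := cauchy_sqr (row i A)^T x.
rewrite -!enorm_sqr enorm_sum [X in _ <= X * _ -> _](_ : _ = \sum_j A i j ^+ 2).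
  by congr (_ ^+ 2 <= _); rewrite /dot trmxK !mxE; apply: eq_bigr => j _; rewrite !mxE.
by apply: eq_bigr => j _; rewrite !mxE.
Qed.

Lemma opnorm_has_sup m n (A : 'M[R]_(m, n)) :
  has_sup [set enorm (A *m x) | x in [set x : 'cV[R]_n | enorm x <= 1]].
Proof.
split; first by exists (enorm (A *m 0)), 0 => //=; rewrite enorm0.
exists (Num.sqrt (\sum_i \sum_j A i j ^+ 2)) => _ [x /= x1 <-].
have F0 : 0 <= \sum_i \sum_j A i j ^+ 2.
  by rewrite sumr_ge0 // => i _; rewrite sumr_ge0 // => j _; rewrite sqr_ge0.
rewrite -ler_sqr ?nnegrE ?enorm_ge0 ?sqrtr_ge0 // [leRHS]sqr_sqrtr //.
apply: le_trans (frobenius_ge _ _) _; rewrite -[leRHS]mulr1 ler_wpM2l //.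
by rewrite expr_le1 ?enorm_ge0.
Qed.

Lemma opnorm_ge0 m n (A : 'M[R]_(m, n)) : 0 <= opnorm A.
Proof.
apply: (@le_trans _ _ (enorm (A *m (0 : 'cV_n)))); first exact: enorm_ge0.
apply: (sup_upper_bound (opnorm_has_sup A)).
by exists 0 => //=; rewrite enorm0.
Qed.

Lemma enorm_mul_le m n (A : 'M[R]_(m, n)) x :
  enorm (A *m x) <= opnorm A * enorm x.
Proof.
have [->|x0] := eqVneq x 0; first by rewrite mulmx0 !enorm0 mulr0.
have xp := enorm_gt0 x0.
rewrite -ler_pdivrMr //; apply: (@sup_upper_bound _ _ (opnorm_has_sup A)).
exists ((enorm x)^-1 *: x).
  by rewrite /= enormZ ger0_norm ?invr_ge0 ?enorm_ge0 // mulVf // gt_eqF.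
by rewrite -scalemxAr enormZ ger0_norm ?invr_ge0 ?enorm_ge0 // mulrC.
Qed.

Lemma opnormD m n (A B : 'M[R]_(m, n)) : opnorm (A + B) <= opnorm A + opnorm B.
Proof.
apply: opnorm_le => [|x]; first by rewrite addr_ge0 ?opnorm_ge0.
rewrite mulmxDl; apply: le_trans (enormD _ _) _.
by rewrite mulrDl lerD ?enorm_mul_le.
Qed.

Lemma opnormZ_le m n a (A : 'M[R]_(m, n)) : opnorm (a *: A) <= `|a| * opnorm A.
Proof.
apply: opnorm_le => [|x]; first by rewrite mulr_ge0 ?opnorm_ge0.
by rewrite -scalemxAl enormZ -mulrA ler_wpM2l ?enorm_mul_le.
Qed.

Lemma opnorm_sum m n (I : Type) (r : seq I) (P : pred I) (F : I -> 'M[R]_(m, n)) :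
  opnorm (\sum_(i <- r | P i) F i) <= \sum_(i <- r | P i) opnorm (F i).
Proof.
elim/big_rec2: _ => [|i x y _ h].
  by apply: opnorm_le => // x; rewrite mul0mx enorm0 mul0r.
by apply: le_trans (opnormD _ _) _; rewrite lerD2l.
Qed.

End Euclid.

(** * Power iteration on a matrix close to a Gram matrix *)

Section PowerIteration.
Context {R : realType}.

Lemma mxpowS n (A : 'M[R]_n) j : A ^+ j.+1 = A *m A ^+ j.
Proof. exact: exprS. Qed.

Lemma mxpowSr n (A : 'M[R]_n) j : A ^+ j.+1 = A ^+ j *m A.
Proof. exact: exprSr. Qed.

Lemma mxpowD n (A : 'M[R]_n) i j : A ^+ (i + j) = A ^+ i *m A ^+ j.
Proof. exact: exprD. Qed.

Lemma mxpow_sym n (A : 'M[R]_n) j : A^T = A -> (A ^+ j)^T = A ^+ j.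
Proof.
move=> symA; elim: j => [|j ih]; first exact: trmx1.
by rewrite mxpowS trmx_mul ih symA -mxpowSr mxpowS.
Qed.

(** [Phi] is [C^T C] up to [eta * c ^ 2], and [C] is at least [c] on the column
    span of [V1] and at most [eta * c] on its orthogonal complement.  On the
    span of [V1] it may be arbitrarily large, so [Phi] need not be block diagonal
    up to a small error. *)
Record near_gram m l k (Phi : 'M[R]_l) (C : 'M[R]_(m, l)) (V1 : 'M[R]_(l, k))
    (c eta : R) : Prop := NearGram {
  ng_sym : Phi^T = Phi;
  ng_orth : orthonormal_cols V1;
  ng_c : 0 < c;
  ng_eta : 0 <= eta <= 1 / 100%:R;
  ng_top : forall y, c * enorm y <= enorm (C *m (V1 *m y));
  ng_bot : forall w, V1^T *m w = 0 -> enorm (C *m w) <= eta * c * enorm w;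
  ng_err : forall x,
    enorm (Phi *m x - C^T *m (C *m x)) <= eta * c ^+ 2 * enorm x }.

Section NearGram.
Context m l k (Phi : 'M[R]_l) (C : 'M[R]_(m, l)) (V1 : 'M[R]_(l, k)) (c eta : R).
Context (ng : near_gram Phi C V1 c eta).

Definition residual (x : 'cV[R]_l) := x - V1 *m (V1^T *m x).

Lemma residual_orth x : V1^T *m residual x = 0.
Proof. by rewrite mulmxBr [X in _ - X]mulmxA (ng_orth ng) mul1mx subrr. Qed.

Lemma dot_residual (w x : 'cV[R]_l) : V1^T *m w = 0 -> dot w (residual x) = dot w x.
Proof. by move=> h; rewrite dotBr dot_mulr h dot0l subr0. Qed.

(** Both parts of [Phi x] are compared with [|C x|] rather than [|x|], which
    keeps the norm of [C] out of the estimates: a vector orthogonal to [V1] sees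
    [C^T C x] only through the small part of [C], hence the residual is at most
    of order [eta * c * |C x|], whereas the part along [V1] is at least of order
    [c * |C x|]. *)
Lemma cone_step x :
  enorm (residual x) <= 8%:R * eta * enorm (V1^T *m x) ->
  enorm (residual (Phi *m x)) <= 8%:R * eta * enorm (V1^T *m (Phi *m x)) /\
  c ^+ 2 / 2%:R * enorm (V1^T *m x) <= enorm (V1^T *m (Phi *m x)).
Proof.
have [_ _ c0 /andP[eta0 eta1] top bot err] := ng; have c0' := ltW c0.
set y := V1^T *m x; set w := residual x.
set y' := V1^T *m (Phi *m x); set w' := residual (Phi *m x) => hw.
have xE : x = V1 *m y + w by rewrite /w /residual addrC subrK.
set f := enorm (C *m x).
set E := Phi *m x - C^T *m (C *m x).
have PhiE : Phi *m x = C^T *m (C *m x) + E by rewrite /E addrC subrK.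
have vy : enorm (V1 *m y) = enorm y by rewrite enorm_isom //; exact: ng_orth ng.
have hCw := bot _ (residual_orth x); rewrite -/w in hCw.
have hE := err x; rewrite -/E in hE.
have hf : c * enorm y - eta * c * enorm w <= f.
  rewrite /f {1}xE mulmxDr -[C *m w]opprK.
  apply: le_trans (enormB_ge _ _); rewrite enormN.
  by have := top y; lra.
have hX : enorm x <= enorm y + enorm w by rewrite {1}xE -vy enormD.
have hw' : enorm w' <= eta * c * f + eta * c ^+ 2 * enorm x.
  have [->|w0] := eqVneq (enorm w') 0.
    by rewrite addr_ge0 ?mulr_ge0 ?sqr_ge0 ?enorm_ge0 // ltW.
  have wp : 0 < enorm w' by rewrite lt0r w0 enorm_ge0.
  have o' : V1^T *m w' = 0 by exact: residual_orth.
  rewrite -(ler_pM2l wp) -expr2 enorm_sqr {2}/w' dot_residual // PhiE dotDr.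
  rewrite dot_mulr trmxK.
  have h1 := cauchy (C *m w') (C *m x); have h2 := cauchy w' E.
  have h3 := bot _ o'; rewrite -/f in h1.
  have f0 : 0 <= f by exact: enorm_ge0.
  rewrite mulrDr lerD //.
    by apply: le_trans h1 _; rewrite mulrCA mulrA ler_wpM2r // mulrAC (mulrC _ c) mulrA.
  by apply: le_trans h2 _; rewrite ler_wpM2l // ltW.
have hy' : f * (f - eta * c * enorm w) - eta * c ^+ 2 * enorm x * enorm y
    <= enorm y' * enorm y.
  apply: le_trans (cauchy y' y); rewrite /y' dot_mull trmxK {1}PhiE dotDl.
  have -> : dot (C^T *m (C *m x)) (V1 *m y) = f ^+ 2 - dot (C *m x) (C *m w).
    rewrite dot_mull trmxK enorm_sqr -dotBr -mulmxBr; congr (dot _ (_ *m _)).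
    by rewrite [X in X - _]xE addrK.
  have h1 := cauchy (C *m x) (C *m w); have h2 := cauchy_ge E (V1 *m y).
  rewrite vy in h2; rewrite -/f in h1.
  have f0 : 0 <= f by exact: enorm_ge0.
  have y0 := enorm_ge0 y.
  have h3 : enorm E * enorm y <= eta * c ^+ 2 * enorm x * enorm y.
    by rewrite ler_wpM2r.
  have h4 : f * enorm (C *m w) <= f * (eta * c * enorm w) by rewrite ler_wpM2l.
  by rewrite mulrBr -expr2; lra.
have Y0 := enorm_ge0 y; have W0 := enorm_ge0 w; have Y'0 := enorm_ge0 y'.
have X0 := enorm_ge0 x.
have f0 : 0 <= f by exact: enorm_ge0.
move: hf hX hw' hy' hw Y0 W0 Y'0 X0.
have fy0 : enorm y = 0 -> enorm w = 0 -> f = 0.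
  move=> /enorm_eq0 y0 /enorm_eq0 w0; rewrite /f xE y0 w0 mulmx0 addr0 mulmx0.
  exact: enorm0.
move: (enorm y) (enorm w) (enorm y') (enorm x) (enorm w') fy0.
move=> Y W Y' X W' fy0 hf hX hw' hy' hw Y0 W0 Y'0 X0.
have hY8 : eta * Y <= 1 / 100%:R * Y by rewrite ler_wpM2r.
have hW : W <= 8%:R / 100%:R * Y by lra.
have cY0 : 0 <= c * Y by rewrite mulr_ge0 // ltW.
have hg : eta * c * W <= 1 / 1000%:R * (c * Y).
  have : eta * (c * W) <= 1 / 100%:R * (c * W) by rewrite ler_wpM2r ?mulr_ge0 // ltW.
  have : c * W <= c * (8%:R / 100%:R * Y) by rewrite ler_wpM2l // ltW.
  by rewrite mulrA; lra.
have hcf : 0 <= c * f by rewrite mulr_ge0 // ltW.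
have hcX : c * X <= 11%:R / 10%:R * f.
  have : c * X <= c * (108%:R / 100%:R * Y) by rewrite ler_wpM2l //; lra.
  by lra.
have hccX : c ^+ 2 * X <= 11%:R / 10%:R * (c * f).
  by have := ler_wpM2l (ltW c0) hcX; congr (_ <= _); ring.
have hlow : 9%:R / 10%:R * (c * f) <= Y'.
  have [Yz|Yn] := eqVneq Y 0.
    have Wz : W = 0 by apply: le_anti; rewrite W0 andbT; lra.
    by rewrite fy0 // !mulr0.
  have Yp : 0 < Y by rewrite lt0r Yn.
  rewrite -(ler_pM2r Yp); apply: le_trans hy'.
  have h1 : f * (98%:R / 100%:R * (c * Y)) <= f * (f - eta * c * W).
    by rewrite ler_wpM2l //; lra.
  have h2 : eta * (c ^+ 2 * X) * Y <= 1 / 100%:R * (11%:R / 10%:R * (c * f)) * Y.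
    rewrite ler_wpM2r //.
    apply: (@le_trans _ _ (1 / 100%:R * (c ^+ 2 * X))).
      by rewrite ler_wpM2r ?mulr_ge0 ?sqr_ge0.
    by rewrite ler_wpM2l //; lra.
  have : 0 <= c * f * Y by rewrite mulr_ge0.
  rewrite mulrA in h2; move: h1 h2; rewrite !mulrA; nra.
split.
  have h1 : eta * (c * f) <= eta * (10%:R / 9%:R * Y') by rewrite ler_wpM2l //; lra.
  have h2 : eta * (c ^+ 2 * X) <= eta * (11%:R / 10%:R * (c * f)).
    by rewrite ler_wpM2l.
  have : 0 <= eta * Y' by rewrite mulr_ge0.
  by move: h1 h2 hw'; rewrite !mulrA; nra.
have : c * (c * Y * (99%:R / 100%:R)) <= c * f by rewrite ler_wpM2l //; lra.
have : 0 <= c * (c * Y) by rewrite mulr_ge0 // ltW.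
by rewrite expr2; nra.
Qed.

Lemma cone_iter j (a : 'cV[R]_k) : let x := Phi ^+ j *m (V1 *m a) in
  enorm (residual x) <= 8%:R * eta * enorm (V1^T *m x) /\
  (c ^+ 2 / 2%:R) ^+ j * enorm a <= enorm (V1^T *m x).
Proof.
have [_ orth c0 /andP[eta0 _] _ _ _] := ng.
elim: j => [|j /= [ih1 ih2]] /=.
  have Va : V1^T *m (V1 *m a) = a by rewrite mulmxA orth mul1mx.
  rewrite expr0 !mul1mx /residual Va subrr enorm0 mul1r lexx.
  by rewrite !mulr_ge0 ?enorm_ge0.
rewrite mxpowS -mulmxA; have [h1 h2] := cone_step ih1; split => //.
apply: le_trans h2; rewrite exprS -mulrA ler_wpM2l //.
by rewrite divr_ge0 ?sqr_ge0.
Qed.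

(** For a vector [u] that [Phi] sends into the orthogonal complement of [V1],
    apply Cauchy-Schwarz to the positive semidefinite form of [Phi + alpha]
    at [u] and [Phi u], where [alpha] bounds the form of [Phi] on that
    complement.  This is a substitute for the spectral theorem. *)
Lemma bottom_step (u : 'cV[R]_l) : V1^T *m (Phi *m u) = 0 ->
  enorm (Phi *m u) <= 10%:R * eta * c ^+ 2 * enorm u.
Proof.
have [sym _ c0 /andP[eta0 eta1] top bot err] := ng; have c0' := ltW c0.
set y := Phi *m u => yV.
set al := 2%:R * eta * c ^+ 2.
have al0 : 0 <= al by rewrite !mulr_ge0 // ltW.
have formE z : dot z (Phi *m z) =
    enorm (C *m z) ^+ 2 + dot z (Phi *m z - C^T *m (C *m z)).
  by rewrite dotBr enorm_sqr (dot_mulr C^T) trmxK addrC subrK.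
have low z : - (eta * c ^+ 2 * enorm z ^+ 2) <= dot z (Phi *m z).
  rewrite formE; have h1 := cauchy_ge z (Phi *m z - C^T *m (C *m z)).
  have h2 := err z; have z0 := enorm_ge0 z.
  have h3 : enorm z * enorm (Phi *m z - C^T *m (C *m z)) <= enorm z * (eta * c ^+ 2 * enorm z).
    by rewrite ler_wpM2l.
  have := sqr_ge0 (enorm (C *m z)); lra.
have up : dot y (Phi *m y) <= al * enorm y ^+ 2.
  rewrite formE; have h1 := cauchy y (Phi *m y - C^T *m (C *m y)).
  have h2 := err y; have z0 := enorm_ge0 y.
  have h3 : enorm y * enorm (Phi *m y - C^T *m (C *m y)) <= enorm y * (eta * c ^+ 2 * enorm y).
    by rewrite ler_wpM2l.
  have h4 : enorm (C *m y) ^+ 2 <= (eta * c * enorm y) ^+ 2.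
    by rewrite ler_sqr ?nnegrE ?enorm_ge0 ?bot // !mulr_ge0 ?enorm_ge0 // ltW.
  have h5 : eta * (eta * (c * enorm y) ^+ 2) <= 1 / 100%:R * (eta * (c * enorm y) ^+ 2).
    by rewrite ler_wpM2r ?mulr_ge0 ?sqr_ge0.
  have h6 : 0 <= eta * (c * enorm y) ^+ 2 by rewrite mulr_ge0 ?sqr_ge0.
  rewrite /al; move: h1 h3 h4 h5 h6.
  rewrite !exprMn; move: (dot _ _) (enorm (Phi *m y - _)) => *; nra.
pose Psi := Phi + al%:M.
have PsiE z : Psi *m z = Phi *m z + al *: z.
  by rewrite /Psi mulmxDl mul_scalar_mx.
have symPsi : Psi^T = Psi by rewrite linearD /= sym tr_scalar_mx.
have psd z : 0 <= dot z (Psi *m z).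
  rewrite PsiE dotDr dotZr -enorm_sqr; have := low z.
  rewrite /al; have : 0 <= eta * c ^+ 2 * enorm z ^+ 2.
    by rewrite !mulr_ge0 ?enorm_ge0.
  by lra.
have key := psd_cauchy u y symPsi psd.
have e1 : dot u (Psi *m y) = enorm y ^+ 2 + al * dot u y.
  by rewrite PsiE dotDr dotZr dot_mulr sym enorm_sqr.
have e2 : dot u (Psi *m u) = dot u y + al * enorm u ^+ 2.
  by rewrite PsiE dotDr dotZr enorm_sqr.
have e3 : dot y (Psi *m y) <= 2%:R * al * enorm y ^+ 2.
  by rewrite PsiE dotDr dotZr -enorm_sqr; lra.
have e30 := psd y.
have b1 := cauchy u y; have b2 := cauchy_ge u y.
have -> : 10%:R * eta * c ^+ 2 = 5%:R * al by rewrite /al; ring.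
move: key; rewrite e1 e2 => key.
have U0 := enorm_ge0 u; have Y0 := enorm_ge0 y.
clear up low psd formE e1 e2 PsiE symPsi.
clearbody al Psi.
move: key e3 e30 b1 b2 U0 Y0.
move: (dot y (Psi *m y)) (dot u y) (enorm u) (enorm y) al al0.
move=> D d U Y a a0 key e3 e30 b1 b2 U0 Y0.
clear - key e3 e30 b1 b2 U0 Y0 a0.
rewrite leNgt; apply/negP => lt.
have aU : 0 <= a * U by rewrite mulr_ge0.
have Yp : 0 < Y by lra.
have h1 : Y * (Y - a * U) <= Y ^+ 2 + a * d.
  have : a * (- (U * Y)) <= a * d by rewrite ler_wpM2l.
  by rewrite expr2; lra.
have h2 : (Y * (Y - a * U)) ^+ 2 <= (Y ^+ 2 + a * d) ^+ 2.
  by rewrite ler_sqr ?nnegrE //; [|apply: le_trans h1]; rewrite mulr_ge0 //; lra.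
have h3 : (d + a * U ^+ 2) * D <= (U * (Y + a * U)) * (2%:R * a * Y ^+ 2).
  apply: (@le_trans _ _ ((U * (Y + a * U)) * D)).
    by rewrite ler_wpM2r // mulrDr expr2; lra.
  by rewrite ler_wpM2l // mulr_ge0 //; lra.
have h4 := le_trans h2 (le_trans key h3).
have h5 : (Y - a * U) ^+ 2 <= 2%:R * (a * U) * (Y + a * U).
  rewrite -(ler_pM2l (exprn_gt0 2 Yp)).
  by move: h4; congr (_ <= _); ring.
by nra.
Qed.

(** The norms of the iterates of a symmetric matrix are log-convex, so that the
    last ratio, which [bottom_step] controls, is the largest one. *)
Lemma bottom_iter N (z : 'cV[R]_l) : V1^T *m (Phi ^+ N *m z) = 0 ->
  enorm (Phi ^+ N *m z) <= (10%:R * eta * c ^+ 2) ^+ N * enorm z.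
Proof.
have [sym _ c0 /andP[eta0 eta1] _ _ _] := ng.
set q := 10%:R * eta * c ^+ 2.
have q0 : 0 <= q by rewrite !mulr_ge0 // ltW.
case: N => [|N]; first by rewrite !expr0 mul1mx mul1r.
set zz := fun j => enorm (Phi ^+ j *m z) => hV.
have zS j : Phi ^+ j.+1 *m z = Phi *m (Phi ^+ j *m z) by rewrite mxpowS mulmxA.
have lc j : zz j.+1 ^+ 2 <= zz j * zz j.+2.
  rewrite /zz enorm_sqr (zS j) dot_mull sym -!zS; exact: cauchy.
have last : zz N.+1 <= q * zz N.
  by rewrite /zz zS; apply: bottom_step; rewrite -zS.
have all_le j : (j <= N)%N -> zz (N - j).+1 <= q * zz (N - j)%N.
  elim: j => [|j ih] hj; first by rewrite subn0.
  have := ih (ltnW hj); have := lc (N - j.+1)%N.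
  have -> : (N - j = (N - j.+1).+1)%N by rewrite subnSK.
  move: (N - j.+1)%N => i h1 h2.
  have i0 : 0 <= zz i by exact: enorm_ge0.
  have i1 : 0 <= zz i.+1 by exact: enorm_ge0.
  have [->|n0] := eqVneq (zz i.+1) 0; first by rewrite mulr_ge0.
  have ip : 0 < zz i.+1 by rewrite lt0r n0.
  rewrite -(ler_pM2r ip) -expr2; apply: le_trans h1 _.
  by rewrite [leRHS]mulrAC mulrC ler_wpM2r.
have all_le' j : (j <= N.+1)%N -> zz j <= q ^+ j * zz 0%N.
  elim: j => [|j ih] hj; first by rewrite expr0 mul1r.
  have := all_le (N - j)%N (leq_subr _ _); rewrite subKn // => h.
  by apply: le_trans h _; rewrite exprS -mulrA ler_wpM2l // ih // ltnW.
by have := all_le' N.+1 (leqnn _); rewrite /zz expr0 mul1mx.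
Qed.

(** The columns of [Phi ^+ N *m Q0] split along [Phi ^+ N *m V1] and its
    orthogonal complement: the first part is carried by the cone of
    [cone_iter], the second one shrinks by [bottom_iter]. *)
Lemma power_iteration N (Q0 : 'M[R]_(l, k)) (rho : R) (v : 'cV[R]_l) :
  orthonormal_cols Q0 -> 0 < rho ->
  (forall d, rho * enorm d <= enorm (Q0^T *m (Phi ^+ N *m (V1 *m d)))) ->
  (Phi ^+ N *m Q0)^T *m v = 0 ->
  enorm (V1^T *m v) <=
    (8%:R * eta + (10%:R * eta * c ^+ 2) ^+ N / rho) * enorm v.
Proof.
move=> orthQ rho0 hrho hv.
have [sym orth c0 /andP[eta0 eta1] _ _ _] := ng.
set q := _ ^+ N; have q0 : 0 <= q by rewrite exprn_ge0 // !mulr_ge0 // ltW.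
have symN : (Phi ^+ N)^T = Phi ^+ N by exact: mxpow_sym.
set Y := Phi ^+ N *m V1.
have YtE : Y^T = V1^T *m Phi ^+ N by rewrite trmx_mul symN.
pose T := Y^T *m Q0.
have [uT hT] : T \in unitmx /\ forall d : 'cV_k, rho * enorm d <= enorm (T *m d).
  apply: trmx_bounded_below => // d.
  by rewrite trmx_mul trmxK -!mulmxA; exact: hrho.
have uY : Y^T *m Y \in unitmx.
  apply: unitmx_inj => x; rewrite -mulmxA => hx.
  have Yx0 : Y *m x = 0.
    by apply: enorm_eq0; rewrite enormE dot_mull hx dot0r sqrtr0.
  have PVx : Phi ^+ N *m (V1 *m x) = 0 by rewrite mulmxA.
  apply: enorm_eq0; have := hrho x; rewrite PVx mulmx0 enorm0.
  by have := enorm_ge0 x; nra.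
set nu := V1^T *m v.
set d := invmx T *m nu.
have Td : T *m d = nu by rewrite mulmxA mulmxV // mul1mx.
have hd : enorm d <= enorm nu / rho.
  by rewrite ler_pdivlMr // mulrC -Td.
set a := invmx (Y^T *m Y) *m (Y^T *m (Q0 *m d)).
set z := Q0 *m d - Y *m a.
have Yz : Y^T *m z = 0.
  have aE : (Y^T *m Y) *m a = Y^T *m (Q0 *m d).
    by rewrite /a; exact: mulKVmx.
  by rewrite mulmxBr [Y^T *m (Y *m a)]mulmxA aE subrr.
have hz : enorm z <= enorm d.
  have orthYz : dot (Y *m a) z = 0 by rewrite dot_mull Yz dot0r.
  have := enorm_orthoD orthYz; rewrite {1}/z addrC subrK enorm_isom // => hs.
  rewrite -ler_sqr ?nnegrE ?enorm_ge0 // hs; have := sqr_ge0 (enorm (Y *m a)); lra.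
have Vz : V1^T *m (Phi ^+ N *m z) = 0 by rewrite mulmxA -YtE.
have hzN := bottom_iter Vz; rewrite -/q in hzN.
set x1 := Phi ^+ N *m (Y *m a).
have x1E : x1 = Phi ^+ (N + N) *m (V1 *m a) by rewrite /x1 /Y mxpowD !mulmxA.
have [cone _] := cone_iter (N + N) a; rewrite -x1E in cone.
set x := Phi ^+ N *m (Q0 *m d).
have xE : x = x1 + Phi ^+ N *m z.
  by rewrite /x1 -mulmxDr /z addrC subrK.
have Vx : V1^T *m x = nu by rewrite /x mulmxA -YtE mulmxA.
have Vx1 : V1^T *m x1 = nu by rewrite -Vx xE mulmxDr Vz addr0.
have hvx : dot v x = 0.
  by rewrite /x mulmxA dot_mulr hv dot0l.
have xd : x = V1 *m nu + (residual x1 + Phi ^+ N *m z).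
  by rewrite {1}xE addrA; congr (_ + _); rewrite /residual Vx1 addrC subrK.
move: hvx; rewrite {1}xd dotDr dot_mulr -/nu -enorm_sqr => hvx.
have b1 := cauchy_ge v (residual x1 + Phi ^+ N *m z).
have b2 := enormD (residual x1) (Phi ^+ N *m z).
rewrite Vx1 in cone.
have v0 := enorm_ge0 v; have nu0 := enorm_ge0 nu.
have b3 : enorm (Phi ^+ N *m z) <= q / rho * enorm nu.
  apply: le_trans hzN _; rewrite -mulrA ler_wpM2l //.
  by apply: le_trans hz _; rewrite mulrC.
have b4 : enorm nu ^+ 2 <= enorm v * ((8%:R * eta + q / rho) * enorm nu).
  apply: (@le_trans _ _ (enorm v * enorm (residual x1 + Phi ^+ N *m z))); first by lra.
  by rewrite ler_wpM2l // mulrDl; lra.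
have [->|n0] := eqVneq (enorm nu) 0.
  by rewrite mulr_ge0 // addr_ge0 ?mulr_ge0 // invr_ge0 ltW.
have np : 0 < enorm nu by rewrite lt0r n0.
by rewrite -(ler_pM2r np) -expr2; move: b4; congr (_ <= _); ring.
Qed.

End NearGram.
End PowerIteration.

(** * Small balls: counting integer vectors, reflections, Borel sets of matrices *)

Section Counting.
Context {R : realType}.

(** Once the other coordinates are fixed, two values of the [j]-th one move the
    sum by at least [2 * eps], so at most one of them is good. *)
Lemma count_small l L (x : 'cV[R]_l) (eps : R) j :
  2%:R * eps <= `|x j 0| ->
  (#|[set n : {ffun 'I_l -> 'I_L} | (`|\sum_i (n i)%:R * x i 0| < eps)%R]%SET| * L
     <= L ^ l)%N.
Proof.
move=> hx; set S := [set n | _]%SET.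
pose upd (na : {ffun 'I_l -> 'I_L} * 'I_L) : {ffun 'I_l -> 'I_L} :=
  [ffun i => if i == j then na.2 else na.1 i].
have inj : {in finset.setX S [set: 'I_L]%SET &, injective upd}.
  move=> [n a] [n' a']; rewrite !inE /= !andbT => hn hn' /ffunP e.
  have ea : a = a' by have := e j; rewrite !ffunE eqxx.
  have eo i : i != j -> n i = n' i.
    by move=> ij; have := e i; rewrite !ffunE /= (negPf ij).
  have ej : n j = n' j.
    apply: contraTeq isT => nj /=.
    have dE : \sum_i (n i)%:R * x i 0 - \sum_i (n' i)%:R * x i 0
        = ((n j)%:R - (n' j)%:R) * x j 0.
      rewrite -sumrB (bigD1 j) //= big1 ?addr0 ?mulrBl // => i ij.
      by rewrite eo // subrr.
    have : `|((n j)%:R - (n' j)%:R) * x j 0| < 2%:R * eps.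
      rewrite -dE; apply: le_lt_trans (ler_normB _ _) _.
      by move: hn hn'; lra.
    rewrite ltNge => /negP[]; apply: le_trans hx _.
    rewrite normrM -[leLHS]mul1r ler_wpM2r //.
    have -> : (n j)%:R - (n' j)%:R = ((n j : nat)%:Z - (n' j : nat)%:Z)%:~R :> R.
      by rewrite intrB.
    rewrite -intr_norm -[1]/(1%:~R) ler_int -gtz0_ge1 normr_gt0 subr_eq0.
    by rewrite eqz_nat (inj_eq val_inj).
  congr (_, _) => //; apply/ffunP => i.
  by have [->|ij] := eqVneq i j; [|exact: eo].
have := card_in_imset inj; rewrite cardsX cardsT card_ord => <-.
by apply: leq_trans (max_card _) _; rewrite card_ffun !card_ord.
Qed.

(** The reflection in the hyperplane orthogonal to [w - f] exchanges these two
    unit vectors and fixes what is orthogonal to both. *)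
Lemma householder l (w f : 'cV[R]_l) : enorm w = 1 -> enorm f = 1 ->
  exists O : 'M[R]_l, [/\ orthonormal_cols O, O^T = O, O *m w = f
    & forall x, dot x w = 0 -> dot x f = 0 -> O *m x = x].
Proof.
move=> w1 f1; have [wf|wf] := eqVneq w f.
  exists 1%:M; split=> //; rewrite /orthonormal_cols ?trmx1 ?mul1mx // => x.
  by rewrite mul1mx.
set a := w - f; have a0 : a != 0 by rewrite subr_eq0.
have aa0 : dot a a != 0.
  by rewrite -enorm_sqr sqrf_eq0 gt_eqF // enorm_gt0.
pose O : 'M[R]_l := 1%:M - (2%:R / dot a a) *: (a *m a^T).
have OE x : O *m x = x - (2%:R * dot a x / dot a a) *: a.
  rewrite /O mulmxBl mul1mx -scalemxAl -mulmxA; congr (_ - _).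
  rewrite (_ : a^T *m x = (dot a x)%:M); last exact: mx11_scalar.
  by rewrite mul_mx_scalar scalerA; congr (_ *: _); rewrite mulrAC.
have symO : O^T = O.
  by rewrite /O linearB /= trmx1 linearZ /= trmx_mul trmxK.
have OO (x : 'cV[R]_l) : O *m (O *m x) = x.
  rewrite (OE x) mulmxBr -scalemxAr (OE x) (OE a) mulfK //.
  set r := 2%:R * dot a x / dot a a.
  have -> : r *: (a - 2%:R *: a) = - (r *: a).
    by rewrite -{1}[a]scale1r -scalerBl scalerA -scaleNr; congr (_ *: _); ring.
  by rewrite opprK subrK.
have aw : 2%:R * dot a w = dot a a.
  have ww : dot w w = 1 by rewrite -enorm_sqr w1 expr1n.
  have ff : dot f f = 1 by rewrite -enorm_sqr f1 expr1n.
  by rewrite /a !dotBl !dotBr ww ff (dotC f w); ring.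
exists O; split => //.
- rewrite /orthonormal_cols symO; apply/matrixP => i j.
  have := OO (delta_mx j 0); rewrite mulmxA -colE => /colP/(_ i).
  by rewrite !mxE eqxx andbT eq_sym.
- by rewrite OE aw divff // scale1r /a opprB addrC subrK.
- move=> x xw xf; rewrite OE (dotC a) /a dotBr xw xf subrr mulr0 mul0r.
  by rewrite scale0r subr0.
Qed.

End Counting.

Section MatrixMeasurability.
Context {R : realType}.

Definition mx_entries p q : set (set 'M[R]_(p, q)) :=
  \bigcup_(ij in [set: 'I_p * 'I_q])
    preimage_set_system setT (fun B : 'M[R]_(p, q) => B ij.1 ij.2) measurable.

(** The space of matrices with the sigma-algebra [borel_mx]. *)
Definition mxT p q := g_sigma_algebraType (@mx_entries p q).

Lemma measurable_entry p q i j :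
  measurable_fun setT (fun B : mxT p q => (B : 'M[R]_(p, q)) i j).
Proof.
move=> _ Y mY; rewrite setTI; apply: sub_gen_smallest.
by exists (i, j) => //; exists Y => //; rewrite setTI.
Qed.

Lemma measurable_det p q n (F : 'I_n -> 'I_n -> mxT p q -> R) :
  (forall i j, measurable_fun setT (F i j)) ->
  measurable_fun setT (fun B : mxT p q => \det (\matrix_(i, j) F i j B)).
Proof.
move=> mF; rewrite /determinant; apply: measurable_sum => s.
apply: measurable_funM => //; apply: measurable_prod => i _.
by under eq_fun do rewrite mxE; exact: mF.
Qed.

Lemma measurable_mulmx p q n (A : 'M[R]_(n, p)) i j :
  measurable_fun setT (fun B : mxT p q => (A *m (B : 'M[R]_(p, q))) i j).
Proof.
under eq_fun do rewrite mxE; apply: measurable_sum => h.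
by apply: measurable_funM => //; exact: measurable_entry.
Qed.


Lemma measurable_ltr_set p q (f g : mxT p q -> R) :
  measurable_fun setT f -> measurable_fun setT g ->
  borel_mx [set B : 'M[R]_(p, q) | f B < g B].
Proof.
move=> mf mg; have h := measurable_fun_ltr mf mg.
by have := h measurableT [set true] I; rewrite setTI.
Qed.

Lemma borel_mxC p q (B : set 'M[R]_(p, q)) : borel_mx B -> borel_mx (~` B).
Proof. by move=> mB; apply: (@measurableC _ (mxT p q)). Qed.

Lemma borel_mxI p q (B C : set 'M[R]_(p, q)) :
  borel_mx B -> borel_mx C -> borel_mx (B `&` C).
Proof. by move=> mB mC; apply: (@measurableI _ (mxT p q)). Qed.

Lemma borel_mx_bigI p q (I : Type) (r : seq I) (F : I -> set 'M[R]_(p, q)) :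
  (forall i, borel_mx (F i)) -> borel_mx (\big[setI/setT]_(i <- r) F i).
Proof.
move=> mF; apply: (@bigsetI_measurable _ (mxT p q)) => i _; exact: mF.
Qed.

Lemma measurable_cofactor p k (W : 'M[R]_(p, k)) i j :
  measurable_fun setT (fun B : mxT p k => cofactor (W^T *m (B : 'M[R]_(p, k))) i j).
Proof.
rewrite /cofactor; apply: measurable_funM => //.
have E (B : 'M[R]_(p, k)) : row' i (col' j (W^T *m B)) =
    \matrix_(a, b) (W^T *m B) (lift i a) (lift j b).
  by apply/matrixP => a b; rewrite !mxE.
under eq_fun do rewrite E.
apply: measurable_det => a b; exact: measurable_mulmx.
Qed.

Lemma measurable_detmul p k (W : 'M[R]_(p, k)) :
  measurable_fun setT (fun B : mxT p k => \det (W^T *m (B : 'M[R]_(p, k)))).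
Proof.
have E (B : 'M[R]_(p, k)) : W^T *m B = \matrix_(a, b) (W^T *m B) a b.
  by apply/matrixP => a b; rewrite !mxE.
under eq_fun do rewrite E.
apply: measurable_det => a b; exact: measurable_mulmx.
Qed.

End MatrixMeasurability.

(** * Distance of a row to the span of the others, for a uniform frame *)

Section SmallBall.
Context {R : realType} {d : measure_display} {T : measurableType d}.
Variable P : probability T R.

(** By Cramer's rule the quotient of the two sides, without [eps], is the squared
    distance of the [i]-th row of [W^T q] to the span of the other rows.  In this
    polynomial form the set is Borel, and it avoids the matrices whose other rows
    are dependent, for which the distance is meaningless. *)
Definition near_singular p k (W : 'M[R]_(p, k)) i (eps : R) : set 'M[R]_(p, k) :=
  [set q | (\det (W^T *m q)) ^+ 2
           < eps ^+ 2 * \sum_j cofactor (W^T *m q) i j ^+ 2].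

Lemma borel_near_singular p k (W : 'M[R]_(p, k)) i eps :
  borel_mx (near_singular W i eps).
Proof.
apply: measurable_ltr_set.
  by apply: measurable_funX; exact: measurable_detmul.
apply: measurable_funM => //; apply: measurable_sum => j.
by apply: measurable_funX; exact: measurable_cofactor.
Qed.

Lemma borel_preimage p k (Q : T -> 'M[R]_(p, k)) (B : set 'M[R]_(p, k)) :
  uniform_orthonormal P Q -> borel_mx B -> measurable (Q @^-1` B).
Proof. by case=> _ mQ _; exact: mQ. Qed.

(** Double counting: the left-hand side is the mean number of the events that
    occur. *)
Lemma prob_count (I : finType) (F : I -> set T) (c : R) :
  0 <= c -> (forall i, measurable (F i)) ->
  (forall t, (\sum_i \1_(F i) t : R) <= c) ->
  (\sum_i P (F i) <= c%:E)%E.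
Proof.
move=> c0 mF h.
have -> : (\sum_i P (F i) = \int[P]_t ((\sum_i (\1_(F i) t : R))%:E))%E.
  under eq_integral do rewrite -sumEFin.
  rewrite ge0_integral_sum //; first by apply: eq_bigr => i _; rewrite integral_indic ?setIT.
  by move=> i; apply/measurable_EFinP; exact: measurable_indic.
rewrite -[leRHS]mule1 -(probability_setT P) -integral_cst //.
apply: ge0_le_integral => //.
- by move=> t _; rewrite lee_fin sumr_ge0.
- by apply/measurable_EFinP/measurable_sum => i; exact: measurable_indic.
- by move=> t _; rewrite lee_fin.
Qed.

Section Fixed.
Context l k (W : 'M[R]_(l, k)) (Q : T -> 'M[R]_(l, k)) (i : 'I_k).
Context (orthW : orthonormal_cols W) (unifQ : uniform_orthonormal P Q).

Let cof (q : 'M[R]_(l, k)) : 'cV[R]_k := \col_j cofactor (W^T *m q) i j.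
Let int_vec L (n : {ffun 'I_l -> 'I_L}) : 'cV[R]_l := \col_j (n j)%:R.

(* The vector [cof q] depends only on the rows of [W^T q] other than the
   [i]-th one, and it is orthogonal to them. *)
Let rotated L (n : {ffun 'I_l -> 'I_L}) : set 'M[R]_(l, k) :=
  [set q | dot (int_vec n) (q *m cof q) ^+ 2
           < (2%:R * l%:R)^-1 ^+ 2 * \sum_j cofactor (W^T *m q) i j ^+ 2].

Lemma borel_rotated L (n : {ffun 'I_l -> 'I_L}) : borel_mx (rotated n).
Proof.
apply: measurable_ltr_set; last first.
  apply: measurable_funM => //; apply: measurable_sum => j.
  by apply: measurable_funX; exact: measurable_cofactor.
apply: measurable_funX; under eq_fun do rewrite dotE.
apply: measurable_sum => a; apply: measurable_funM => //.
under eq_fun do rewrite mxE; apply: measurable_sum => b.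
apply: measurable_funM; first exact: measurable_entry.
under eq_fun do rewrite mxE; exact: measurable_cofactor.
Qed.

Lemma col_orth a b : dot (col a W) (col b W) = (a == b)%:R.
Proof.
by rewrite /dot tr_col -row_mul !mxE; have /matrixP/(_ a b) := orthW; rewrite !mxE => <-;
   apply: eq_bigr => c _; rewrite !mxE.
Qed.

Lemma trW_coord (x : 'cV[R]_l) a : (W^T *m x) a 0 = dot (col a W) x.
Proof.
by rewrite dotE mxE; apply: eq_bigr => c _; rewrite !mxE.
Qed.

Lemma cof_orth q a : a != i -> dot (col a W) (q *m cof q) = 0.
Proof.
move=> ai; rewrite -trW_coord mulmxA.
have : ((W^T *m q) *m \adj (W^T *m q)) a i = 0.
  by rewrite mul_mx_adj !mxE (negPf ai).
by move=> <-; rewrite [LHS]mxE [RHS]mxE; apply: eq_bigr => b _; rewrite !mxE.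
Qed.

Lemma int_vec_norm L (n : {ffun 'I_l -> 'I_L}) :
  enorm (int_vec n) ^+ 2 <= l%:R * L%:R ^+ 2.
Proof.
rewrite enorm_sum; apply: (@le_trans _ _ (\sum_(j < l) L%:R ^+ 2)).
  apply: ler_sum => j _; rewrite mxE.
  by rewrite ler_sqr ?nnegrE ?ler0n // ler_nat ltnW.
by rewrite sumr_const card_ord mulr_natl.
Qed.

(** Householder reflections turn the [i]-th column of [W] into the normalized
    projection of any integer vector away from the other columns. *)
Lemma near_singular_le_rotated L (n : {ffun 'I_l -> 'I_L}) :
  (0 < l)%N -> (0 < L)%N ->
  (P (Q @^-1` near_singular W i (2%:R * l%:R ^+ 2 * L%:R)^-1)
     <= P (Q @^-1` rotated n))%E.
Proof.
move=> l0 L0; set eps := _^-1.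
have lR : 1 <= l%:R :> R by rewrite ler1n.
have LR : 1 <= L%:R :> R by rewrite ler1n.
have eps0 : 0 < eps by rewrite invr_gt0 !mulr_gt0 ?exprn_gt0 //; lra.
have c0 : 0 < (2%:R * l%:R)^-1 :> R by rewrite invr_gt0 mulr_gt0 //; lra.
set nv := int_vec n; set wi := col i W.
pose f0 := nv - W *m (W^T *m nv) + dot wi nv *: wi.
have Wcoord (y : 'cV[R]_k) a : dot (col a W) (W *m y) = y a 0.
  by rewrite -trW_coord mulmxA orthW mul1mx.
have f0E x : (forall a, a != i -> dot (col a W) x = 0) -> dot f0 x = dot nv x.
  move=> hx; rewrite dotDl dotBl dotZl (dot_mull W).
  rewrite (dotE (W^T *m nv)) (bigD1 i) //= big1 ?addr0; last first.
    by move=> a ai; rewrite (trW_coord x) hx // mulr0.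
  by rewrite !trW_coord subrK.
have f0o a : a != i -> dot (col a W) f0 = 0.
  move=> ai; rewrite dotDr dotBr dotZr Wcoord trW_coord subrr add0r.
  by rewrite col_orth (negPf ai) mulr0.
have f0n : enorm f0 <= enorm nv.
  have := cauchy nv f0; rewrite -(f0E f0 f0o) -enorm_sqr.
  by have := enorm_ge0 f0; have := enorm_ge0 nv; nra.
have borS := borel_near_singular W i eps.
have borR := borel_rotated n.
have pos (h : R) x : 0 <= x -> x < eps ^+ 2 * h -> 0 < h.
  move=> x0 hh; have := le_lt_trans x0 hh.
  by rewrite pmulr_rgt0 // exprn_gt0.
have [f00|f0n0] := eqVneq f0 0.
  apply: le_measure; rewrite ?inE; try exact: borel_preimage unifQ _.
  move=> t /=; rewrite /near_singular /rotated /= => /(pos _ _ (sqr_ge0 _)) hp.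
  rewrite -f0E; last by move=> a; exact: cof_orth.
  by rewrite f00 dot0l expr0n /= mulr_gt0 // exprn_gt0.
have f0p := enorm_gt0 f0n0.
pose f := (enorm f0)^-1 *: f0.
have f1 : enorm f = 1.
  by rewrite enormZ ger0_norm ?invr_ge0 ?enorm_ge0 // mulVf // gt_eqF.
have wi1 : enorm wi = 1 by rewrite enormE col_orth eqxx sqrtr1.
have [Hh [orthO symO Owi Ofix]] := householder wi1 f1.
have [_ _ inv] := unifQ.
rewrite -(inv Hh orthO _ borS).
apply: le_measure; rewrite ?inE.
- suff -> : [set t | near_singular W i eps (Hh *m Q t)] =
     Q @^-1` [set q | near_singular W i eps (Hh *m q)].
    apply: borel_preimage unifQ _; apply: measurable_ltr_set.
      apply: measurable_funX; under eq_fun do rewrite mulmxA -[W^T *m Hh]trmxK.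
      exact: measurable_detmul.
    apply: measurable_funM => //; apply: measurable_sum => j.
    apply: measurable_funX; under eq_fun do rewrite mulmxA -[W^T *m Hh]trmxK.
    exact: measurable_cofactor.
  by apply/seteqP; split.
- exact: borel_preimage unifQ _.
move=> t /=; move: (Q t) => q.
have entryE a b : (W^T *m (Hh *m q)) a b =
    if a == i then dot f (col b q) else (W^T *m q) a b.
  have -> : (W^T *m (Hh *m q)) a b = dot (Hh *m col a W) (col b q).
    rewrite dot_mull symO dotE mxE; apply: eq_bigr => c _.
    rewrite !mxE; congr (_ * _).
    by apply: eq_bigr => c' _; rewrite !mxE.
  case: eqP => [->|/eqP ai]; first by rewrite Owi.
  rewrite Ofix; first by rewrite dotE mxE; apply: eq_bigr => c _; rewrite !mxE.
    by rewrite col_orth (negPf ai).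
  by rewrite /f dotZr f0o // mulr0.
have cofE j : cofactor (W^T *m (Hh *m q)) i j = cofactor (W^T *m q) i j.
  rewrite /cofactor; congr (_ * \det _); apply/matrixP => a b.
  by rewrite [LHS]mxE [LHS]mxE entryE eq_sym (negPf (neq_lift _ _)) [RHS]mxE [RHS]mxE.
have detE : \det (W^T *m (Hh *m q)) = dot f (q *m cof q).
  rewrite (expand_det_row _ i).
  under eq_bigr => j _ do rewrite entryE eqxx cofE.
  rewrite dot_mulr [RHS]dotE; apply: eq_bigr => j _; rewrite !mxE; congr (_ * _).
  by rewrite dotC dotE; apply: eq_bigr => c _; rewrite !mxE.
rewrite /near_singular /rotated /= detE.
under eq_bigr do rewrite cofE.
set h := \sum_j _ => hlt.
have hp := pos _ _ (sqr_ge0 _) hlt.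
rewrite -/nv -f0E; last by move=> a; exact: cof_orth.
have -> : f0 = enorm f0 *: f by rewrite scalerA divff ?scale1r // gt_eqF.
rewrite dotZl exprMn.
apply: (@lt_le_trans _ _ (enorm f0 ^+ 2 * (eps ^+ 2 * h))).
  by rewrite ltr_pM2l // exprn_gt0.
rewrite mulrA ler_wpM2r ?(ltW hp) //.
apply: (@le_trans _ _ (l%:R * L%:R ^+ 2 * eps ^+ 2)).
  rewrite ler_wpM2r ?sqr_ge0 //; apply: le_trans (int_vec_norm n).
  by rewrite ler_sqr ?nnegrE ?enorm_ge0.
have -> : eps = (2%:R * l%:R)^-1 * (l%:R * L%:R)^-1.
  by rewrite -invfM /eps; congr (_^-1); ring.
rewrite exprMn mulrCA -[leRHS]mulr1 ler_wpM2l ?sqr_ge0 //.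
rewrite exprVn ler_pdivrMr ?exprn_gt0 ?mulr_gt0 //; try lra.
rewrite mul1r exprMn ler_wpM2r ?sqr_ge0 // expr2.
by rewrite -[leLHS]mulr1 ler_wpM2l //; lra.
Qed.

(** The vector [q *m cof q] has a coordinate of size at least its norm over [l],
    to which [count_small] applies. *)
Lemma rotated_count L (q : 'M[R]_(l, k)) : (0 < l)%N -> (0 < L)%N ->
  orthonormal_cols q ->
  (\sum_(n : {ffun 'I_l -> 'I_L}) \1_(rotated n) q : R) <= (L ^ l)%:R / L%:R.
Proof.
move=> l0 L0 orthq.
have lR : 1 <= l%:R :> R by rewrite ler1n.
have LR : 1 <= L%:R :> R by rewrite ler1n.
set u := cof q.
have hE : \sum_j cofactor (W^T *m q) i j ^+ 2 = enorm u ^+ 2.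
  by rewrite enorm_sum; apply: eq_bigr => j _; rewrite mxE.
have [u0|u0] := eqVneq u 0.
  rewrite big1 ?divr_ge0 ?ler0n // => n _; rewrite indicE memNset //.
  by rewrite /rotated /= hE u0 enorm0 expr0n /= mulr0 ltNge sqr_ge0.
have up := enorm_gt0 u0.
pose x := (enorm u)^-1 *: (q *m u).
have x1 : enorm x = 1.
  by rewrite enormZ enorm_isom // ger0_norm ?invr_ge0 ?enorm_ge0 // mulVf // gt_eqF.
have [j hj] : exists j, 2%:R * (2%:R * l%:R)^-1 <= `|x j 0|.
  apply/existsP; rewrite -[X in is_true X]negbK; apply/negP => /existsPn hx.
  have : enorm x ^+ 2 < 1.
    rewrite enorm_sum; apply: (@lt_le_trans _ _ (\sum_(j < l) l%:R^-1)).
      apply: ltr_sum => [|j _].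
        by apply/hasP; exists (Ordinal l0) => //; rewrite mem_index_enum.
      have := hx j; rewrite -ltNge invfM mulrA divff // mul1r => hlt.
      have h1 : `|x j 0| <= 1 by apply: le_trans (ltW hlt) _; rewrite invf_le1 //; lra.
      rewrite -real_normK ?num_real // expr2; apply: le_lt_trans hlt.
      by rewrite -[leRHS]mulr1 ler_wpM2l.
    by rewrite sumr_const card_ord -(mulr_natl l%:R^-1) mulfV // gt_eqF //; lra.
  by rewrite x1 expr1n ltxx.
have := count_small L hj.
rewrite -(ler_nat R) natrM -ler_pdivlMr; last by lra.
apply: le_trans; rewrite -sum1_card natr_sum [leRHS]big_mkcond /=.
apply: ler_sum => n _; rewrite indicE inE.
case: (boolP (q \in rotated n)) => [|_]; last by case: ifP.
rewrite inE /rotated /= hE -exprMn => hlt.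
case: ifP => // /negP[].
have -> : \sum_i (n i)%:R * x i 0 = dot (int_vec n) x.
  by rewrite dotE; apply: eq_bigr => a _; rewrite [int_vec n a 0]mxE.
rewrite dotZr normrM ger0_norm ?invr_ge0 ?enorm_ge0 // mulrC ltr_pdivrMr //.
rewrite -ltr_sqr ?nnegrE ?mulr_ge0 ?invr_ge0 ?mulr_ge0 ?ler0n ?enorm_ge0 //.
by rewrite real_normK ?num_real.
Qed.

(** Averaging [near_singular_le_rotated] over all integer vectors turns the count
    of [rotated_count] into a probability. *)
Lemma near_singular_prob L : (0 < l)%N -> (0 < L)%N ->
  (P (Q @^-1` near_singular W i (2%:R * l%:R ^+ 2 * L%:R)^-1)
     <= (L%:R^-1)%:E)%E.
Proof.
move=> l0 L0; set p := P _.
have LR : 1 <= L%:R :> R by rewrite ler1n.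
have LlR : 0 < (L ^ l)%:R :> R by rewrite ltr0n expn_gt0 L0.
have [orthQ _ _] := unifQ.
have h : (\sum_(n : {ffun 'I_l -> 'I_L}) P (Q @^-1` rotated n)
    <= ((L ^ l)%:R / L%:R)%:E)%E.
  apply: prob_count => [|n|t].
  - by rewrite divr_ge0.
  - by apply: borel_preimage unifQ _; exact: borel_rotated.
  - by apply: le_trans (rotated_count l0 L0 (orthQ t)); apply: ler_sum => n _.
have h2 : (\sum_(n : {ffun 'I_l -> 'I_L}) p <= ((L ^ l)%:R / L%:R)%:E)%E.
  apply: le_trans h; apply: lee_sum => n _; exact: near_singular_le_rotated.
have pE : p = (fine p)%:E.
  by rewrite fineK // fin_num_measure //; apply: borel_preimage unifQ _; exact: borel_near_singular.
move: h2; rewrite pE sumEFin !lee_fin sumr_const card_ffun !card_ord.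
by rewrite -[fine p *+ _]mulr_natl ler_pM2l.
Qed.

End Fixed.
End SmallBall.

(** * Conditioning of a uniform frame *)

Section WellConditioned.
Context {R : realType} {d : measure_display} {T : measurableType d}.
Variable P : probability T R.

Lemma orthonormal_gt0 l k (W : 'M[R]_(l, k)) :
  orthonormal_cols W -> (0 < k)%N -> (0 < l)%N.
Proof.
case: l W => // W /matrixP orthW k0.
have := orthW (Ordinal k0) (Ordinal k0); rewrite !mxE eqxx big_ord0 => /eqP.
by rewrite eq_sym oner_eq0.
Qed.

Lemma orthonormal_col' l k (W : 'M[R]_(l, k.+1)) i :
  orthonormal_cols W -> orthonormal_cols (col' i W).
Proof.
move=> /matrixP orthW; apply/matrixP => a b.
have := orthW (lift i a) (lift i b); rewrite !mxE (inj_eq lift_inj) => <-.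
by apply: eq_bigr => c _; rewrite !mxE.
Qed.

Lemma mul_col' m n p (A : 'M[R]_(m, n)) (B : 'M[R]_(n, p.+1)) i :
  A *m col' i B = col' i (A *m B).
Proof. by apply/matrixP => a b; rewrite !mxE; apply: eq_bigr => c _; rewrite mxE. Qed.

Lemma finite_boole (I : Type) (r : seq I) (F : I -> set T) :
  (forall i, measurable (F i)) ->
  (P (\big[setU/set0]_(i <- r) F i) <= \sum_(i <- r) P (F i))%E.
Proof.
move=> mF; elim: r => [|i r ih]; first by rewrite !big_nil measure0.
rewrite !big_cons; apply: le_trans (measureU2 _ _ _) _ => //.
  by apply: bigsetU_measurable.
by rewrite leeD2l.
Qed.

Lemma borel_singular l k (W : 'M[R]_(l, k)) :
  borel_mx [set q : 'M[R]_(l, k) | \det (W^T *m q) = 0].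
Proof.
have h := measurable_detmul W measurableT (measurable_set1 (0 : R)).
by move: h; rewrite setTI.
Qed.

Lemma borel_col' l k i (B : set 'M[R]_(l, k)) :
  borel_mx B -> borel_mx [set q : 'M[R]_(l, k.+1) | B (col' i q)].
Proof.
move=> borB.
suff : measurable_fun setT (col' i : @mxT R l k.+1 -> @mxT R l k).
  by move=> /(_ measurableT B borB); rewrite setTI.
apply: (@measurability _ _ (@mxT R l k.+1) (@mxT R l k) setT
  (col' i : @mxT R l k.+1 -> @mxT R l k) (@mx_entries R l k)) => //.
move=> _ [_ [[a b] _ [Y mY <-]] <-]; rewrite !setTI.
have := @measurable_entry R l k.+1 a (lift i b) measurableT Y mY.
rewrite setTI; congr (measurable _); apply/seteqP.
by split => q /=; rewrite mxE.
Qed.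

Lemma uniform_col' l k (Q : T -> 'M[R]_(l, k.+1)) i :
  uniform_orthonormal P Q -> uniform_orthonormal P (fun t => col' i (Q t)).
Proof.
move=> unifQ; have [orthQ _ inv] := unifQ; split.
- by move=> t; exact: orthonormal_col'.
- move=> B borB; exact: (borel_preimage unifQ (borel_col' i borB)).
- move=> Hh orthH B borB; rewrite -(inv _ orthH _ (borel_col' i borB)).
  congr (P _); apply/seteqP.
  by split => t /=; rewrite mul_col'.
Qed.

(** By induction on [k]: the minor that avoids the last row and the last
    column is the same determinant for one column less. *)
Lemma det_null l k (W : 'M[R]_(l, k)) (Q : T -> 'M[R]_(l, k)) :
  orthonormal_cols W -> uniform_orthonormal P Q ->
  P (Q @^-1` [set q | \det (W^T *m q) = 0]) = 0%E.
Proof.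
elim: k W Q => [|k ih] W Q orthW unifQ.
  rewrite (_ : _ @^-1` _ = set0) ?measure0 // -subset0 => t /=.
  by rewrite det_mx00 => /eqP; rewrite oner_eq0.
have l0 := orthonormal_gt0 orthW (ltn0Sn k).
set i : 'I_k.+1 := ord_max.
have n0 := ih _ _ (orthonormal_col' i orthW) (uniform_col' i unifQ).
have mS := borel_preimage unifQ (borel_singular W).
have mS' := borel_preimage (uniform_col' i unifQ) (borel_singular (col' i W)).
apply/eqP; rewrite eq_le measure_ge0 andbT; apply/lee_addgt0Pr => e e0.
rewrite add0e.
pose L := (Num.truncn e^-1).+1.
have mN := borel_preimage unifQ
  (borel_near_singular W i (2%:R * l%:R ^+ 2 * L%:R)^-1).
have hL := near_singular_prob i orthW unifQ l0 (ltn0Sn (Num.truncn e^-1)).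
apply: (@le_trans _ _ (L%:R^-1)%:E); last first.
  rewrite lee_fin invf_ple ?posrE ?ltr0Sn //.
  by apply: ltW; exact: truncnS_gt.
apply: le_trans hL; rewrite -/L -[leRHS]add0e -n0.
apply: le_trans (measureU2 _ mS' mN).
apply: le_measure; rewrite ?inE //; first exact: measurableU.
move=> t /= dt; set q := Q t.
have [c0|c0] := eqVneq (cofactor (W^T *m q) i i) 0; [left|right].
  move: c0; rewrite /cofactor => /eqP; rewrite mulf_eq0 signr_eq0 /= => /eqP <-.
  congr (\det _); apply/matrixP => a b; rewrite !mxE.
  by apply: eq_bigr => c _; rewrite !mxE.
rewrite /near_singular /= dt expr0n /= mulr_gt0 //.
  by rewrite exprn_gt0 // invr_gt0 !mulr_gt0 ?exprn_gt0 // ltr0n.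
rewrite (bigD1 i) //= ltr_wpDr ?sumr_ge0 //; last by rewrite exprn_even_gt0.
by move=> j _; rewrite sqr_ge0.
Qed.

(** Away from the sets [near_singular], the adjugate identity recovers each
    coordinate of [x] from [q^T W x] with a bounded loss. *)
Lemma uniform_well_conditioned L l k (W : 'M[R]_(l, k)) (Q : T -> 'M[R]_(l, k)) :
  (0 < L)%N -> (0 < k)%N -> orthonormal_cols W -> uniform_orthonormal P Q ->
  exists B : set 'M[R]_(l, k), [/\ borel_mx B,
    ((1 - k%:R / L%:R)%:E <= P (Q @^-1` B))%E
  & forall q, B q -> forall x : 'cV_k,
      (2%:R * l%:R ^+ 2 * L%:R * k%:R)^-1 * enorm x <= enorm (q^T *m (W *m x))].
Proof.
move=> L0 k0 orthW unifQ.
have l0 := orthonormal_gt0 orthW k0.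
set eps : R := (2%:R * l%:R ^+ 2 * L%:R)^-1.
have eps0 : 0 < eps by rewrite invr_gt0 !mulr_gt0 ?exprn_gt0 // ltr0n.
pose S : set 'M[R]_(l, k) := [set q | \det (W^T *m q) = 0].
pose N i := near_singular W i eps.
have bN i : borel_mx (~` N i) by apply: borel_mxC; exact: borel_near_singular.
have bS : borel_mx (~` S) by apply: borel_mxC; exact: borel_singular.
pose B := ~` S `&` \big[setI/setT]_(i < k) ~` N i.
have bB : borel_mx B by apply: borel_mxI => //; exact: borel_mx_bigI.
exists B; split => //.
  have mB := borel_preimage unifQ bB.
  have mS : measurable (Q @^-1` S) by exact: borel_preimage unifQ (borel_singular W).
  have mN i : measurable (Q @^-1` N i).
    by apply: borel_preimage unifQ _; exact: borel_near_singular.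
  have hC : (P (~` (Q @^-1` B)) <= (k%:R / L%:R)%:E)%E.
    apply: (@le_trans _ _ (P (Q @^-1` S `|` \big[setU/set0]_(i < k) (Q @^-1` N i)))).
      apply: le_measure; rewrite ?inE; first exact: measurableC.
        by apply: measurableU => //; exact: bigsetU_measurable.
      move=> t /=; rewrite /B -bigcap_seq -bigcup_seq.
      have [st|st] := pselect (S (Q t)); first by left.
      move=> /not_andP[//|/existsNP[i /not_implyP[ii /contrapT ni]]].
      by right; exists i => //=; rewrite mem_index_enum.
    apply: le_trans (measureU2 _ mS _) _; first exact: bigsetU_measurable.
    rewrite [X in (X + _)%E](_ : _ = 0%E) ?add0e; last exact: det_null.
    apply: le_trans (finite_boole _ mN) _.
    apply: (@le_trans _ _ (\sum_(i < k) (L%:R^-1)%:E)%E).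
      by apply: lee_sum => i _; exact: near_singular_prob.
    by rewrite sumEFin lee_fin sumr_const card_ord mulr_natl.
  move: hC; rewrite probability_setC //.
  have pE : P (Q @^-1` B) = (fine (P (Q @^-1` B)))%:E by rewrite fineK // fin_num_measure.
  by rewrite pE -EFinB !lee_fin; lra.
move=> q [qS /=]; rewrite -bigcap_seq => qN x.
have kR : 1 <= k%:R :> R by rewrite ler1n.
set H := W^T *m q.
have det0 : \det H != 0 by apply/eqP.
rewrite mulmxA -[q^T *m W]trmxK trmx_mul trmxK -/H.
set y := H^T *m x.
have yE i : dot y (\col_j cofactor H i j) = \det H * x i 0.
  rewrite dot_mull trmxK dotC.
  have -> : H *m (\col_j cofactor H i j) = \det H *: delta_mx i 0.
    apply/colP => a.
    have := mul_mx_adj H => /matrixP/(_ a i).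
    rewrite !mxE eqxx andbT mulr_natr => <-.
    by apply: eq_bigr => b _; rewrite !mxE.
  rewrite dotZl dotE (bigD1 i) //= big1 ?addr0 ?mxE ?eqxx ?mul1r // => a ai.
  by rewrite mxE (negPf ai) mul0r.
have xi i : eps ^+ 2 * x i 0 ^+ 2 <= enorm y ^+ 2.
  have /negP := qN i (mem_index_enum i); rewrite -leNgt -/H => hcof.
  have hy := cauchy_sqr y (\col_j cofactor H i j).
  have hE : dot (\col_j cofactor H i j) (\col_j cofactor H i j) = \sum_j cofactor H i j ^+ 2.
    by rewrite -enorm_sqr enorm_sum; apply: eq_bigr => j _; rewrite mxE.
  have d2 : 0 < \det H ^+ 2 by rewrite exprn_even_gt0.
  rewrite yE hE -enorm_sqr exprMn in hy.
  rewrite -(ler_pM2l d2); apply: (@le_trans _ _ (eps ^+ 2 *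
      (enorm y ^+ 2 * \sum_j cofactor H i j ^+ 2))).
    by rewrite mulrCA ler_wpM2l ?sqr_ge0.
  by rewrite mulrCA [leRHS]mulrC ler_wpM2l ?sqr_ge0.
rewrite invfM -/eps -ler_sqr ?nnegrE ?mulr_ge0 ?invr_ge0 ?enorm_ge0 ?ler0n ?(ltW eps0) //.
rewrite !exprMn.
apply: (@le_trans _ _ (eps ^+ 2 * k%:R^-1 * enorm x ^+ 2)).
  rewrite ler_wpM2r ?sqr_ge0 // ler_wpM2l ?sqr_ge0 // expr2.
  by rewrite -[leRHS]mulr1 ler_wpM2l ?invr_ge0 ?ler0n // invf_le1 //; lra.
rewrite mulrAC ler_pdivrMr; last by lra.
rewrite enorm_sum mulr_sumr.
apply: (@le_trans _ _ (\sum_(i < k) enorm y ^+ 2)); first exact: ler_sum.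
by rewrite sumr_const card_ord mulr_natr.
Qed.

End WellConditioned.

(** * Interpolation of traces *)

Section Frobenius.
Context {R : realType}.

Definition fdot m n (A B : 'M[R]_(m, n)) : R := \tr (A^T *m B).

Lemma fdotE m n (A B : 'M[R]_(m, n)) :
  fdot A B = \sum_j \sum_i A i j * B i j.
Proof.
apply: eq_bigr => j _; rewrite mxE; apply: eq_bigr => i _; by rewrite mxE.
Qed.

Lemma fdot_cols m n (A B : 'M[R]_(m, n)) :
  fdot A B = \sum_j dot (col j A) (col j B).
Proof.
by rewrite fdotE; apply: eq_bigr => j _; rewrite dotE; apply: eq_bigr => i _; rewrite !mxE.
Qed.

Lemma fdot_cauchy m n (A B : 'M[R]_(m, n)) :
  fdot A B ^+ 2 <= fdot A A * fdot B B.
Proof.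
pose v (A : 'M[R]_(m, n)) : 'cV[R]_#|{: 'I_n * 'I_m}| :=
  \col_p A (enum_val p).2 (enum_val p).1.
have E (C D : 'M[R]_(m, n)) : fdot C D = dot (v C) (v D).
  rewrite fdotE pair_big dotE.
  rewrite (reindex (enum_val (A := {: 'I_n * 'I_m}))) /=; last first.
    by apply: onW_bij; exact: enum_val_bij.
  by apply: eq_bigr => p _; rewrite !mxE.
by rewrite !E cauchy_sqr.
Qed.

Lemma fdot_ge0 m n (A : 'M[R]_(m, n)) : 0 <= fdot A A.
Proof. by rewrite fdot_cols sumr_ge0 // => j _; exact: dot_ge0. Qed.


(** Once a log-convex sequence increases, it keeps increasing. *)
Lemma log_convex_max (g : nat -> R) n : (forall i, 0 <= g i) ->
  (forall i, (i.+1 < n)%N -> g i.+1 ^+ 2 <= g i * g i.+2) ->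
  forall i, (i <= n)%N -> g i <= g 0%N + g n.
Proof.
move=> g0 lc.
have up i : (i < n)%N -> g i < g i.+1 -> g i.+1 <= g n.
  move=> hi; have [j hj] : exists j, (n = i.+1 + j)%N.
    by exists (n - i.+1)%N; rewrite subnKC.
  elim: j i hi hj => [|j ih] i hi hj lt; first by rewrite hj addn0.
  have hi2 : (i.+1 < n)%N by rewrite hj addnS ltnS leq_addr.
  have lt2 : g i.+1 < g i.+2.
    have := lc i hi2; have := g0 i; move: lt (g0 i.+2); rewrite expr2.
    move: (g i) (g i.+1) (g i.+2) => a b c *; nra.
  by apply: le_trans (ltW lt2) _; apply: ih => //; rewrite hj; lia.
elim=> [|i ih] hi; first by rewrite lerDl.
have [lt|le] := ltP (g i) (g i.+1).
  by apply: le_trans (up _ hi lt) _; rewrite lerDr.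
by apply: le_trans le _; apply: ih; exact: ltnW.
Qed.

(** The weights [|S^a A T^b|_F^2] with [a + b = p] form a log-convex sequence,
    so that the extreme ones dominate. *)
Lemma trace_interpolation n (S T A : 'M[R]_n) (p q r : nat) :
  S^T = S -> T^T = T -> A^T = A -> (q + r = p.*2)%N ->
  \tr (A *m S ^+ q *m A *m T ^+ r) <=
    fdot (S ^+ p *m A) (S ^+ p *m A) + fdot (T ^+ p *m A) (T ^+ p *m A).
Proof.
move=> symS symT symA qr.
pose F a b := S ^+ a *m A *m T ^+ b.
have FF a b a' b' :
    fdot (F a b) (F a' b') = \tr (A *m S ^+ (a + a') *m A *m T ^+ (b' + b)).
  rewrite /fdot /F !trmx_mul !mxpow_sym // symA -mulmxA mxtrace_mulC.
  by rewrite !mxpowD !mulmxA [LHS]mxtrace_mulC !mulmxA [LHS]mxtrace_mulC !mulmxA.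
have F0 a b : 0 <= fdot (F a b) (F a b) by exact: fdot_ge0.
have Fp0 : fdot (F p 0%N) (F p 0%N) = fdot (S ^+ p *m A) (S ^+ p *m A).
  by rewrite /F expr0 mulmx1.
have F0p : fdot (F 0%N p) (F 0%N p) = fdot (T ^+ p *m A) (T ^+ p *m A).
  by rewrite /fdot /F expr0 mul1mx !trmx_mul !mxpow_sym // symA mxtrace_mulC.
have le_ends a b : (a + b = p)%N -> fdot (F a b) (F a b) <=
    fdot (S ^+ p *m A) (S ^+ p *m A) + fdot (T ^+ p *m A) (T ^+ p *m A).
  move=> ab; rewrite -Fp0 -F0p addrC.
  pose g i := fdot (F i (p - i)%N) (F i (p - i)%N).
  have := @log_convex_max g p; rewrite /g subn0 subnn.
  have -> : b = (p - a)%N by rewrite -ab addKn.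
  apply=> [i|i hi|]; [exact: F0| |by rewrite -ab leq_addr].
  have -> : (p - i = (p - i.+2).+2)%N by lia.
  have -> : (p - i.+1 = (p - i.+2).+1)%N by lia.
  move: (p - i.+2)%N => b'.
  have -> : fdot (F i.+1 b'.+1) (F i.+1 b'.+1) = fdot (F i b'.+2) (F i.+2 b').
    by rewrite !FF; congr (\tr (_ *m _ ^+ _ *m _ *m _ ^+ _)); lia.
  exact: fdot_cauchy.
have [ev|oq] := boolP (~~ odd q).
  have hq : (q = q./2 + q./2)%N by have := odd_double_half q; rewrite (negPf ev); lia.
  have hr : (r = r./2 + r./2)%N.
    have : odd (q + r)%N = false by rewrite qr odd_double.
    by rewrite oddD (negPf ev) /= => orr; have := odd_double_half r; rewrite orr; lia.
  rewrite hq hr -FF; apply: le_ends; lia.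
have hq : (q = q./2 + (q./2).+1)%N.
  by have := odd_double_half q; rewrite negbK in oq; rewrite oq; lia.
have hr : (r = r./2 + (r./2).+1)%N.
  rewrite negbK in oq; have := odd_double_half r.
  have : odd (q + r)%N = false by rewrite qr odd_double.
  by rewrite oddD oq /=; case: (boolP (odd r)) => // _ _; lia.
rewrite {1}hq {1}hr -FF.
have h1 := le_ends q./2 (r./2).+1 ltac:(lia).
have h2 := le_ends (q./2).+1 r./2 ltac:(lia).
have := fdot_cauchy (F q./2 (r./2).+1) (F (q./2).+1 r./2).
have := F0 q./2 (r./2).+1; have := F0 (q./2).+1 r./2.
move: h1 h2; move: (fdot (F _ _) _) (fdot (F _.+1 _) (F _.+1 _)) (fdot _ _).
by move=> u v w; set z := _ + _; nra.
Qed.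

End Frobenius.

(** * Khintchine inequality for matrices *)

Section Khintchine.
Context {R : realType}.

Lemma mxsubX n (S T : 'M[R]_n) p :
  S ^+ p - T ^+ p = \sum_(q < p) S ^+ q *m (S - T) *m T ^+ (p.-1 - q).
Proof.
elim: p => [|p ih]; first by rewrite big_ord0 !expr0 subrr.
rewrite big_ord_recr /= subnn expr0 mulmx1.
have -> : \sum_(q < p) S ^+ q *m (S - T) *m T ^+ (p - q) =
    (S ^+ p - T ^+ p) *m T.
  rewrite ih mulmx_suml; apply: eq_bigr => q _.
  rewrite -[RHS]mulmxA -mxpowSr; congr (_ *m _ ^+ _).
  by have := ltn_ord q; lia.
by rewrite mulmxBl mulmxBr -!mxpowSr addrC addrA subrK.
Qed.

Lemma trace_even_power n (S : 'M[R]_n) p : S^T = S -> 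
  \tr (S ^+ p.*2) = \sum_i \sum_j (S ^+ p) i j ^+ 2.
Proof.
move=> symS; rewrite -addnn mxpowD; apply: eq_bigr => i _.
rewrite mxE; apply: eq_bigr => j _.
by rewrite -{2}(mxpow_sym p symS) mxE expr2.
Qed.

(** The iterates of [S] at a unit vector satisfy [|S x| ^ p <= |S ^ p x|], and the
    trace of [S ^ 2p] is the squared Frobenius norm of [S ^ p].  The bound is
    linear in the trace, so that it can be averaged without taking roots. *)
Lemma opnorm_trace n (S : 'M[R]_n) p (t : R) : S^T = S -> (0 < p)%N -> 0 < t ->
  opnorm S <= t + t * (\tr (S ^+ p.*2) / t ^+ p.*2).
Proof.
move=> symS p0 t0.
have tr0 : 0 <= \tr (S ^+ p.*2).
  rewrite trace_even_power // sumr_ge0 // => i _; rewrite sumr_ge0 // => j _.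
  by rewrite sqr_ge0.
have c0 : 0 <= t * (\tr (S ^+ p.*2) / t ^+ p.*2).
  by rewrite mulr_ge0 ?(ltW t0) // divr_ge0 // exprn_ge0 // ltW.
have key (x : 'cV[R]_n) : enorm x = 1 -> enorm (S *m x) ^+ p.*2 <= \tr (S ^+ p.*2).
  move=> x1; pose g j := enorm (S ^+ j *m x).
  have gS j : S ^+ j.+1 *m x = S *m (S ^+ j *m x) by rewrite mxpowS mulmxA.
  have g0 j : 0 <= g j by exact: enorm_ge0.
  have lc j : g j.+1 ^+ 2 <= g j * g j.+2.
    by rewrite /g enorm_sqr (gS j) dot_mull symS -!gS cauchy.
  have g00 : g 0%N = 1 by rewrite /g expr0 mul1mx.
  have step j : g 1%N * g j <= g j.+1.
    elim: j => [|j ih]; first by rewrite g00 mulr1.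
    have [z|nz] := eqVneq (g j) 0.
      suff -> : g j.+1 = 0 by rewrite mulr0.
      by move: z; rewrite /g gS => /enorm_eq0 ->; rewrite mulmx0 enorm0.
    have gp : 0 < g j by rewrite lt0r nz g0.
    rewrite -(ler_pM2l gp); apply: le_trans (lc j).
    by rewrite mulrCA mulrA expr2 ler_wpM2r.
  have pow j : g 1%N ^+ j <= g j.
    elim: j => [|j ih]; first by rewrite expr0 g00.
    by rewrite exprS; apply: le_trans (step j); rewrite ler_wpM2l.
  have := pow p; rewrite {1}/g expr1 => hp.
  rewrite -muln2 exprM.
  apply: (@le_trans _ _ (g p ^+ 2)).
    by rewrite ler_sqr ?nnegrE // exprn_ge0 // enorm_ge0.
  by have := frobenius_ge (S ^+ p) x; rewrite x1 expr1n mulr1 muln2 -trace_even_power.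
apply: opnorm_le => [|x]; first by rewrite addr_ge0 // ltW.
have [->|x0] := eqVneq x 0; first by rewrite mulmx0 !enorm0 mulr0.
have xp := enorm_gt0 x0.
rewrite -ler_pdivrMr //.
set y := (enorm x)^-1 *: x.
have y1 : enorm y = 1.
  by rewrite enormZ ger0_norm ?invr_ge0 ?enorm_ge0 // mulVf // gt_eqF.
have -> : enorm (S *m x) / enorm x = enorm (S *m y).
  by rewrite -scalemxAr enormZ ger0_norm ?invr_ge0 ?enorm_ge0 // mulrC.
have [le|lt] := leP (enorm (S *m y)) t; first by rewrite ler_wpDr.
rewrite ler_wpDl ?(ltW t0) // -ler_pdivrMl //.
apply: (@le_trans _ _ ((t^-1 * enorm (S *m y)) ^+ p.*2)).
  rewrite -[leLHS]expr1 ler_weXn2l ?double_gt0 //.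
  by rewrite ler_pdivlMl // mulr1 ltW.
by rewrite exprMn exprVn mulrC ler_wpM2r ?key // invr_ge0 exprn_ge0 // ltW.
Qed.

Section Signs.
Context (n : nat) (I : finType) (A : I -> 'M[R]_n) (v : R).
Context (symA : forall i, (A i)^T = A i).
Context (hv : forall x, \sum_i enorm (A i *m x) ^+ 2 <= v * enorm x ^+ 2).

Definition signed_sum (e : {ffun I -> bool}) : 'M[R]_n :=
  \sum_i (-1) ^+ (e i) *: A i.

Definition flip i (e : {ffun I -> bool}) : {ffun I -> bool} :=
  [ffun j => if j == i then ~~ e j else e j].

Lemma flipK i : involutive (flip i).
Proof. by move=> e; apply/ffunP => j; rewrite !ffunE; case: eqP => //; rewrite negbK. Qed.

Lemma signed_sum_sym e : (signed_sum e)^T = signed_sum e.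
Proof.
by rewrite /signed_sum linear_sum; apply: eq_bigr => i _; rewrite linearZ /= symA.
Qed.

Lemma signed_sum_flip i e :
  signed_sum e - signed_sum (flip i e) = (2%:R * (-1) ^+ (e i)) *: A i.
Proof.
rewrite /signed_sum -sumrB (bigD1 i) //= big1 ?addr0; last first.
  by move=> j ji; rewrite ffunE (negPf ji) subrr.
by rewrite ffunE eqxx -scalerBl; congr (_ *: _); case: (e i); rewrite /= ?expr0 ?expr1; ring.
Qed.

Lemma v_ge0 : (0 < n)%N -> 0 <= v.
Proof.
move=> n0; pose x : 'cV[R]_n := delta_mx (Ordinal n0) 0.
have x0 : 0 < enorm x.
  by apply: enorm_gt0; apply/eqP => /matrixP/(_ (Ordinal n0) 0)/eqP; rewrite !mxE !eqxx oner_eq0.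
have := hv x; rewrite -ler_pdivrMr ?exprn_gt0 //; apply: le_trans.
by rewrite divr_ge0 ?sqr_ge0 // sumr_ge0 // => i _; rewrite sqr_ge0.
Qed.

Lemma sum_sandwich p e :
  \sum_i fdot (signed_sum e ^+ p *m A i) (signed_sum e ^+ p *m A i)
    <= v * \tr (signed_sum e ^+ p.*2).
Proof.
set S := signed_sum e.
have symS : S^T = S by exact: signed_sum_sym.
have -> : \sum_i fdot (S ^+ p *m A i) (S ^+ p *m A i) =
    \sum_i \sum_j enorm (A i *m col j (S ^+ p)) ^+ 2.
  apply: eq_bigr => i _.
  have -> : fdot (S ^+ p *m A i) (S ^+ p *m A i) = fdot (A i *m S ^+ p) (A i *m S ^+ p).
    by rewrite /fdot !trmx_mul !mxpow_sym // symA mxtrace_mulC.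
  rewrite fdot_cols; apply: eq_bigr => j _; rewrite enorm_sqr !colE.
  by rewrite !mulmxA.
rewrite exchange_big /=.
apply: (@le_trans _ _ (\sum_j v * enorm (col j (S ^+ p)) ^+ 2)).
  by apply: ler_sum => j _.
rewrite -mulr_sumr trace_even_power // exchange_big /=.
rewrite [X in _ <= v * X](_ : _ = \sum_j enorm (col j (S ^+ p)) ^+ 2) //.
by apply: eq_bigr => j _; rewrite enorm_sum; apply: eq_bigr => i _; rewrite mxE.
Qed.

(** Changing the sign [e i] pairs the terms of the sum.  In a pair, the
    difference of the two powers telescopes into terms with one more factor
    [A i], each of which [trace_interpolation] bounds by its extreme cases. *)
Lemma khintchine_step p :
  \sum_e \tr (signed_sum e ^+ p.+1.*2) <=
    (4 * p + 2)%:R * v * \sum_e \tr (signed_sum e ^+ p.*2).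
Proof.
pose S := signed_sum.
pose sg (e : {ffun I -> bool}) i : R := (-1) ^+ (e i).
pose D i := \sum_e fdot (S e ^+ p *m A i) (S e ^+ p *m A i).
pose X i := \sum_e sg e i * \tr (A i *m S e ^+ p.*2.+1).
have -> : \sum_e \tr (signed_sum e ^+ p.+1.*2) = \sum_i X i.
  rewrite /X [RHS]exchange_big /=; apply: eq_bigr => e _.
  rewrite doubleS mxpowS {1}/signed_sum mulmx_suml linear_sum /=.
  by apply: eq_bigr => i _; rewrite -scalemxAl linearZ.
have Dflip i : \sum_e fdot (S (flip i e) ^+ p *m A i) (S (flip i e) ^+ p *m A i) = D i.
  by rewrite [RHS](reindex_inj (inv_inj (flipK i))).
have hX i : X i <= (4 * p + 2)%:R * D i.
  have XE : 2%:R * X i = \sum_e sg e i *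
      \tr (A i *m (S e ^+ p.*2.+1 - S (flip i e) ^+ p.*2.+1)).
    have X2 : X i = \sum_e - sg e i * \tr (A i *m S (flip i e) ^+ p.*2.+1).
      rewrite /X (reindex_inj (inv_inj (flipK i))) /=; apply: eq_bigr => e _.
      by rewrite /sg ffunE eqxx; case: (e i); rewrite /= ?expr0 ?expr1; ring.
    rewrite mulr2n mulrDl mul1r {2}X2 /X -big_split /=; apply: eq_bigr => e _.
    by rewrite mulmxBr linearB /= mulrBr mulNr.
  have hterm e : sg e i * \tr (A i *m (S e ^+ p.*2.+1 - S (flip i e) ^+ p.*2.+1))
      <= 2%:R * (2 * p + 1)%:R * (fdot (S e ^+ p *m A i) (S e ^+ p *m A i) +
          fdot (S (flip i e) ^+ p *m A i) (S (flip i e) ^+ p *m A i)).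
    rewrite mxsubX mulmx_sumr linear_sum /= mulr_sumr.
    set u := (X in _ <= _ * X).
    apply: (@le_trans _ _ (\sum_(q < p.*2.+1) 2%:R * u)); last first.
      rewrite sumr_const card_ord -[leLHS]mulr_natl (_ : p.*2.+1 = 2 * p + 1)%N; last by lia.
      by rewrite mulrCA mulrA.
    apply: ler_sum => q _.
    rewrite signed_sum_flip -scalemxAr -scalemxAl -scalemxAr linearZ /= mulrA.
    have -> : sg e i * (2%:R * (-1) ^+ (e i)) = 2%:R.
      by rewrite /sg; case: (e i); rewrite /= ?expr0 ?expr1; ring.
    rewrite ler_pM2l ?ltr0n // !mulmxA.
    apply: trace_interpolation; rewrite ?signed_sum_sym ?symA //.
    by have := ltn_ord q; lia.
  rewrite -(ler_pM2l (ltr0n R 2)) XE.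
  apply: (@le_trans _ _ (2%:R * (2 * p + 1)%:R * (D i + D i))); last first.
    rewrite (_ : (4 * p + 2)%N = 2 * (2 * p + 1))%N; last by lia.
    by rewrite natrM -mulr2n -mulr_natl le_eqVlt; apply/orP; left; apply/eqP; ring.
  by rewrite -{2}Dflip /D -big_split /= mulr_sumr; apply: ler_sum => e _.
apply: (@le_trans _ _ (\sum_i (4 * p + 2)%:R * D i)); first exact: ler_sum.
rewrite -mulr_sumr -mulrA ler_wpM2l ?ler0n // /D [leLHS]exchange_big /= mulr_sumr.
by apply: ler_sum => e _; exact: sum_sandwich.
Qed.

Lemma khintchine_trace p : \sum_e \tr (signed_sum e ^+ p.*2) <=
  #|{ffun I -> bool}|%:R * n%:R * (4%:R * p%:R * v) ^+ p.
Proof.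
case: (posnP n) => [n0|n0].
  rewrite big1 ?n0 ?mulr0 ?mul0r // => e _.
  by rewrite /mxtrace big1 // => -[i hi]; exfalso; move: hi; rewrite n0.
have v0 := v_ge0 n0.
have all q : (q <= p)%N -> \sum_e \tr (signed_sum e ^+ q.*2) <=
    #|{ffun I -> bool}|%:R * n%:R * (4%:R * p%:R * v) ^+ q.
  elim: q => [|q ih] hq.
    rewrite !expr0 mulr1; under eq_bigr do rewrite expr0 mxtrace1.
    by rewrite sumr_const mulr_natl.
  apply: le_trans (khintchine_step q) _.
  apply: (@le_trans _ _ ((4%:R * p%:R * v) *
     (#|{ffun I -> bool}|%:R * n%:R * (4%:R * p%:R * v) ^+ q))).
    apply: ler_pM; rewrite ?mulr_ge0 ?ler0n //.
    - rewrite sumr_ge0 // => e _; rewrite trace_even_power ?signed_sum_sym //.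
      by rewrite sumr_ge0 // => i _; rewrite sumr_ge0 // => j _; rewrite sqr_ge0.
    - by rewrite ler_wpM2r // -natrM ler_nat; lia.
    - by apply: ih; exact: ltnW.
  by rewrite mulrCA -exprS.
exact: all.
Qed.

(** Khintchine's inequality in operator norm, from the trace moment of order
    [2 p] with [p >= ln n]. *)
Lemma khintchine_opnorm p (t : R) : (0 < p)%N -> (ln n%:R : R) <= p%:R -> (0 < n)%N ->
  0 < t -> 4%:R * expR 1 * p%:R * v <= t ^+ 2 ->
  \sum_e opnorm (signed_sum e) <= #|{ffun I -> bool}|%:R * (2%:R * t).
Proof.
move=> p0 hp n0 t0 ht.
have v0 := v_ge0 n0.
apply: (@le_trans _ _ (\sum_e (t + t * (\tr (signed_sum e ^+ p.*2) / t ^+ p.*2)))).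
  by apply: ler_sum => e _; apply: opnorm_trace => //; exact: signed_sum_sym.
rewrite big_split /= sumr_const -mulr_sumr -mulr_suml.
rewrite -(mulr_natl t) [2%:R * t]mulrC mulr2n mulrDr mulr1 [leRHS]mulrDr lerD2l.
rewrite [leRHS]mulrC ler_wpM2l ?(ltW t0) // ler_pdivrMr ?exprn_gt0 //.
apply: le_trans (khintchine_trace p) _.
rewrite -mulrA ler_wpM2l ?ler0n //.
rewrite -muln2 mulnC exprM.
apply: (@le_trans _ _ (expR p%:R * (4%:R * p%:R * v) ^+ p)).
  rewrite ler_wpM2r //; first by rewrite exprn_ge0 // !mulr_ge0 ?ler0n.
  by rewrite -[leLHS]lnK ?posrE ?ltr0n // ler_expR.
rewrite -[p%:R]mulr1 -[X in expR X]mulrC expRM_natr -exprMn.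
by rewrite lerXn2r // ?nnegrE ?sqr_ge0 ?mulr_ge0 ?expR_ge0 ?ler0n //;
  apply: le_trans ht; rewrite le_eqVlt; apply/orP; left; apply/eqP; ring.
Qed.

End Signs.
End Khintchine.

(** * Finite product weights and symmetrization *)

Section ProductWeights.
Context {R : realType} (I T : finType) (p : I -> T -> R).
Context (p_ge0 : forall i t, 0 <= p i t) (p_sum1 : forall i, \sum_t p i t = 1).

Definition prod_weight (w : {ffun I -> T}) : R := \prod_i p i (w i).

(** The expectation when the coordinates are independent and the [i]-th one has
    the weights [p i]. *)
Definition expect (F : {ffun I -> T} -> R) : R := \sum_w prod_weight w * F w.

Lemma prod_weight_ge0 w : 0 <= prod_weight w.
Proof. by rewrite prodr_ge0. Qed.

Lemma expect_prod (f : I -> T -> R) :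
  expect (fun w => \prod_i f i (w i)) = \prod_i \sum_t p i t * f i t.
Proof.
rewrite bigA_distr_bigA; apply: eq_bigr => w _.
by rewrite /prod_weight -big_split.
Qed.

Lemma prod_weight_sum1 : \sum_w prod_weight w = 1.
Proof.
have -> : \sum_w prod_weight w = expect (fun w => \prod_(i : I) 1).
  by apply: eq_bigr => w _; rewrite big1 ?mulr1.
rewrite (expect_prod (fun _ _ => 1)) big1 // => i _.
by under eq_bigr do rewrite mulr1.
Qed.

Lemma expect_cst c : expect (fun=> c) = c.
Proof. by rewrite /expect -mulr_suml prod_weight_sum1 mul1r. Qed.

Lemma eq_expect F G : F =1 G -> expect F = expect G.
Proof. by move=> h; apply: eq_bigr => w _; rewrite h. Qed.

Lemma expect_le F G : (forall w, F w <= G w) -> expect F <= expect G.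
Proof. by move=> h; apply: ler_sum => w _; rewrite ler_wpM2l // prod_weight_ge0. Qed.

Lemma expect_ge0 F : (forall w, 0 <= F w) -> 0 <= expect F.
Proof. by move=> h; apply: sumr_ge0 => w _; rewrite mulr_ge0 // prod_weight_ge0. Qed.

Lemma expectD F G : expect (fun w => F w + G w) = expect F + expect G.
Proof. by rewrite /expect -big_split; apply: eq_bigr => w _; rewrite mulrDr. Qed.

Lemma expectZ c F : expect (fun w => c * F w) = c * expect F.
Proof. by rewrite /expect mulr_sumr; apply: eq_bigr => w _; rewrite mulrCA. Qed.

Lemma expect_sum (J : Type) (r : seq J) (F : J -> {ffun I -> T} -> R) :
  expect (fun w => \sum_(j <- r) F j w) = \sum_(j <- r) expect (F j).
Proof.
rewrite /expect exchange_big /=; apply: eq_bigr => w _; exact: mulr_sumr.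
Qed.

Definition upd (w : {ffun I -> T}) j t : {ffun I -> T} :=
  [ffun i => if i == j then t else w i].

Lemma prod_weight_upd w j t : prod_weight (upd w j t) * p j (w j) = prod_weight w * p j t.
Proof.
rewrite /prod_weight (bigD1 j) //= [in RHS](bigD1 j) //= ffunE eqxx.
rewrite (eq_bigr (fun i => p i (w i))); last by move=> i ij; rewrite ffunE (negPf ij).
by rewrite mulrC [p j t * _]mulrC mulrA.
Qed.

(** Exchanging the coordinate [j] with an independent copy preserves the
    weights. *)
Lemma resample j (G : {ffun I -> T} -> T -> R) :
  \sum_w \sum_t prod_weight w * p j t * G w t =
  \sum_w \sum_t prod_weight w * p j t * G (upd w j t) (w j).
Proof.
rewrite !pair_big /=.
pose h (x : {ffun I -> T} * T) := (upd x.1 j x.2, x.1 j).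
have hK : involutive h.
  move=> [w t]; rewrite /h /= ffunE eqxx; congr (_, _).
  by apply/ffunP => i; rewrite !ffunE; case: eqP => // ->.
rewrite (reindex_inj (inv_inj hK)) /=; apply: eq_bigr => -[w t] _ /=.
by rewrite prod_weight_upd.
Qed.

(** Independence of one coordinate from a function of the others, by
    [resample]. *)
Lemma expect_indep j (f : T -> R) (H : {ffun I -> T} -> R) :
  (forall w t, H (upd w j t) = H w) ->
  expect (fun w => f (w j) * H w) = (\sum_t p j t * f t) * expect H.
Proof.
move=> hH.
have := resample j (fun w t => f (w j) * H w).
under eq_bigr => w _.
  rewrite -mulr_suml -mulr_sumr p_sum1 mulr1; over.
rewrite -/(expect _) => ->.
rewrite /expect mulrC mulr_suml; apply: eq_bigr => w _; rewrite mulr_sumr.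
by apply: eq_bigr => t _; rewrite hH ffunE eqxx; ring.
Qed.

Lemma expect_coord j (f : T -> R) : expect (fun w => f (w j)) = \sum_t p j t * f t.
Proof.
have := @expect_indep j f (fun=> 1) (fun _ _ => erefl).
by rewrite expect_cst mulr1 => <-; apply: eq_expect => w; rewrite mulr1.
Qed.

Lemma expect_markov (F : {ffun I -> T} -> R) (a : R) : 0 < a -> (forall w, 0 <= F w) ->
  expect (fun w => (a < F w)%R%:R) <= expect F / a.
Proof.
move=> a0 F0; rewrite ler_pdivlMr // mulrC -expectZ; apply: expect_le => w.
by case: ltP => [/ltW|_]; rewrite ?mulr1 ?mulr0.
Qed.

Section Symmetrization.
Context (n : nat) (X : I -> T -> 'M[R]_n).

Definition mean_mx i : 'M[R]_n := \sum_t p i t *: X i t.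

Lemma sum_mean_mx : \sum_i mean_mx i = \sum_w prod_weight w *: \sum_i X i (w i).
Proof.
apply/matrixP => a b; rewrite !summxE.
under [RHS]eq_bigr => w _ do rewrite mxE summxE.
rewrite -/(expect _) (expect_sum _ (fun i w => X i (w i) a b)).
apply: eq_bigr => i _; rewrite (expect_coord i (fun t => X i t a b)) summxE.
by apply: eq_bigr => t _; rewrite mxE.
Qed.

Let S (w : {ffun I -> T}) (e : {ffun I -> bool}) : 'M[R]_n :=
  signed_sum (fun i => X i (w i)) e.

(** The mean is an independent copy averaged out, and exchanging some coordinates
    of [w] with those of the copy flips the corresponding signs. *)
Lemma symmetrization :
  #|{ffun I -> bool}|%:R * expect (fun w => opnorm (\sum_i (X i (w i) - mean_mx i)))
  <= 2%:R * expect (fun w => \sum_e opnorm (S w e)).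
Proof.
pose Dd (x : {ffun I -> T} * {ffun I -> T}) :=
  opnorm (\sum_i (X i (x.1 i) - X i (x.2 i))).
pose D := \sum_(x : {ffun I -> T} * {ffun I -> T}) prod_weight x.1 * prod_weight x.2 * Dd x.
have h1 : expect (fun w => opnorm (\sum_i (X i (w i) - mean_mx i))) <= D.
  rewrite /D -(pair_big xpredT xpredT (fun w w' => prod_weight w * prod_weight w' * Dd (w, w'))) /=.
  apply: ler_sum => w _.
  under [leRHS]eq_bigr do rewrite -mulrA.
  rewrite -mulr_sumr ler_wpM2l ?prod_weight_ge0 //.
  have -> : \sum_i (X i (w i) - mean_mx i) =
      \sum_w' prod_weight w' *: \sum_i (X i (w i) - X i (w' i)).
    under [RHS]eq_bigr => w' _ do rewrite sumrB scalerBr.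
    by rewrite [RHS]sumrB -scaler_suml prod_weight_sum1 scale1r -sum_mean_mx sumrB.
  apply: le_trans (opnorm_sum _ _ _) _; apply: ler_sum => w' _.
  by apply: le_trans (opnormZ_le _ _) _; rewrite ger0_norm // prod_weight_ge0.
have h2 e : D <= 2%:R * expect (fun w => opnorm (S w e)).
  pose swap (x : {ffun I -> T} * {ffun I -> T}) : {ffun I -> T} * {ffun I -> T} :=
    ([ffun i => if e i then x.2 i else x.1 i],
     [ffun i => if e i then x.1 i else x.2 i]).
  have swapK : involutive swap.
    move=> [w w']; rewrite /swap /=; congr (_, _); apply/ffunP => i;
      by rewrite !ffunE; case: (e i).
  have swap_pw x : prod_weight (swap x).1 * prod_weight (swap x).2 =
      prod_weight x.1 * prod_weight x.2.
    rewrite /prod_weight -!big_split /=; apply: eq_bigr => i _; rewrite !ffunE.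
    by case: (e i); rewrite // mulrC.
  have swap_D x : Dd (swap x) = opnorm (S x.1 e - S x.2 e).
    rewrite /Dd /S /signed_sum -sumrB; congr opnorm; apply: eq_bigr => i _.
    by rewrite !ffunE; case: (e i); rewrite /= ?expr0 ?expr1 -scalerBr ?scale1r // scaleN1r opprB.
  rewrite /D (reindex_inj (inv_inj swapK)) /=.
  under eq_bigr do rewrite swap_pw swap_D.
  apply: (@le_trans _ _ (\sum_(x : {ffun I -> T} * {ffun I -> T})
      prod_weight x.1 * prod_weight x.2 * (opnorm (S x.1 e) + opnorm (S x.2 e)))).
    apply: ler_sum => x _; rewrite ler_wpM2l ?mulr_ge0 ?prod_weight_ge0 //.
    apply: le_trans (opnormD _ _) _; rewrite lerD2l -scaleN1r.
    by apply: le_trans (opnormZ_le _ _) _; rewrite normrN1 mul1r.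
  rewrite -(pair_big xpredT xpredT
    (fun w w' => prod_weight w * prod_weight w' * (opnorm (S w e) + opnorm (S w' e)))) /=.
  apply: (@le_trans _ _ (expect (fun w => opnorm (S w e) + expect (fun w' => opnorm (S w' e))))).
    apply: ler_sum => w _; under eq_bigr do rewrite -mulrA.
    by rewrite -mulr_sumr -/(expect _) expectD expect_cst.
  by rewrite expectD expect_cst mulr2n mulrDl mul1r.
have : \sum_(e : {ffun I -> bool}) expect (fun w => opnorm (\sum_i (X i (w i) - mean_mx i)))
    <= \sum_e 2%:R * expect (fun w => opnorm (S w e)).
  by apply: ler_sum => e _; exact: le_trans h1 (h2 e).
by rewrite sumr_const mulr_natl -mulr_sumr -expect_sum.
Qed.

End Symmetrization.
End ProductWeights.

(** * The contribution of one row *)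

Section RowMatrix.
Context {R : realType}.

Lemma expR1_le4 : expR 1 <= 4%:R :> R.
Proof.
have h : expR (- (1 / 2%:R)) >= 1 / 2%:R :> R.
  by apply: le_trans (expR_ge1Dx _); lra.
have -> : 1 = 1 / 2%:R + 1 / 2%:R :> R by lra.
rewrite expRD; have := expRN (1 / 2%:R : R); have := expR_gt0 (1 / 2%:R : R).
move: h; set u := expR (1 / 2%:R); set v := expR _ => h u0 vE.
have : u * v = 1 by rewrite vE mulfV // gt_eqF.
by nra.
Qed.

Context (l : nat).

Definition weight (a : 'I_l -> R) : nat := #|[set j | a j != 0]%SET|.

(** The contribution of one row to the matrix that SPCA iterates, when the
    trimming threshold is 10. *)
Definition row_Phi (a : 'I_l -> R) : 'M[R]_l :=
  \matrix_(j, p) if (j == p) || (10 < weight a)%N then 0 else a j * a p.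

Lemma spca_Phi_rows m (A : 'M[R]_(m, l)) : delta_hat A * l%:R <= 1 ->
  spca_Phi A = \sum_i row_Phi (A i).
Proof.
move=> h; apply/matrixP => j p; rewrite summxE /spca_Phi /diag_part.
have maxE : Num.max 10%:R (10%:R * delta_hat A * l%:R) = 10%:R :> R.
  by apply/max_idPl; rewrite -mulrA; lra.
have trE i a : trimming A i a = if (10 < weight (A i))%N then 0 else A i a.
  by rewrite mxE maxE ltr_nat.
rewrite [LHS]mxE [X in _ + X]mxE [X in _ - X]mxE [X in - (X *+ _)]mxE.
have BE a b : ((trimming A)^T *m trimming A) a b =
    \sum_i if (10 < weight (A i))%N then 0 else A i a * A i b.
  rewrite mxE; apply: eq_bigr => i _; rewrite mxE !trE.
  by case: ifP => _ //; rewrite mul0r.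
rewrite !BE; case: eqP => [->|jp].
  rewrite mulr1n subrr big1 // => i _; by rewrite mxE eqxx.
rewrite mulr0n subr0; apply: eq_bigr => i _.
by rewrite mxE; case: eqP => // _ /=.
Qed.

Lemma row_Phi_sym a : (row_Phi a)^T = row_Phi a.
Proof. by apply/matrixP => j p; rewrite !mxE eq_sym mulrC. Qed.

(** The condition for the [j]-th row of [row_Phi a] to be nonzero, trimming
    aside. *)
Definition hit (a : 'I_l -> R) (j : 'I_l) : bool :=
  (a j != 0) && [exists p, (p != j) && (a p != 0)].

Section Bounded.
Context (a : 'I_l -> R) (a01 : forall j, 0 <= a j <= 1).

Lemma row_Phi_ge0 j p : 0 <= row_Phi a j p.
Proof.
rewrite mxE; case: ifP => // _.
by rewrite mulr_ge0 //; [have /andP[] := a01 j|have /andP[] := a01 p].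
Qed.

Lemma row_Phi_sum j : \sum_p row_Phi a j p <= 10%:R.
Proof.
have [big|small] := ltnP 10 (weight a).
  by rewrite big1 ?ler0n // => p _; rewrite mxE big orbT.
apply: (@le_trans _ _ (weight a)%:R); last by rewrite ler_nat.
rewrite /weight -sum1_card natr_sum [leRHS]big_mkcond /=; apply: ler_sum => p _.
rewrite mxE inE; case: ifP => _; first by case: ifP.
have /andP[j0 j1] := a01 j; have /andP[p0 p1] := a01 p.
by case: eqP => [->|_] /=; rewrite ?mulr0 //; nra.
Qed.

Lemma row_Phi_hit j p : row_Phi a j p != 0 -> hit a j.
Proof.
rewrite mxE; case: ifP => [|/norP[jp _]]; first by rewrite eqxx.
rewrite mulf_eq0 => /norP[aj ap]; rewrite /hit aj /=.
by apply/existsP; exists p; rewrite ap eq_sym jp.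
Qed.

Lemma row_Phi_sqr_sum j :
  \sum_p (row_Phi a *m row_Phi a) j p <= 100%:R * (hit a j)%:R.
Proof.
have -> : \sum_p (row_Phi a *m row_Phi a) j p =
    \sum_q row_Phi a j q * \sum_p row_Phi a q p.
  under eq_bigr do rewrite mxE.
  by rewrite exchange_big /=; apply: eq_bigr => q _; rewrite mulr_sumr.
apply: (@le_trans _ _ (\sum_q row_Phi a j q * 10%:R)).
  by apply: ler_sum => q _; rewrite ler_wpM2l ?row_Phi_ge0 ?row_Phi_sum.
rewrite -mulr_suml; have [h|nh] := boolP (hit a j).
  rewrite mulr1; have := row_Phi_sum j; lra.
rewrite big1 ?mul0r ?mulr0 // => p _; apply/eqP.
by apply: contraNT nh; exact: row_Phi_hit.
Qed.

End Bounded.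

(** The matrices are entrywise nonnegative, so the sum of their squares is
    bounded by its row sums, to which a matrix contributes at most 100 and only
    when it is hit. *)
Lemma row_Phi_variance (I : finType) (a : I -> 'I_l -> R) (v : R) :
  (forall i j, 0 <= a i j <= 1) ->
  (forall j, 100%:R * \sum_i (hit (a i) j)%:R <= v) ->
  forall x, \sum_i enorm (row_Phi (a i) *m x) ^+ 2 <= v * enorm x ^+ 2.
Proof.
move=> a01 hv x.
pose B := \sum_i row_Phi (a i) *m row_Phi (a i).
have -> : \sum_i enorm (row_Phi (a i) *m x) ^+ 2 = dot x (B *m x).
  rewrite mulmx_suml dot_sumr; apply: eq_bigr => i _.
  by rewrite enorm_sqr dot_mull row_Phi_sym mulmxA.
have symB : B^T = B.
  by rewrite linear_sum; apply: eq_bigr => i _ /=; rewrite trmx_mul row_Phi_sym.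
apply: le_trans (cauchy _ _) _; rewrite expr2 mulrCA ler_wpM2l ?enorm_ge0 //.
apply: schur_test symB _ _ => j.
have -> : \sum_p `|B j p| = \sum_i \sum_p (row_Phi (a i) *m row_Phi (a i)) j p.
  rewrite exchange_big /=; apply: eq_bigr => p _.
  rewrite summxE ger0_norm // sumr_ge0 // => i _; rewrite mxE sumr_ge0 // => q _.
  by rewrite mulr_ge0 // row_Phi_ge0.
apply: le_trans (hv j); rewrite mulr_sumr; apply: ler_sum => i _.
exact: row_Phi_sqr_sum.
Qed.

End RowMatrix.

(** * Concentration for rounded observations *)

(** An outcome of type [O] at each entry fixes the observed value, with [value]
    zero unless [obs] holds.  The mean of the underlying matrix is [M'], which is
    within [theta] of [M]: this leaves room for rounding. *)
Section FiniteModel.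
Context {R : realType} (O : finType) (m l : nat).
Context (q : 'I_m -> 'I_l -> O -> R) (value : O -> R) (obs : O -> bool).
Context (delta theta : R) (M M' : 'M[R]_(m, l)).
Context (q_ge0 : forall i j o, 0 <= q i j o) (q_sum1 : forall i j, \sum_o q i j o = 1).
Context (value01 : forall o, 0 <= value o <= 1).
Context (value_obs : forall o, value o != 0 -> obs o).
Context (delta01 : 0 < delta <= 1).
Context (q_obs : forall i j, \sum_o q i j o * (obs o)%:R = delta).
Context (q_mean : forall i j, \sum_o q i j o * value o = delta * M' i j).
Context (M01 : forall i j, 0 <= M i j <= 1) (M'01 : forall i j, 0 <= M' i j <= 1).
Context (M'M : forall i j, `|M' i j - M i j| <= theta).

Let row := {ffun 'I_l -> O}.
Let rowval (r : row) : 'I_l -> R := fun j => value (r j).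
Let qrow (i : 'I_m) (r : row) : R := prod_weight (q i) r.
Let rowX (_ : 'I_m) (r : row) : 'M[R]_l := row_Phi (rowval r).

Let rowval01 r j : 0 <= rowval r j <= 1. Proof. exact: value01. Qed.
Let qrow_ge0 i r : 0 <= qrow i r. Proof. exact: prod_weight_ge0. Qed.
Let qrow_sum1 i : \sum_r qrow i r = 1. Proof. exact: prod_weight_sum1. Qed.

Definition sample (w : {ffun 'I_m -> {ffun 'I_l -> O}}) : 'M[R]_(m, l) :=
  \matrix_(i, j) value (w i j).

Let d0 : 0 <= delta. Proof. by have /andP[/ltW] := delta01. Qed.

Lemma expect_obs2 i j p : p != j ->
  expect (q i) (fun r => (obs (r j))%:R * (obs (r p))%:R) = delta * delta.
Proof.
move=> pj; rewrite (expect_indep (q_sum1 i) (fun o => (obs o)%:R)); last first.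
  by move=> w t; rewrite ffunE (negPf pj).
by rewrite q_obs (expect_coord (q_sum1 i) p (fun o => (obs o)%:R)) q_obs.
Qed.

Lemma hit_prob i j :
  \sum_r qrow i r * (hit (rowval r) j)%:R <= l%:R * (delta * delta).
Proof.
have -> : l%:R * (delta * delta) = \sum_(p < l) (delta * delta).
  by rewrite sumr_const card_ord mulr_natl.
apply: (@le_trans _ _ (\sum_(p < l) expect (q i)
    (fun r => if p != j then (obs (r j))%:R * (obs (r p))%:R else 0))).
  rewrite -(expect_sum (q i) _ (fun p (r : row) =>
    if p != j then (obs (r j))%:R * (obs (r p))%:R else 0 : R)).
  apply: (expect_le (q_ge0 i)) => r; rewrite /hit.
  case: (boolP (_ && _)) => [/andP[vj /existsP[p /andP[pj vp]]]|_].
    rewrite (bigD1 p) //= pj (value_obs vj) (value_obs vp) mulr1 lerDl.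
    by rewrite sumr_ge0 // => a _; case: ifP => // _; rewrite mulr_ge0.
  by rewrite sumr_ge0 // => a _; case: ifP => // _; rewrite mulr_ge0.
apply: ler_sum => p _; case: (boolP (p != j)) => pj; first by rewrite expect_obs2.
by rewrite (expect_cst (q_sum1 i)) mulr_ge0.
Qed.

Let hits j (w : {ffun 'I_m -> row}) : R := \sum_i (hit (rowval (w i)) j)%:R.

Let mu : R := m%:R * (l%:R * (delta * delta)).

(** The numbers of hits are sums of independent indicators with total mean at
    most [mu]; their exponential moments control all [l] of them at once. *)
Lemma hits_exp j : expect qrow (fun w => expR (hits j w)) <= expR ((expR 1 - 1) * mu).
Proof.
have e1 : 0 <= expR 1 - 1 :> R by have := expR_ge1Dx (1 : R); lra.
have -> : expect qrow (fun w => expR (hits j w)) =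
    \prod_i \sum_r qrow i r * expR (hit (rowval r) j)%:R.
  rewrite -(expect_prod qrow (fun _ r => expR (hit (rowval r) j)%:R)).
  by apply: eq_expect => w; rewrite /hits expR_sum.
apply: (@le_trans _ _ (\prod_(i < m) expR ((expR 1 - 1) * (l%:R * (delta * delta))))).
  apply: ler_prod => i _; apply/andP; split.
    by rewrite sumr_ge0 // => r _; rewrite mulr_ge0 ?expR_ge0.
  apply: le_trans (expR_ge1Dx _).
  have -> : \sum_r qrow i r * expR (hit (rowval r) j)%:R =
      1 + (expR 1 - 1) * \sum_r qrow i r * (hit (rowval r) j)%:R.
    rewrite -[X in X + _](qrow_sum1 i) mulr_sumr -big_split /=; apply: eq_bigr => r _.
    by case: (hit _ _); rewrite /= ?expR0; ring.
  by rewrite lerD2l ler_wpM2l // hit_prob.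
by rewrite -expR_sum sumr_const card_ord -[_ *+ m]mulr_natl mulrCA lexx.
Qed.

(** Khintchine's inequality holds conditionally on the rows, with the variance
    [v] of their number of hits.  The maximum over [j] is replaced with a soft
    maximum, whose mean is computed from [hits_exp]. *)
Lemma deviation : (0 < m)%N -> (0 < l)%N -> 1 <= (ln l%:R : R) -> (ln l%:R : R) <= mu ->
  expect qrow (fun w => opnorm (\sum_i (rowX i (w i) - mean_mx qrow rowX i)))
   <= 600%:R * Num.sqrt (mu * ln l%:R).
Proof.
move=> m0 l0 L1 Lmu.
set K := (expR 1 - 1 : R); set L := (ln l%:R : R).
have K0 : 0 <= K by rewrite /K; have := expR_ge1Dx (1 : R); lra.
have K3 : K <= 3%:R by have := @expR1_le4 R; rewrite /K; lra.
rewrite -/L in L1 Lmu.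
have mu1 : 1 <= mu by lra.
have Kmu : 0 <= K * mu by rewrite mulr_ge0 //; lra.
pose c0 := K * mu + L.
have c0_gt0 : 0 < c0 by rewrite /c0; lra.
pose v w : R := 100%:R * (c0 + \sum_j expR (hits j w - c0)).
have vP w j : 100%:R * hits j w <= v w.
  rewrite ler_pM2l ?ltr0n // (bigD1 j) //= addrA.
  apply: (@le_trans _ _ (c0 + expR (hits j w - c0))).
    by have := expR_ge1Dx (hits j w - c0); lra.
  by rewrite lerDl sumr_ge0 // => a _; rewrite expR_ge0.
have v_gt0 w : 0 < v w.
  rewrite mulr_gt0 ?ltr0n // ltr_pwDl //.
  by rewrite sumr_ge0 // => a _; rewrite expR_ge0.
have v_ex : expect qrow v <= 100%:R * (c0 + 1).
  rewrite expectZ ler_pM2l ?ltr0n // expectD (expect_cst qrow_sum1) lerD2l.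
  rewrite (expect_sum qrow _ (fun j w => expR (hits j w - c0))).
  apply: (@le_trans _ _ (\sum_(j < l) l%:R^-1)); last first.
    by rewrite sumr_const card_ord -(mulr_natl l%:R^-1) mulfV // pnatr_eq0 -lt0n.
  apply: ler_sum => j _.
  have -> : expect qrow (fun w => expR (hits j w - c0)) =
      expR (- c0) * expect qrow (fun w => expR (hits j w)).
    by rewrite -expectZ; apply: eq_expect => w; rewrite expRD mulrC.
  apply: le_trans (ler_wpM2l (expR_ge0 _) (hits_exp j)) _.
  by rewrite -expRD /c0 opprD addrAC addNr add0r expRN lnK // posrE ltr0n.
pose p := (Num.truncn L).+1.
have pL : L <= p%:R by apply: ltW; exact: truncnS_gt.
have p2 : p%:R <= 2%:R * L.
  rewrite /p -addn1 natrD; have : (Num.truncn L)%:R <= L by rewrite truncn_le; lra.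
  by lra.
pose t w : R := Num.sqrt (4%:R * expR 1 * p%:R * v w).
have pos w : 0 < 4%:R * expR 1 * p%:R * v w.
  by apply: mulr_gt0 (v_gt0 w); rewrite !mulr_gt0 ?ltr0n ?expR_gt0.
have t_gt0 w : 0 < t w by rewrite sqrtr_gt0.
have t_sqr w : t w ^+ 2 = 4%:R * expR 1 * p%:R * v w by rewrite sqr_sqrtr // ltW.
set tau := 150%:R * Num.sqrt (mu * L).
have muL : 0 < mu * L by rewrite mulr_gt0 //; lra.
have tau0 : 0 < tau by rewrite mulr_gt0 ?ltr0n ?sqrtr_gt0.
have tau2 : tau ^+ 2 = 150%:R * 150%:R * (mu * L).
  by rewrite exprMn sqr_sqrtr ?(ltW muL) // expr2.
have t_ex : expect qrow t <= tau.
  have h w : t w <= (2%:R * tau)^-1 * t w ^+ 2 + tau / 2%:R.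
    rewrite -subr_ge0; have -> : (2%:R * tau)^-1 * t w ^+ 2 + tau / 2%:R - t w =
      (2%:R * tau)^-1 * (t w - tau) ^+ 2 by field; rewrite gt_eqF.
    by rewrite mulr_ge0 ?sqr_ge0 // invr_ge0 mulr_ge0 // ltW.
  apply: le_trans (expect_le qrow_ge0 h) _.
  rewrite expectD expectZ (expect_cst qrow_sum1).
  have hv : expect qrow (fun w => t w ^+ 2) <= tau ^+ 2.
    rewrite (eq_expect _ t_sqr) expectZ tau2.
    apply: (@le_trans _ _ ((4%:R * 4%:R * (2%:R * L)) * (100%:R * (5%:R * mu)))).
      apply: ler_pM.
      - by rewrite !mulr_ge0 ?expR_ge0.
      - by apply: (expect_ge0 qrow_ge0) => w; exact: ltW.
      - by rewrite ler_pM ?mulr_ge0 ?expR_ge0 // ler_wpM2l // expR1_le4.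
      - apply: le_trans v_ex _; rewrite ler_wpM2l // /c0.
        have : K * mu <= 3%:R * mu by rewrite ler_wpM2r //; lra.
        by lra.
    have -> : 4%:R * 4%:R * (2%:R * L) * (100%:R * (5%:R * mu)) =
        160%:R * 100%:R * (mu * L) :> R by ring.
    by rewrite ler_wpM2r ?(ltW muL) //; lra.
  have : (2%:R * tau)^-1 * expect qrow (fun w => t w ^+ 2) <= (2%:R * tau)^-1 * tau ^+ 2.
    by rewrite ler_wpM2l // invr_ge0 mulr_ge0 // ltW.
  have -> : (2%:R * tau)^-1 * tau ^+ 2 = tau / 2%:R by field; rewrite gt_eqF.
  by lra.
have card0 : 0 < #|{ffun 'I_m -> bool}|%:R :> R.
  by rewrite ltr0n card_ffun card_bool expn_gt0.
rewrite -(ler_pM2l card0).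
apply: le_trans (symmetrization qrow_ge0 qrow_sum1 rowX) _.
apply: (@le_trans _ _ (2%:R * expect qrow (fun w => #|{ffun 'I_m -> bool}|%:R * (2%:R * t w)))).
  rewrite ler_pM2l ?ltr0n //; apply: (expect_le qrow_ge0) => w.
  apply: (@khintchine_opnorm _ _ _ (fun i => rowX i (w i)) (v w) _ _ p) => //.
  - by move=> i; exact: row_Phi_sym.
  - apply: row_Phi_variance => [i j|j]; first exact: rowval01.
    exact: vP.
  - by rewrite t_sqr.
rewrite expectZ expectZ; rewrite mulrCA ler_pM2l //.
have -> : 600%:R * Num.sqrt (mu * L) = 2%:R * (2%:R * tau) by rewrite /tau; ring.
by rewrite !ler_pM2l ?ltr0n.
Qed.

(** A row is kept when at most 10 of its entries are nonzero.  Given that two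
    of its entries are nonzero, this leaves at most 8 for the others, whence the
    threshold here. *)
Definition keep_prob i : R := expect (q i) (fun r => (weight (rowval r) <= 8)%N%:R).

Let rest j p (r : row) : nat :=
  #|[set a | [&& a != j, a != p & rowval r a != 0]]%SET|.

Lemma weight_rest j p r : j != p ->
  weight (rowval r) = ((rowval r j != 0%R) + (rowval r p != 0%R) + rest j p r)%N.
Proof.
move=> jp; have pj : p != j by rewrite eq_sym.
rewrite /weight (cardsD1 j) (cardsD1 p) !inE pj /= addnA.
congr (_ + _ + _)%N; apply: eq_card => a; rewrite !inE.
by rewrite andbCA.
Qed.

Lemma mean_entry i j p : j != p ->
  mean_mx qrow rowX i j p = delta * M' i j * (delta * M' i p *
     expect (q i) (fun r => (rest j p r <= 8)%N%:R)).
Proof.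
move=> jp.
have rest_upd (a : 'I_l) (r : row) t : (a == j) || (a == p) -> rest j p (upd r a t) = rest j p r.
  move=> ajp; apply: eq_card => b; rewrite !inE /rowval ffunE.
  have [->|//] := eqVneq b a; move: ajp => /orP[] /eqP ->; by rewrite eqxx /= ?andbF.
rewrite summxE -!q_mean.
rewrite -(expect_indep (q_sum1 i) value (j := p)); last first.
  by move=> w t; rewrite rest_upd // eqxx orbT.
rewrite -(expect_indep (q_sum1 i) value (j := j)); last first.
  by move=> w t; rewrite rest_upd ?eqxx // ffunE eq_sym (negPf jp).
apply: eq_bigr => r _; rewrite !mxE (negPf jp) /= (weight_rest r jp).
congr (_ * _); rewrite -/(rowval r j) -/(rowval r p).
have [vj|vj] := eqVneq (rowval r j) 0; first by rewrite vj !mul0r; case: ifP.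
have [vp|vp] := eqVneq (rowval r p) 0; first by rewrite vp !(mul0r, mulr0); case: ifP.
by rewrite /= !add1n !ltnS; case: leqP; rewrite /= ?mulr0 ?mulr1.
Qed.

Lemma keep_prob01 i : 0 <= keep_prob i <= 1.
Proof.
apply/andP; split; first by apply: (expect_ge0 (q_ge0 i)) => r; rewrite ler0n.
rewrite -[leRHS](expect_cst (q_sum1 i)); apply: (expect_le (q_ge0 i)) => r.
by rewrite lern1 leq_b1.
Qed.

Lemma expect_obs i j : expect (q i) (fun r => (obs (r j))%:R) = delta.
Proof. by rewrite (expect_coord (q_sum1 i) j (fun o => (obs o)%:R)) q_obs. Qed.

Lemma keep_prob_ge i : 1 - l%:R * delta <= keep_prob i.
Proof.
rewrite lerBlDr.
have -> : l%:R * delta = expect (q i) (fun r => \sum_(j < l) (obs (r j))%:R).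
  rewrite (expect_sum (q i) _ (fun j (r : row) => (obs (r j))%:R : R)).
  by under eq_bigr do rewrite expect_obs; rewrite sumr_const card_ord mulr_natl.
rewrite -expectD -[leLHS](expect_cst (q_sum1 i)); apply: (expect_le (q_ge0 i)) => r.
case: leqP => [_|big] /=; first by rewrite lerDl sumr_ge0.
rewrite add0r; apply: (@le_trans _ _ (weight (rowval r))%:R).
  by rewrite ler1n; apply: leq_trans big.
rewrite /weight -sum1_card natr_sum [leLHS]big_mkcond /=; apply: ler_sum => j _.
by rewrite inE; case: ifP => // vj; rewrite (value_obs vj).
Qed.

Lemma rest_keep i j p : j != p ->
  `|expect (q i) (fun r => (rest j p r <= 8)%N%:R) - keep_prob i| <= 2%:R * delta.
Proof.
move=> jp; rewrite ler_norml; apply/andP; split.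
  apply: (@le_trans _ _ 0); first by rewrite oppr_le0 mulr_ge0.
  rewrite subr_ge0 /keep_prob; apply: (expect_le (q_ge0 i)) => r; rewrite ler_nat.
  rewrite (weight_rest r jp).
  case E : (_ + rest j p r <= 8)%N => //.
  by rewrite (leq_trans (leq_addl _ _) E).
rewrite lerBlDl.
have -> : 2%:R * delta = expect (q i) (fun r => (obs (r j))%:R + (obs (r p))%:R).
  by rewrite expectD !expect_obs mulr2n mulrDl mul1r.
rewrite -expectD; apply: (expect_le (q_ge0 i)) => r; rewrite (weight_rest r jp).
have [vj|vj] := eqVneq (rowval r j) 0; last first.
  by rewrite (value_obs vj); case: (rest _ _ _ <= 8)%N;
    rewrite ?addr_ge0 ?ler0n // addrA addrAC lerDr addr_ge0 ?ler0n.
have [vp|vp] := eqVneq (rowval r p) 0; last first.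
  by rewrite (value_obs vp); case: (rest _ _ _ <= 8)%N;
    rewrite ?addr_ge0 ?ler0n // addrA lerDr addr_ge0 ?ler0n.
by rewrite add0n lerDl addr_ge0 ?ler0n.
Qed.

Definition kept : 'M[R]_(m, l) := \matrix_(i, j) (delta * Num.sqrt (keep_prob i) * M i j).

Lemma kept_gram j p :
  (kept^T *m kept) j p = \sum_i delta ^+ 2 * (keep_prob i * (M i j * M i p)).
Proof.
rewrite mxE; apply: eq_bigr => i _; rewrite !mxE.
have /andP[k0 _] := keep_prob01 i.
by rewrite -{3}(sqr_sqrtr k0); ring.
Qed.

(** The probability that a row is kept given two of its entries depends on these
    two by at most [2 * delta], by [rest_keep], so in the mean of [Phi] it can be
    replaced with [keep_prob].  This correction and the missing diagonal account
    for the error. *)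
Lemma mean_near x :
  enorm ((\sum_i mean_mx qrow rowX i) *m x - kept^T *m (kept *m x)) <=
    m%:R * delta ^+ 2 * (1 + l%:R * (2%:R * delta + 2%:R * theta)) * enorm x.
Proof.
rewrite mulmxA -mulmxBl; set E := _ - _.
have theta0 (i : 'I_m) (j : 'I_l) : 0 <= theta.
  by apply: le_trans (M'M i j); exact: normr_ge0.
have symE : E^T = E.
  rewrite linearB /= trmx_mul trmxK; congr (_ - _).
  rewrite linear_sum; apply: eq_bigr => i _ /=; rewrite /mean_mx linear_sum.
  by apply: eq_bigr => r _ /=; rewrite linearZ /= row_Phi_sym.
apply: schur_test symE _ _ => j.
pose b := m%:R * delta ^+ 2 * (2%:R * delta + 2%:R * theta).
apply: (@le_trans _ _ (\sum_(p < l) ((p == j)%:R * (m%:R * delta ^+ 2) + b))); last first.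
  rewrite big_split /= -mulr_suml sumr_const card_ord -[_ *+ l]mulr_natl.
  rewrite (bigD1 j) //= eqxx big1 ?addr0 => [|a /negPf -> //].
  rewrite /b /= mulr1n.
  by rewrite le_eqVlt; apply/orP; left; apply/eqP; ring.
apply: ler_sum => p _; rewrite mxE [X in _ + X]mxE kept_gram summxE -sumrB.
have b0 (i : 'I_m) : 0 <= 2%:R * delta + 2%:R * theta.
  by rewrite addr_ge0 ?mulr_ge0 // (theta0 i j).
apply: (@le_trans _ _ (\sum_(i < m) ((p == j)%:R * delta ^+ 2 +
    delta ^+ 2 * (2%:R * delta + 2%:R * theta)))); last first.
  rewrite sumr_const card_ord -[_ *+ m]mulr_natl /b.
  by rewrite le_eqVlt; apply/orP; left; apply/eqP; ring.
apply: le_trans (ler_norm_sum _ _ _) _; apply: ler_sum => i _.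
have /andP[g0 g1] := keep_prob01 i.
have /andP[Mj0 Mj1] := M01 i j; have /andP[Mp0 Mp1] := M01 i p.
have /andP[Nj0 Nj1] := M'01 i j; have /andP[Np0 Np1] := M'01 i p.
have [pj|pj] := eqVneq p j.
  rewrite pj mul1r (_ : mean_mx _ _ _ _ _ = 0); last first.
    by rewrite summxE big1 // => r _; rewrite !mxE eqxx mulr0.
  rewrite sub0r normrN ler_wpDr ?mulr_ge0 ?sqr_ge0 ?(b0 i) //.
  rewrite ger0_norm ?mulr_ge0 ?sqr_ge0 // -[leRHS]mulr1 ler_wpM2l ?sqr_ge0 //.
  by rewrite mulr_ile1 ?mulr_ge0 ?mulr_ile1.
rewrite mul0r add0r mean_entry 1?eq_sym //.
set c := expect _ _.
have hc : `|c - keep_prob i| <= 2%:R * delta by apply: rest_keep; rewrite eq_sym.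
have -> : delta * M' i j * (delta * M' i p * c) - delta ^+ 2 * (keep_prob i * (M i j * M i p))
   = delta ^+ 2 * (M' i j * M' i p * (c - keep_prob i) +
       keep_prob i * (M' i j * (M' i p - M i p) + M i p * (M' i j - M i j))) by ring.
rewrite normrM ger0_norm ?sqr_ge0 // ler_wpM2l ?sqr_ge0 //.
apply: le_trans (ler_normD _ _) _; apply: lerD.
  rewrite normrM ger0_norm ?mulr_ge0 //; apply: le_trans hc.
  by rewrite -[leRHS]mul1r ler_wpM2r // mulr_ile1.
rewrite normrM ger0_norm //.
have h1 : `|M' i j * (M' i p - M i p)| <= theta.
  rewrite normrM ger0_norm //; apply: le_trans (M'M i p).
  by rewrite -[leRHS]mul1r ler_wpM2r.
have h2 : `|M i p * (M' i j - M i j)| <= theta.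
  rewrite normrM ger0_norm //; apply: le_trans (M'M i j).
  by rewrite -[leRHS]mul1r ler_wpM2r.
have h3 := le_trans (ler_normD _ _) (lerD h1 h2).
apply: (@le_trans _ _ (theta + theta)); last by rewrite mulr2n mulrDl mul1r.
by apply: le_trans h3; rewrite -[leRHS]mul1r ler_wpM2r.
Qed.

(** Markov's inequality for the average number of observed entries in a row. *)
Lemma few_observed : (0 < m)%N -> (0 < l)%N ->
  expect qrow (fun w => (1 < delta_hat (sample w) * l%:R)%R%:R) <= l%:R * delta.
Proof.
move=> m0 l0.
have mR : 0 < m%:R :> R by rewrite ltr0n.
have lR : 0 < l%:R :> R by rewrite ltr0n.
apply: le_trans (expect_markov qrow_ge0 ltr01 _) _.
  move=> w; rewrite /delta_hat !mulr_ge0 ?invr_ge0 ?mulr_ge0 ?ler0n //.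
  by rewrite sumr_ge0 // => i _; rewrite sumr_ge0.
rewrite divr1.
apply: (@le_trans _ _ (expect qrow (fun w => m%:R^-1 * \sum_i \sum_j (obs (w i j))%:R))).
  apply: (expect_le qrow_ge0) => w; rewrite /delta_hat invfM mulrAC divfK ?gt_eqF //.
  rewrite ler_pM2l ?invr_gt0 //; apply: ler_sum => i _; apply: ler_sum => j _.
  rewrite mxE ler_nat; case: ltP => // vp.
  by rewrite (value_obs (lt0r_neq0 vp)).
rewrite expectZ (expect_sum qrow _ (fun i w => \sum_j (obs (w i j))%:R)).
under eq_bigr => i _.
  rewrite (expect_coord qrow_sum1 i (fun r : row => \sum_j (obs (r j))%:R)) -/(expect _ _).
  rewrite (expect_sum (q i) _ (fun j (r : row) => (obs (r j))%:R : R)).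
  under eq_bigr do rewrite expect_obs.
  rewrite sumr_const card_ord -mulr_natl.
  over.
by rewrite sumr_const card_ord -(mulr_natl (_ * _) m) mulrA mulVf ?mul1r // gt_eqF.
Qed.

(** Outside this event, the matrix that SPCA iterates is close to the Gram matrix
    of [kept], see [not_far]. *)
Definition far (a : R) (w : {ffun 'I_m -> {ffun 'I_l -> O}}) : bool :=
  (1 < delta_hat (sample w) * l%:R) ||
  (a < opnorm (\sum_i (rowX i (w i) - mean_mx qrow rowX i))).

Lemma not_far a w x : ~~ far a w ->
  enorm (spca_Phi (sample w) *m x - kept^T *m (kept *m x)) <=
    (a + m%:R * delta ^+ 2 * (1 + l%:R * (2%:R * delta + 2%:R * theta))) * enorm x.
Proof.
rewrite negb_or -!leNgt => /andP[h1 h2].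
rewrite spca_Phi_rows //.
have -> : \sum_i row_Phi (sample w i) = \sum_i rowX i (w i).
  apply: eq_bigr => i _; rewrite /rowX; congr row_Phi.
  by apply/funext => j; rewrite /sample mxE.
set S := \sum_i rowX i (w i); set E := \sum_i mean_mx qrow rowX i.
have -> : S *m x - kept^T *m (kept *m x) = (S - E) *m x + (E *m x - kept^T *m (kept *m x)).
  by rewrite mulmxBl addrA subrK.
apply: le_trans (enormD _ _) _; rewrite mulrDl lerD ?mean_near //.
apply: le_trans (enorm_mul_le _ _) _; rewrite ler_wpM2r ?enorm_ge0 //.
by rewrite /S /E -sumrB.
Qed.

Lemma far_prob a : (0 < m)%N -> (0 < l)%N -> 1 <= (ln l%:R : R) -> (ln l%:R : R) <= mu ->
  0 < a ->
  expect qrow (fun w => (far a w)%:R) <=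
    l%:R * delta + 600%:R * Num.sqrt (mu * ln l%:R) / a.
Proof.
move=> m0 l0 L1 Lmu a0.
pose F w := opnorm (\sum_i (rowX i (w i) - mean_mx qrow rowX i)).
apply: (@le_trans _ _ (expect qrow (fun w => (1 < delta_hat (sample w) * l%:R)%R%:R) +
    expect qrow (fun w => (a < F w)%R%:R))).
  rewrite -expectD; apply: (expect_le qrow_ge0) => w; rewrite /far -/(F w).
  by case: (1 < _); case: (a < _); rewrite /= ?addr0 ?add0r ?lerDl.
apply: lerD; first exact: few_observed.
apply: le_trans (expect_markov qrow_ge0 a0 _) _; first by move=> w; exact: opnorm_ge0.
by rewrite ler_pM2r ?invr_gt0 //; exact: deviation.
Qed.

End FiniteModel.

(** * Splitting the probability space into cells *)

Section IndicatorSums.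
Context {R : realType} {d : measure_display} {T : measurableType d}.
Variable P : probability T R.

Lemma sum_prob_integral (I : finType) (F : I -> set T) :
  (forall i, measurable (F i)) ->
  (\sum_i P (F i) = \int[P]_t ((\sum_i (\1_(F i) t : R))%:E))%E.
Proof.
move=> mF; under eq_integral do rewrite -sumEFin.
rewrite ge0_integral_sum //; first by apply: eq_bigr => i _; rewrite integral_indic ?setIT.
by move=> i; apply/measurable_EFinP; exact: measurable_indic.
Qed.

Lemma sum_indic_disjoint (I : finType) (F : I -> set T) t :
  (forall i j, F i t -> F j t -> i = j) ->
  \sum_i (\1_(F i) t : R) = \1_(\bigcup_i F i) t.
Proof.
move=> dF; have [[i _ it]|nt] := pselect ((\bigcup_i F i) t).
  rewrite (bigD1 i) //= big1 ?addr0; last first.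
    move=> j ji; rewrite indicE memNset // => jt.
    by move: ji; rewrite (dF _ _ jt it) eqxx.
  by rewrite !indicE !mem_set //; exists i.
rewrite big1 => [|i _]; first by rewrite indicE memNset.
by rewrite indicE memNset // => it; apply: nt; exists i.
Qed.

Lemma prob_disjoint_bigcup (I : finType) (F : I -> set T) :
  (forall i, measurable (F i)) -> (forall t i j, F i t -> F j t -> i = j) ->
  measurable (\bigcup_i F i) ->
  (\sum_i P (F i) = P (\bigcup_i F i))%E.
Proof.
move=> mF dF mU; rewrite sum_prob_integral //.
under eq_integral => t _ do rewrite (sum_indic_disjoint (dF t)).
by rewrite integral_indic // setIT.
Qed.

Lemma bigcup_measurable_fin (I : finType) (F : I -> set T) :
  (forall i, measurable (F i)) -> measurable (\bigcup_i F i).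
Proof.
move=> mF; apply: fin_bigcup_measurable => //; exact: finite_finset.
Qed.

End IndicatorSums.

(** The cell of a sample point is given by the entries of [M + X] rounded up to
    multiples of [1 / N], so that zero is only rounded to itself, and by the set
    of observed entries. *)
Section Cells.
Context {R : realType} {d : measure_display} {T : measurableType d}.
Variable P : probability T R.
Context (m l k : nat) (M : 'M[R]_(m, l)) (delta : R)
  (X : T -> 'M[R]_(m, l)) (Om : T -> {set 'I_m * 'I_l}) (Q0 : T -> 'M[R]_(l, k)).
Context (model : random_model P M delta X Om Q0).
Context (N : nat) (N_gt0 : (0 < N)%N).
Context (M01 : forall i j, 0 <= M i j <= 1).

Definition outcome : finType := ('I_N.+1 * bool)%type.

Definition value (o : outcome) : R := if o.2 then o.1%:R / N%:R else 0.

Definition entry_cell i j (c : 'I_N.+1) : set T :=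
  [set t | c%:R - 1 < (M i j + X t i j) * N%:R <= c%:R].

Definition cell (w : {ffun 'I_m -> {ffun 'I_l -> outcome}}) : set T :=
  [set t | forall i j, entry_cell i j (w i j).1 t /\ ((i, j) \in Om t) = (w i j).2].

Definition cell_weight (i : 'I_m) (j : 'I_l) (o : outcome) : R :=
  fine (P (entry_cell i j o.1)) * (if o.2 then delta else 1 - delta).

Let NR : 0 < N%:R :> R. Proof. by rewrite ltr0n. Qed.

Lemma y01 t i j : 0 <= M i j + X t i j <= 1.
Proof. by have := noise_range model t i j; rewrite mxE. Qed.

Definition grid_set i j (c : 'I_N.+1) : set R :=
  [set x | c%:R - 1 < (M i j + x) * N%:R <= c%:R].

Lemma measurable_grid_set i j c : measurable (grid_set i j c).
Proof.
have -> : grid_set i j c = `](c%:R - 1) / N%:R - M i j, c%:R / N%:R - M i j]%classic.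
  apply/seteqP; split => x /=; rewrite in_itv /= ltrBlDl lerBrDl ltr_pdivrMr // ler_pdivlMr //.
exact: measurable_itv.
Qed.

Lemma entry_cell_preimage i j c : entry_cell i j c = (fun t => X t i j) @^-1` grid_set i j c.
Proof. by apply/seteqP; split. Qed.

Lemma measurable_entry_cell i j c : measurable (entry_cell i j c).
Proof.
rewrite entry_cell_preimage -[_ @^-1` _]setTI.
exact: (noise_measurable model) (measurable_grid_set i j c).
Qed.

Lemma entry_cell_uniq i j c c' t : entry_cell i j c t -> entry_cell i j c' t -> c = c'.
Proof.
rewrite /entry_cell /= => /andP[h1 h2] /andP[h3 h4].
have : c%:R - 1 < c'%:R :> R by exact: lt_le_trans h1 h4.
have : c'%:R - 1 < c%:R :> R by exact: lt_le_trans h3 h2.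
rewrite !ltrBlDr !natr1 !ltr_nat !ltnS => a b.
by apply/val_inj/eqP; rewrite eqn_leq b a.
Qed.

Lemma entry_cell_cover i j t : exists c, entry_cell i j c t.
Proof.
have /andP[y0 y1] := y01 t i j; set y := M i j + X t i j in y0 y1.
have z0 : 0 <= y * N%:R by rewrite mulr_ge0 // ltW.
have z1 : y * N%:R <= N%:R by rewrite -[leRHS]mul1r ler_wpM2r // ltW.
have /andP[c1 c2] := ceil_itv (y * N%:R); set z := Num.ceil _ in c1 c2.
have zge0 : 0 <= z.
  have : (-1)%:~R < z%:~R :> R by apply: lt_le_trans c2; rewrite mulrN1z; lra.
  by rewrite ltr_int; lia.
have zleN : z <= N%:Z.
  have : (z - 1)%:~R < N%:Z%:~R :> R by exact: lt_le_trans c1 z1.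
  by rewrite ltr_int; lia.
have zN : (`|z|%N < N.+1)%N by lia.
exists (Ordinal zN); rewrite /entry_cell /= -/y.
have -> : (`|z|%N)%:R = z%:~R :> R by rewrite natr_absz ger0_norm.
by rewrite c2 andbT; move: c1; rewrite intrB.
Qed.

Lemma entry_cell_sum i j : \sum_c fine (P (entry_cell i j c)) = 1.
Proof.
apply: EFin_inj; rewrite -sumEFin.
under eq_bigr => c _ do rewrite (fineK (fin_num_measure P _ (measurable_entry_cell i j c))).
rewrite prob_disjoint_bigcup.
- rewrite (_ : \bigcup_c _ = setT) ?probability_setT //.
  by apply/seteqP; split => // t _; have [c hc] := entry_cell_cover i j t; exists c.
- by move=> c; exact: measurable_entry_cell.
- by move=> t c c'; exact: entry_cell_uniq.
- by apply: bigcup_measurable_fin => c; exact: measurable_entry_cell.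
Qed.

Definition grid_mean : 'M[R]_(m, l) :=
  \matrix_(i, j) \sum_c fine (P (entry_cell i j c)) * (c%:R / N%:R).

Lemma grid_mean01 i j : 0 <= grid_mean i j <= 1.
Proof.
rewrite mxE; apply/andP; split.
  by rewrite sumr_ge0 // => c _; rewrite mulr_ge0 ?divr_ge0 ?fine_ge0.
rewrite -[leRHS](entry_cell_sum i j); apply: ler_sum => c _.
rewrite -[leRHS]mulr1 ler_wpM2l ?fine_ge0 // ler_pdivrMr // mul1r ler_nat.
by rewrite -ltnS.
Qed.

Lemma expect_entry i j : (\int[P]_t (M i j + X t i j)%:E = (M i j)%:E)%E.
Proof.
have mX := noise_measurable model i j.
have iX : P.-integrable setT (EFin \o (fun t => X t i j)).
  apply: (@le_integrable _ _ _ _ _ measurableT _ (EFin \o cst 1)).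
  - exact/measurable_EFinP.
  - move=> t _ /=; rewrite lee_fin normr1 ler_norml.
    by have := y01 t i j; have := M01 i j; lra.
  - exact: finite_measure_integrable_cst.
under eq_integral do rewrite EFinD.
rewrite integralD //; last exact: finite_measure_integrable_cst.
have := noise_mean0 model i j; rewrite expectation.unlock => ->.
by rewrite adde0 integral_cst // [X in (_ * X)%E](probability_setT P) mule1.
Qed.

Lemma grid_mean_near i j : `|grid_mean i j - M i j| <= N%:R^-1.
Proof.
have mX := noise_measurable model i j.
pose Z (t : T) : R := \sum_(c < N.+1) (c%:R / N%:R) * \1_(entry_cell i j c) t.
have ZE t c : entry_cell i j c t -> Z t = c%:R / N%:R.
  move=> ct; rewrite /Z (bigD1 c) //= big1 ?addr0; last first.
    move=> c' cc'; rewrite indicE memNset ?mulr0 // => c't.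
    by move: cc'; rewrite (entry_cell_uniq c't ct) eqxx.
  by rewrite indicE mem_set // mulr1.
have Zb t : M i j + X t i j <= Z t <= M i j + X t i j + N%:R^-1.
  have [c ct] := entry_cell_cover i j t; rewrite (ZE _ _ ct).
  move: ct; rewrite /entry_cell /= ler_pdivlMr // => /andP[c1 ->] /=.
  by rewrite ler_pdivrMr // mulrDl mulVf ?gt_eqF //; lra.
have mc c : measurable_fun setT (\1_(entry_cell i j c) : T -> R).
  by apply: measurable_indic; exact: measurable_entry_cell.
have mZ : measurable_fun setT Z.
  by apply: measurable_sum => c; exact: measurable_funM.
have iZ : (\int[P]_t (Z t)%:E = (grid_mean i j)%:E)%E.
  under eq_integral => t _ do rewrite /Z -sumEFin.
  rewrite ge0_integral_sum //; last first.
    by move=> c; apply/measurable_EFinP; exact: measurable_funM.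
  rewrite mxE -sumEFin; apply: eq_bigr => c _.
  under eq_integral do rewrite EFinM.
  rewrite ge0_integralZl //; last first.
    exact/measurable_EFinP.
  have mec := measurable_entry_cell i j c.
  by rewrite integral_indic // setIT muleC [RHS]EFinM fineK // fin_num_measure.
have mY : measurable_fun setT (fun t => M i j + X t i j) by exact: measurable_funD.
have lo : ((M i j)%:E <= (grid_mean i j)%:E)%E.
  rewrite -iZ -(expect_entry i j); apply: ge0_le_integral => //.
  - by move=> t _; rewrite lee_fin; have /andP[] := y01 t i j.
  - exact/measurable_EFinP.
  - exact/measurable_EFinP.
  - by move=> t _; rewrite lee_fin; have /andP[] := Zb t.
have hi : ((grid_mean i j)%:E <= (M i j)%:E + (N%:R^-1)%:E)%E.
  rewrite -iZ -(expect_entry i j).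
  have -> : (N%:R^-1%:E = \int[P]_t (N%:R^-1)%:E)%E.
    by rewrite integral_cst // [X in (_ * X)%E](probability_setT P) mule1.
  rewrite -ge0_integralD //.
  - apply: ge0_le_integral => //.
    + move=> t _; rewrite lee_fin; have /andP[h _] := Zb t; apply: le_trans h.
      by have /andP[] := y01 t i j.
    + exact/measurable_EFinP.
    + by apply: emeasurable_funD => //; exact/measurable_EFinP.
    + by move=> t _; rewrite -EFinD lee_fin; have /andP[] := Zb t.
  - by move=> t _; rewrite lee_fin; have /andP[] := y01 t i j.
  - exact/measurable_EFinP.
move: lo hi; rewrite -EFinD !lee_fin => lo hi; rewrite ler_norml.
have : 0 <= N%:R^-1 :> R by rewrite invr_ge0 ltW.
lra.
Qed.

Lemma cell_weight_ge0 : 0 <= delta <= 1 -> forall i j o, 0 <= cell_weight i j o.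
Proof.
move=> /andP[d0 d1] i j o; rewrite mulr_ge0 ?fine_ge0 //.
by case: o.2; rewrite ?subr_ge0.
Qed.

Lemma sum_outcome (F : outcome -> R) :
  \sum_o F o = \sum_c (F (c, true) + F (c, false)).
Proof.
rewrite (eq_bigr (fun o => F (o.1, o.2))) => [|[]] //.
rewrite -(pair_bigA _ (fun c b => F (c, b))) /=; apply: eq_bigr => c _.
by rewrite big_bool.
Qed.

Lemma cell_weight_sum i j : \sum_o cell_weight i j o = 1.
Proof.
rewrite sum_outcome -[RHS](entry_cell_sum i j); apply: eq_bigr => c _.
by rewrite /cell_weight /=; ring.
Qed.

Lemma cell_weight_obs i j : \sum_o cell_weight i j o * (o.2)%:R = delta.
Proof.
rewrite sum_outcome -[RHS]mul1r -[in RHS](entry_cell_sum i j) mulr_suml.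
by apply: eq_bigr => c _; rewrite /cell_weight /= mulr1 mulr0 addr0.
Qed.

Lemma cell_weight_mean i j :
  \sum_o cell_weight i j o * value o = delta * grid_mean i j.
Proof.
rewrite sum_outcome mxE mulr_sumr.
by apply: eq_bigr => c _; rewrite /cell_weight /value /= mulr0 addr0; ring.
Qed.

Lemma value01 o : 0 <= value o <= 1.
Proof.
rewrite /value; case: o.2; last by rewrite lexx ler01.
by rewrite divr_ge0 ?ler0n // ler_pdivrMr // mul1r ler_nat -ltnS ltn_ord.
Qed.

Lemma value_obs o : value o != 0 -> o.2.
Proof. by rewrite /value; case: o.2 => //; rewrite eqxx. Qed.

Lemma obs_event_prob i j b :
  P [set t | ((i, j) \in Om t) = b] = (if b then delta else 1 - delta)%:E.
Proof.
have mO := obs_measurable model i j; have pO := obs_proba model i j.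
case: b; first by rewrite -pO; congr (P _); apply/seteqP; split.
rewrite EFinB -pO -probability_setC //; congr (P _).
by apply/seteqP; split => t /=; [move=> -> | move/negP/negbTE].
Qed.

Lemma borel_obs_event i j b : measurable [set t | ((i, j) \in Om t) = b].
Proof.
have mO := obs_measurable model i j.
case: b; first by congr (measurable _): mO; apply/seteqP; split.
rewrite (_ : [set t | _] = ~` [set t | (i, j) \in Om t]); first exact: measurableC.
by apply/seteqP; split => t /=; [move=> -> | move/negP/negbTE].
Qed.

Definition cell_events (w : {ffun 'I_m -> {ffun 'I_l -> outcome}}) (B : set 'M[R]_(l, k))
    (x : ('I_m * 'I_l) + ('I_m * 'I_l) + unit) : set T :=
  match x with
  | inl (inl (i, j)) => entry_cell i j (w i j).1
  | inl (inr (i, j)) => [set t | ((i, j) \in Om t) = (w i j).2]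
  | inr _ => Q0 @^-1` B
  end.

Lemma cell_eventsE w B :
  cell w `&` (Q0 @^-1` B) =
    \bigcap_(x in [set` [set: ('I_m * 'I_l) + ('I_m * 'I_l) + unit]%SET]) cell_events w B x.
Proof.
apply/seteqP; split => t.
  by move=> [ct Bt] [[[i j]|[i j]]|[]] _ //=; have [] := ct i j.
move=> h; split; last by exact: (h (inr tt) (finset.in_setT _)).
move=> i j; split; first exact: (h (inl (inl (i, j))) (finset.in_setT _)).
exact: (h (inl (inr (i, j))) (finset.in_setT _)).
Qed.

(** A cell is an intersection of events on the single entries and indicators, to
    which the product rule applies as it stands. *)
Lemma cell_prob w B : borel_mx B ->
  P (cell w `&` (Q0 @^-1` B)) =
    ((prod_weight (fun i r => prod_weight (cell_weight i) r) w)%:E * P (Q0 @^-1` B))%E.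
Proof.
move=> bB; rewrite cell_eventsE.
rewrite (model_independent model); last first.
  move=> [[[i j]|[i j]]|[]] _ /=.
  - exists (grid_set i j (w i j).1); first exact: measurable_grid_set.
    by rewrite setTI entry_cell_preimage.
  - by exists [set (w i j).2] => //; rewrite setTI; apply/seteqP; split.
  - by exists B => //; rewrite setTI.
rewrite (eq_bigl xpredT); last by move=> x; rewrite finset.in_setT.
rewrite big_sumType big_sumType /= (big_pred1 tt) //=.
congr (_ * _)%E; rewrite -big_split /=.
under eq_bigr => ij _.
  rewrite (_ : (P _ * P _)%E = (cell_weight ij.1 ij.2 (w ij.1 ij.2))%:E); last first.
    case: ij => i j /=; rewrite obs_event_prob /cell_weight EFinM fineK //.
    by rewrite fin_num_measure //; exact: measurable_entry_cell.
  over.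
rewrite prodEFin; congr (_%:E).
by rewrite /prod_weight pair_big.
Qed.

Lemma measurable_cell w : measurable (cell w).
Proof.
have -> : cell w = \bigcap_(ij in [set: 'I_m * 'I_l])
    (entry_cell ij.1 ij.2 (w ij.1 ij.2).1 `&` [set t | ((ij.1, ij.2) \in Om t) = (w ij.1 ij.2).2]).
  apply/seteqP; split => t; first by move=> ct [i j] _ /=; exact: ct.
  by move=> h i j; exact: (h (i, j) I).
apply: fin_bigcap_measurable => [|ij _]; first exact: finite_finset.
by apply: measurableI; [exact: measurable_entry_cell|exact: borel_obs_event].
Qed.

Lemma cell_uniq w w' t : cell w t -> cell w' t -> w = w'.
Proof.
move=> h h'; apply/ffunP => i; apply/ffunP => j.
have [c b] := h i j; have [c' b'] := h' i j.
have e1 := entry_cell_uniq c c'; move: b b' => -> e2.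
by case: (w i j) (w' i j) e1 e2 => [? ?] [? ?] /= -> ->.
Qed.

(** Rounding up keeps the zero pattern, which determines the trimming threshold
    and the trimmed rows. *)
Lemma cell_sample w t i j : cell w t ->
  let a := proj_obs (Om t) (M + X t) i j in
  let b := sample value w i j in
  [/\ 0 <= a <= 1, `|a - b| <= N%:R^-1, (a == 0) = (b == 0) & (0 < a) = (0 < b)].
Proof.
move=> /(_ i j) [ct ot] /=; rewrite !mxE /value ot; move: ct; rewrite /entry_cell /= => ct.
case: (w i j) ct => c b /=; case: b {ot}; last first.
  by rewrite subrr normr0 invr_ge0 ler0n lexx ler01.
have y := y01 t i j; move: (y); move: (M i j + X t i j) => {}y y01 /andP[c1 c2] /=.
have yc : y <= c%:R / N%:R by rewrite ler_pdivlMr.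
have cy : c%:R / N%:R < y + N%:R^-1.
  by rewrite ltr_pdivrMr // mulrDl mulVf ?gt_eqF //; lra.
have N'0 : 0 < N%:R^-1 :> R by rewrite invr_gt0.
have pos : (0 < y) = (0 < c%:R / N%:R :> R).
  apply/idP/idP => h; first exact: lt_le_trans yc.
  have c1' : 1 <= c%:R :> R.
    by move: h; rewrite pmulr_lgt0 // ltr0n ler1n.
  have yN : 0 < y * N%:R by lra.
  by move: yN; rewrite pmulr_lgt0.
have c0 : 0 <= c%:R / N%:R :> R by rewrite divr_ge0.
have /andP[y0 y1] := y01.
split=> //; first by rewrite ler_norml; lra.
by move: pos; rewrite !lt0r y0 c0 !andbT => /negb_inj.
Qed.

End Cells.

(** * Perturbation lemmas for the algorithm *)

Section Assembly.
Context {R : realType}.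

(** Gram-Schmidt, one column at a time. *)
Lemma orthonormal_factor l k (Y : 'M[R]_(l, k)) :
  (forall x : 'cV_k, Y *m x = 0 -> x = 0) ->
  exists (W : 'M[R]_(l, k)) (B : 'M[R]_k), orthonormal_cols W /\ Y = W *m B.
Proof.
elim: k Y => [|k ih] Y inj.
  by exists Y, 1%:M; split; [apply/matrixP => -[]|rewrite mulmx1].
move: Y inj; rewrite -(add1n k) => Y inj.
pose y : 'M[R]_(l, 1) := lsubmx Y.
pose Y' : 'M[R]_(l, k) := rsubmx Y.
have YE : Y = row_mx y Y' by rewrite hsubmxK.
have inj' (x : 'cV_k) : Y' *m x = 0 -> x = 0.
  move=> Yx; have : col_mx (0 : 'M[R]_(1, 1)) x = 0.
    by apply: inj; rewrite YE mul_row_col mulmx0 add0r.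
  by rewrite -[RHS]col_mx0 => /eq_col_mx[].
have [W' [B' [orthW' Y'E]]] := ih _ inj'.
have uB' : B' \in unitmx.
  by apply: unitmx_inj => x Bx; apply: inj'; rewrite Y'E -mulmxA Bx mulmx0.
pose r := y - W' *m (W'^T *m y).
have W'r : W'^T *m r = 0 by rewrite mulmxBr [W'^T *m (W' *m _)]mulmxA orthW' mul1mx subrr.
have r0 : r != 0.
  apply/eqP => r0.
  have : col_mx (1%:M : 'M[R]_(1, 1)) (- (invmx B' *m (W'^T *m y))) = 0.
    apply: inj; rewrite YE mul_row_col mulmx1 mulmxN Y'E -mulmxA mulKVmx //.
  rewrite -[RHS]col_mx0 => /eq_col_mx[/matrixP/(_ 0 0)].
  by rewrite !mxE => /eqP; rewrite oner_eq0.
have rp := enorm_gt0 r0.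
pose w := (enorm r)^-1 *: r.
have ww : w^T *m w = 1%:M.
  rewrite [LHS]mx11_scalar -/(dot w w) -enorm_sqr enormZ ger0_norm ?invr_ge0 ?enorm_ge0 //.
  by rewrite mulVf ?gt_eqF // expr1n.
have W'w : W'^T *m w = 0 by rewrite -scalemxAr W'r scaler0.
have wW' : w^T *m W' = 0 by apply: trmx_inj; rewrite trmx_mul trmxK W'w trmx0.
exists (row_mx w W').
exists (row_mx (col_mx (enorm r)%:M (W'^T *m y)) (col_mx 0 B')).
split.
  rewrite /orthonormal_cols tr_row_mx mul_col_row ww W'w wW' orthW'.
  by rewrite -scalar_mx_block.
rewrite YE mul_mx_row !mul_row_col mulmx0 add0r -Y'E; congr row_mx.
rewrite mul_mx_scalar scalerA mulfV ?gt_eqF // scale1r.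
by rewrite /r subrK.
Qed.

Lemma power_perturbation l (F G : 'M[R]_l) (Lam eps : R) N : 1 <= Lam -> 0 <= eps ->
  (forall x, enorm (F *m x) <= Lam * enorm x) ->
  (forall x, enorm (G *m x) <= Lam * enorm x) ->
  (forall x, enorm ((F - G) *m x) <= eps * enorm x) ->
  forall x, enorm (F ^+ N *m x - G ^+ N *m x) <= N%:R * Lam ^+ N * eps * enorm x.
Proof.
move=> L1 e0 hF hG hFG x.
have L0 : 0 <= Lam by lra.
have GN j : enorm (G ^+ j *m x) <= Lam ^+ j * enorm x.
  elim: j => [|j ih]; first by rewrite !expr0 mul1mx mul1r.
  by rewrite mxpowS -mulmxA exprS -mulrA; apply: le_trans (hG _) _; rewrite ler_wpM2l.
elim: N => [|N ih]; first by rewrite !expr0 subrr enorm0 !mul0r.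
have -> : F ^+ N.+1 *m x - G ^+ N.+1 *m x =
    F *m (F ^+ N *m x - G ^+ N *m x) + (F - G) *m (G ^+ N *m x).
  by rewrite !mxpowS mulmxBr mulmxBl !mulmxA addrA subrK.
apply: le_trans (enormD _ _) _.
apply: (@le_trans _ _ (Lam * (N%:R * Lam ^+ N * eps * enorm x) + eps * (Lam ^+ N * enorm x))).
  apply: lerD; first by apply: le_trans (hF _) _; rewrite ler_wpM2l.
  by apply: le_trans (hFG _) _; rewrite ler_wpM2l.
have LN : Lam ^+ N <= Lam ^+ N.+1 by rewrite exprS -[leLHS]mul1r ler_wpM2r // exprn_ge0.
have : eps * (Lam ^+ N * enorm x) <= eps * (Lam ^+ N.+1 * enorm x).
  by rewrite ler_wpM2l // ler_wpM2r ?enorm_ge0.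
rewrite -natr1 !exprS; lra.
Qed.

Lemma spca_PhiE m l (A : 'M[R]_(m, l)) j p : spca_Phi A j p =
  if j == p then 0 else \sum_i trimming A i j * trimming A i p.
Proof.
rewrite /spca_Phi /diag_part.
rewrite [LHS]mxE [X in _ + X]mxE [X in _ - X]mxE [X in - (X *+ _)]mxE.
case: eqP => [->|_]; first by rewrite mulr1n subrr.
rewrite mulr0n subr0 mxE; apply: eq_bigr => i _; by rewrite mxE.
Qed.

Lemma spca_Phi_sym m l (A : 'M[R]_(m, l)) : (spca_Phi A)^T = spca_Phi A.
Proof.
apply/matrixP => j p; rewrite mxE !spca_PhiE eq_sym; case: eqP => // _.
by apply: eq_bigr => i _; rewrite mulrC.
Qed.

Lemma trimming01 m l (A : 'M[R]_(m, l)) : (forall i j, 0 <= A i j <= 1) ->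
  forall i j, 0 <= trimming A i j <= 1.
Proof. by move=> A01 i j; rewrite mxE; case: ifP => //; rewrite lexx ler01. Qed.

Lemma spca_Phi_bounded m l (A : 'M[R]_(m, l)) : (forall i j, 0 <= A i j <= 1) ->
  forall x, enorm (spca_Phi A *m x) <= l%:R * m%:R * enorm x.
Proof.
move=> A01; apply: schur_test (spca_Phi_sym A) _ => j.
apply: (@le_trans _ _ (\sum_(p < l) m%:R)); last first.
  by rewrite sumr_const card_ord [leRHS]mulr_natl.
apply: ler_sum => p _; rewrite spca_PhiE; case: eqP => _; first by rewrite normr0.
apply: le_trans (ler_norm_sum _ _ _) _.
apply: (@le_trans _ _ (\sum_(i < m) 1)); last by rewrite sumr_const card_ord.
apply: ler_sum => i _; have t01 := trimming01 A01 i.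
have /andP[j0 j1] := t01 j; have /andP[p0 p1] := t01 p.
by rewrite ger0_norm ?mulr_ge0 // mulr_ile1.
Qed.

(** Two matrices with the same zero pattern have the same trimmed rows. *)
Lemma spca_Phi_near m l (A B : 'M[R]_(m, l)) (theta : R) :
  (forall i j, 0 <= A i j <= 1) -> (forall i j, 0 <= B i j <= 1) ->
  (forall i j, `|A i j - B i j| <= theta) ->
  (forall i j, (A i j == 0) = (B i j == 0)) ->
  (forall i j, (0 < A i j) = (0 < B i j)) ->
  forall x, enorm ((spca_Phi A - spca_Phi B) *m x)
    <= l%:R * (m%:R * (2%:R * theta)) * enorm x.
Proof.
move=> A01 B01 AB z0 pos.
have dE : delta_hat A = delta_hat B.
  rewrite /delta_hat; congr (_ * _); apply: eq_bigr => i _.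
  by apply: eq_bigr => j _; rewrite pos.
have wE i : row_weight A i = row_weight B i.
  by apply: eq_card => j; rewrite !inE z0.
have tE i j : `|trimming A i j - trimming B i j| <= theta.
  rewrite !mxE dE wE; case: ifP => // _.
  by rewrite subrr normr0; apply: le_trans (AB i j); exact: normr_ge0.
apply: schur_test => [|j]; first by rewrite linearB /= !spca_Phi_sym.
apply: (@le_trans _ _ (\sum_(p < l) m%:R * (2%:R * theta))); last first.
  by rewrite sumr_const card_ord [leRHS]mulr_natl.
apply: ler_sum => p _; rewrite mxE [X in _ + X]mxE !spca_PhiE.
apply: (@le_trans _ _ (\sum_(i < m) (2%:R * theta))); last first.
  by rewrite sumr_const card_ord [leRHS]mulr_natl.
case: eqP => _.
  rewrite subrr normr0 sumr_ge0 // => i _; rewrite mulr_ge0 //.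
  by apply: le_trans (AB i j); exact: normr_ge0.
rewrite -sumrB; apply: le_trans (ler_norm_sum _ _ _) _; apply: ler_sum => i _.
have -> : trimming A i j * trimming A i p - trimming B i j * trimming B i p =
    trimming A i j * (trimming A i p - trimming B i p) +
    trimming B i p * (trimming A i j - trimming B i j) by ring.
have h (a b : R) : 0 <= a <= 1 -> `|b| <= theta -> `|a * b| <= theta.
  move=> /andP[a0 a1] hb; rewrite normrM ger0_norm //; apply: le_trans hb.
  by rewrite -[leRHS]mul1r ler_wpM2r.
apply: le_trans (ler_normD _ _) _; rewrite mulr2n mulrDl mul1r.
by apply: lerD; apply: h; rewrite ?trimming01.
Qed.

Section SingularValues.
Context (m l k : nat) (kl : (k <= l)%N) (M U : 'M[R]_(m, l)) (s : seq R) (V : 'M[R]_l).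
Context (svd : is_svd M U s V).
Let V1 := first_cols kl V.

Lemma svd_norm (x : 'cV[R]_l) : enorm (M *m x) ^+ 2 = \sum_(i < l) (s`_i * (V^T *m x) i 0) ^+ 2.
Proof.
have [orthU _ _ ->] := svd.
rewrite -!mulmxA enorm_isom // enorm_sum; apply: eq_bigr => i _.
by rewrite mul_diag_mx !mxE.
Qed.

Lemma first_cols_orthonormal : orthonormal_cols V1.
Proof.
have [_ orthV _ _] := svd.
apply/matrixP => a b; move: orthV => /matrixP/(_ (widen_ord kl a) (widen_ord kl b)).
rewrite !mxE -(inj_eq val_inj) /= (inj_eq val_inj) => <-.
by apply: eq_bigr => i _; rewrite !mxE.
Qed.

Lemma first_cols_coord (x : 'cV[R]_l) (i : 'I_l) (hi : (i < k)%N) :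
  (V1^T *m x) (Ordinal hi) 0 = (V^T *m x) i 0.
Proof.
rewrite !mxE; apply: eq_bigr => j _; rewrite !mxE; congr (V j _ * _).
exact: val_inj.
Qed.

Lemma sval_ge0 i : 0 <= s`_i.
Proof.
have [_ _ [_ _ /allP s0] _] := svd.
have [lt|ge] := ltnP i (size s); first by apply: s0; exact: mem_nth.
by rewrite nth_default.
Qed.

Lemma sval_le i j : (i <= j)%N -> s`_j <= s`_i.
Proof.
have [_ _ [_ sorted_s _] _] := svd => ij.
have [lt|ge] := ltnP j (size s); last by rewrite (nth_default _ ge) sval_ge0.
have tr : transitive (>=%R : rel R) by move=> a b c /= h h'; exact: le_trans h' h.
have rf : reflexive (>=%R : rel R) by move=> a /=.
apply: (sorted_leq_nth tr rf 0 sorted_s) => //.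
by rewrite inE; exact: leq_ltn_trans ij lt.
Qed.

Lemma svd_top y : (0 < k)%N -> singval s k * enorm y <= enorm (M *m (V1 *m y)).
Proof.
move=> k0; rewrite /singval.
rewrite -ler_sqr ?nnegrE ?mulr_ge0 ?sval_ge0 ?enorm_ge0 // svd_norm.
have yE : y = V1^T *m (V1 *m y) by rewrite mulmxA first_cols_orthonormal mul1mx.
rewrite exprMn {1}yE enorm_sum mulr_sumr.
rewrite [leRHS](bigID (fun i : 'I_l => (i < k)%N)) /= ler_wpDr //.
  by rewrite sumr_ge0 // => i _; rewrite sqr_ge0.
rewrite (eq_bigr (fun i : 'I_k =>
    s`_k.-1 ^+ 2 * (V^T *m (V1 *m y)) (widen_ord kl i) 0 ^+ 2)); last first.
  move=> i _; congr (_ * _ ^+ 2).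
  have hi : (widen_ord kl i < k)%N by exact: ltn_ord i.
  rewrite -(first_cols_coord _ hi); congr (_ _ _); exact: val_inj.
rewrite -(big_ord_narrow kl (F := fun i : 'I_l => s`_k.-1 ^+ 2 * (V^T *m (V1 *m y)) i 0 ^+ 2)).
apply: ler_sum => i ik; rewrite exprMn ler_wpM2r ?sqr_ge0 //.
by rewrite ler_sqr ?nnegrE ?sval_ge0 // sval_le //; lia.
Qed.

Lemma svd_bot x : V1^T *m x = 0 -> enorm (M *m x) <= singval s k.+1 * enorm x.
Proof.
move=> Vx; rewrite /singval /=.
have [_ orthV _ _] := svd.
rewrite -ler_sqr ?nnegrE ?mulr_ge0 ?sval_ge0 ?enorm_ge0 // svd_norm.
apply: (@le_trans _ _ (\sum_(i < l) s`_k ^+ 2 * (V^T *m x) i 0 ^+ 2)).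
  apply: ler_sum => i _; rewrite exprMn.
  have [ik|ki] := ltnP i k.
    by rewrite -(first_cols_coord x ik) Vx mxE expr0n /= !mulr0.
  by rewrite ler_wpM2r ?sqr_ge0 // ler_sqr ?nnegrE ?sval_ge0 // sval_le.
rewrite -mulr_sumr -enorm_sum exprMn ler_wpM2l ?sqr_ge0 //.
by rewrite ler_sqr ?nnegrE ?enorm_ge0 // enorm_trmul.
Qed.

End SingularValues.

Lemma qr_iterates l k (Phi : 'M[R]_l) (Q0 Q : 'M[R]_(l, k)) :
  qr_output Phi Q0 Q -> exists S, Phi ^+ qr_iterations (R := R) l *m Q0 = Q *m S.
Proof.
move=> [Qs [Rs [Qs0 step ->]]].
have h tau : (tau <= qr_iterations (R := R) l)%N ->
    exists S, Phi ^+ tau *m Q0 = Qs tau *m S.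
  elim: tau => [_|tau ih lt].
    by exists 1%:M; rewrite Qs0 mulmx1 expr0 mul1mx.
  have [S hS] := ih (ltnW lt); have [QR _ _] := step _ lt.
  exists (Rs tau.+1 *m S).
  by rewrite mxpowS -mulmxA hS mulmxA QR mulmxA.
exact: h.
Qed.

End Assembly.

(** * Deterministic estimates *)

Section FixedSize.
Context {R : realType}.

(** Shrinking the rows of [M] by bounded factors preserves the row
    space of its leading part, so that the gap survives even though [s_1] may
    be much larger than [s_k]. *)
Lemma near_gram_rows m l k (kl : (k <= l)%N) (M U : 'M[R]_(m, l)) s (V Phi : 'M[R]_l)
    (g : 'I_m -> R) (delta eta : R) :
  is_svd M U s V -> (0 < k)%N -> 0 < delta -> 0 < singval s k ->
  0 <= eta <= 1 / 100%:R ->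
  (forall i, 1 / 4%:R <= g i <= 1) ->
  singval s k.+1 <= eta / 2%:R * singval s k ->
  let C := \matrix_(i, j) (delta * Num.sqrt (g i) * M i j) in
  let c := delta * singval s k / 2%:R in
  Phi^T = Phi ->
  (forall x, enorm (Phi *m x - C^T *m (C *m x)) <= eta * c ^+ 2 * enorm x) ->
  near_gram Phi C (first_cols kl V) c eta.
Proof.
move=> svd k0 d0 s0 eta01 g01 gap C c symPhi err.
have g0 i : 0 <= g i by have := g01 i; lra.
have Cx x : enorm (C *m x) ^+ 2 = delta ^+ 2 * \sum_i g i * (M *m x) i 0 ^+ 2.
  rewrite enorm_sum mulr_sumr; apply: eq_bigr => i _.
  have -> : (C *m x) i 0 = delta * Num.sqrt (g i) * (M *m x) i 0.
    by rewrite !mxE mulr_sumr; apply: eq_bigr => j _; rewrite !mxE mulrA.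
  by rewrite !exprMn sqr_sqrtr // mulrA.
have Chi x : enorm (C *m x) <= delta * enorm (M *m x).
  rewrite -ler_sqr ?nnegrE ?enorm_ge0 ?mulr_ge0 ?enorm_ge0 ?(ltW d0) // Cx exprMn.
  rewrite ler_wpM2l ?sqr_ge0 // enorm_sum; apply: ler_sum => i _.
  by rewrite -[leRHS]mul1r ler_wpM2r ?sqr_ge0 //; have /andP[] := g01 i.
have Clo x : delta / 2%:R * enorm (M *m x) <= enorm (C *m x).
  have d2 : 0 <= delta / 2%:R by lra.
  rewrite -ler_sqr ?nnegrE ?enorm_ge0 //; last exact: mulr_ge0 (enorm_ge0 _).
  rewrite Cx !exprMn -mulrA.
  rewrite ler_wpM2l ?sqr_ge0 // enorm_sum mulr_sumr; apply: ler_sum => i _.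
  rewrite ler_wpM2r ?sqr_ge0 //; have /andP[h _] := g01 i; apply: le_trans h.
  by lra.
split => //.
- exact: first_cols_orthonormal svd.
- by rewrite /c; nra.
- move=> y; apply: le_trans (Clo _).
  have d2 : 0 <= delta / 2%:R by lra.
  apply: le_trans (ler_wpM2l d2 (svd_top kl svd y k0)).
  by rewrite /c le_eqVlt; apply/orP; left; apply/eqP; ring.
- move=> w Vw; apply: le_trans (Chi _) _.
  have h := svd_bot svd Vw.
  apply: (@le_trans _ _ (delta * (eta / 2%:R * singval s k * enorm w))).
    rewrite ler_pM2l //; apply: le_trans h _; rewrite ler_wpM2r ?enorm_ge0 //.
  by rewrite /c le_eqVlt; apply/orP; left; apply/eqP; ring.
Qed.

(** The initial matrix only needs to be in good position for a matrix [Phi'] that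
    approximates [Phi], which may therefore be chosen before [Q0]. *)
Lemma perturbed_power_iteration m l k (Phi Phi' : 'M[R]_l) (C : 'M[R]_(m, l))
    (V1 Q0 : 'M[R]_(l, k)) (c eta sigma : R) N v :
  near_gram Phi C V1 c eta -> near_gram Phi' C V1 c eta ->
  orthonormal_cols Q0 -> 0 < sigma ->
  (forall x, enorm (Phi ^+ N *m x - Phi' ^+ N *m x)
     <= sigma * (c ^+ 2 / 2%:R) ^+ N / 2%:R * enorm x) ->
  (forall d, sigma * enorm (Phi' ^+ N *m (V1 *m d))
     <= enorm (Q0^T *m (Phi' ^+ N *m (V1 *m d)))) ->
  (Phi ^+ N *m Q0)^T *m v = 0 ->
  enorm (V1^T *m v) <= (8%:R * eta + 2%:R * (20%:R * eta) ^+ N / sigma) * enorm v.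
Proof.
move=> ng ng' orthQ s0 close hQ hv.
have c0 := ng_c ng.
set beta := (c ^+ 2 / 2%:R) ^+ N.
have b0 : 0 < beta by rewrite exprn_gt0 // divr_gt0 // exprn_gt0.
pose rho := sigma * beta / 2%:R.
have rho0 : 0 < rho by rewrite divr_gt0 // mulr_gt0.
have V1n (d : 'cV_k) : enorm (V1 *m d) = enorm d by rewrite enorm_isom //; exact: ng_orth ng.
have := power_iteration ng orthQ rho0 _ hv.
have -> : (10%:R * eta * c ^+ 2) ^+ N / rho = 2%:R * (20%:R * eta) ^+ N / sigma.
  rewrite (_ : 10%:R * eta * c ^+ 2 = (20%:R * eta) * (c ^+ 2 / 2%:R)); last by field.
  rewrite exprMn -/beta /rho; field; by rewrite !gt_eqF.
apply=> d.
have h1 := hQ d.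
have [_ h2] := cone_iter ng' N d; rewrite -/beta in h2.
have h3 := enorm_trmul (Phi' ^+ N *m (V1 *m d)) (ng_orth ng).
have h4 := close (V1 *m d); rewrite V1n -/beta in h4.
have h5 := enorm_trmul (Phi' ^+ N *m (V1 *m d) - Phi ^+ N *m (V1 *m d)) orthQ.
have h6 := enormB_ge (Q0^T *m (Phi' ^+ N *m (V1 *m d))) 
  (Q0^T *m (Phi' ^+ N *m (V1 *m d) - Phi ^+ N *m (V1 *m d))).
rewrite -mulmxBr subKr in h6.
rewrite -enormN opprB in h4.
have h7 : sigma * (beta * enorm d) <= sigma * enorm (Phi' ^+ N *m (V1 *m d)).
  by rewrite ler_pM2l //; apply: le_trans h2 h3.
by rewrite /rho; lra.
Qed.

(** Ten times [ln l] iterations gain a factor [l ^ 10], against a loss of order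
    [l ^ 5] in the conditioning of the initial matrix. *)
Lemma iterations_enough l k (eta : R) : (0 < k)%N -> (k <= l)%N ->
  0 <= eta <= 1 / 100%:R ->
  2%:R * (20%:R * eta) ^+ qr_iterations (R := R) l /
    (2%:R * l%:R ^+ 2 * (l ^ 2)%:R * k%:R)^-1 <= 4%:R / l%:R.
Proof.
move=> k0 kl /andP[e0 e1].
have l0 : (0 < l)%N by exact: leq_trans kl.
have lR : 1 <= l%:R :> R by rewrite ler1n.
have lp : 0 < l%:R :> R by lra.
set N := qr_iterations l.
have hN : 10%:R * ln l%:R <= N%:R :> R.
  rewrite /N /qr_iterations natr_absz ger0_norm; first exact: ceil_ge.
  rewrite ceil_ge0; apply: (lt_le_trans (ltrN10 R)).
  by rewrite mulr_ge0 // ln_ge0.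
have h1 : (20%:R * eta) ^+ N <= l%:R^-1 ^+ 10.
  have base : 20%:R * eta <= expR (- 1).
    rewrite expRN; apply: (@le_trans _ _ (4%:R^-1)); first by lra.
    by rewrite lef_pV2 ?posrE ?expR_gt0 // expR1_le4.
  apply: (@le_trans _ _ (expR (-1) ^+ N)).
    by rewrite lerXn2r // ?nnegrE ?expR_ge0 // mulr_ge0.
  rewrite -expRM_natl mulrN1.
  apply: (@le_trans _ _ (expR (- (10%:R * ln l%:R)))); first by rewrite ler_expR lerN2.
  by rewrite -mulrN expRM_natl expRN lnK.
rewrite invrK.
have kR : k%:R <= l%:R :> R by rewrite ler_nat.
apply: (@le_trans _ _ (2%:R * l%:R^-1 ^+ 10 * (2%:R * l%:R ^+ 2 * l%:R ^+ 2 * l%:R))).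
  rewrite natrX; apply: ler_pM; rewrite ?mulr_ge0 ?exprn_ge0 ?mulr_ge0 ?ler0n //.
    by rewrite ler_pM2l.
  by rewrite ler_wpM2l // ?mulr_ge0 ?exprn_ge0.
have -> : 2%:R * l%:R^-1 ^+ 10 * (2%:R * l%:R ^+ 2 * l%:R ^+ 2 * l%:R) =
   4%:R / l%:R * l%:R^-1 ^+ 4 :> R by field; rewrite gt_eqF.
rewrite -[leRHS]mulr1 ler_wpM2l ?divr_ge0 ?ler0n // exprn_ile1 ?invr_ge0 ?ler0n //.
by rewrite invf_le1.
Qed.

End FixedSize.

(** * The bound for one size *)

Section FixedSizeProbability.
Context {R : realType}.

Lemma borel_setT l k : borel_mx (setT : set 'M[R]_(l, k)).
Proof. exact: (@measurableT _ (mxT l k)). Qed.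

(** The squared Frobenius norm of [M] is at most [m * l]. *)
Lemma singval_le m l k (M U : 'M[R]_(m, l)) (s : seq R) (V : 'M[R]_l) :
  is_svd M U s V -> (0 < k)%N -> (k <= l)%N -> (forall i j, 0 <= M i j <= 1) ->
  singval s k ^+ 2 <= m%:R * l%:R.
Proof.
move=> svd k0 kl M01.
pose y : 'cV[R]_k := delta_mx (Ordinal k0) 0.
have y1 : enorm y = 1.
  apply/eqP; rewrite -(@eqrXn2 _ 2) ?enorm_ge0 // enorm_sum expr1n.
  rewrite (bigD1 (Ordinal k0)) //= big1 ?addr0 ?mxE ?eqxx ?expr1n // => i ik.
  by rewrite mxE (negPf ik) expr0n.
have h := svd_top kl svd y k0; rewrite y1 mulr1 in h.
have s0 : 0 <= singval s k by exact: sval_ge0 svd _.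
apply: (@le_trans _ _ (enorm (M *m (first_cols kl V *m y)) ^+ 2)).
  by rewrite ler_sqr ?nnegrE ?enorm_ge0.
apply: le_trans (frobenius_ge _ _) _.
rewrite enorm_isom ?y1 ?expr1n ?mulr1; last exact: first_cols_orthonormal svd.
apply: (@le_trans _ _ (\sum_(i < m) \sum_(j < l) 1)).
  apply: ler_sum => i _; apply: ler_sum => j _; have /andP[a b] := M01 i j.
  by rewrite exprn_ile1.
by rewrite !sumr_const !card_ord -mulrnA -natrM mulnC.
Qed.

Lemma fine_grid (D e K Y : R) : 0 < D -> 0 < e -> 0 <= K -> 0 <= Y ->
  exists N : nat, [/\ (0 < N)%N, K * N%:R^-1 <= 1, K * N%:R^-1 <= e & Y * N%:R^-1 <= D].
Proof.
move=> D0 e0 K0 Y0.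
have b1 : 0 <= K / e by rewrite divr_ge0 // ltW.
have b2 : 0 <= Y / D by rewrite divr_ge0 // ltW.
pose N := (Num.truncn (K + K / e + Y / D)).+1; exists N.
have hN : K + K / e + Y / D <= N%:R by apply: ltW; exact: truncnS_gt.
have N0 : 0 < N%:R :> R by rewrite ltr0n.
split => //; rewrite ler_pdivrMr //.
- by rewrite mul1r; lra.
- by rewrite [leRHS]mulrC -ler_pdivrMr //; lra.
- by rewrite [leRHS]mulrC -ler_pdivrMr //; lra.
Qed.

(** Since [S ^ 2 <= m * l], the assumption on the noise forces
    [delta ^ 2 * m * l] to be at least [ln l], the regime in which the
    variance term dominates. *)
Lemma noise_budget (m l L delta S eta : R) : 0 < m * l -> 0 <= L -> 0 < delta ->
  0 < S -> S ^+ 2 <= m * l -> 0 < eta <= 1 / 100%:R ->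
  Num.sqrt (m * l * L) <= eta ^+ 2 / (96%:R * 100%:R) * (delta * S ^+ 2) ->
  L <= m * (l * (delta * delta)) /\
  600%:R * Num.sqrt (m * (l * (delta * delta)) * L)
    / (eta * (delta * S) ^+ 2 / 16%:R) <= eta.
Proof.
move=> ml0 L0 d0 S0 hS /andP[e0 e1] hnoise.
have mlL : 0 <= m * l * L by rewrite mulr_ge0 // ltW.
have S2 : 0 < S ^+ 2 by rewrite exprn_gt0.
split.
  have h1 : Num.sqrt (m * l * L) <= delta * (m * l).
    apply: le_trans hnoise _; rewrite -[leRHS]mul1r; apply: ler_pM.
    - by rewrite divr_ge0 ?sqr_ge0.
    - by rewrite mulr_ge0 // ltW.
    - rewrite ler_pdivrMr ?mulr_gt0 // mul1r; apply: (@le_trans _ _ 1); last by lra.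
      by rewrite exprn_ile1 //; lra.
    - by rewrite ler_pM2l.
  have h2 : m * l * L <= (delta * (m * l)) ^+ 2.
    rewrite -[leLHS]sqr_sqrtr // ler_sqr ?nnegrE ?sqrtr_ge0 //.
    by rewrite mulr_ge0 // ltW.
  rewrite -(ler_pM2l ml0); apply: le_trans h2 _.
  by rewrite le_eqVlt; apply/orP; left; apply/eqP; ring.
have a0 : 0 < eta * (delta * S) ^+ 2 / 16%:R.
  by rewrite divr_gt0 // mulr_gt0 // exprn_gt0 // mulr_gt0.
have -> : m * (l * (delta * delta)) * L = delta ^+ 2 * (m * l * L) by ring.
rewrite sqrtrM ?sqr_ge0 // sqrtr_sqr ger0_norm ?(ltW d0) // ler_pdivrMr //.
have h := ler_wpM2l (ltW d0) hnoise.
apply: (@le_trans _ _ (600%:R * (delta * (eta ^+ 2 / (96%:R * 100%:R) * (delta * S ^+ 2))))).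
  by apply: ler_wpM2l h; exact: ler0n.
by rewrite le_eqVlt; apply/orP; left; apply/eqP; field.
Qed.

Lemma error_budget (m l delta theta S eta : R) : 0 <= m -> 0 <= eta <= 1 / 100%:R ->
  l * delta <= eta -> 2%:R * l * theta <= 1 -> m <= eta / 64%:R * S ^+ 2 ->
  eta * (delta * S) ^+ 2 / 16%:R +
    m * delta ^+ 2 * (1 + l * (2%:R * delta + 2%:R * theta)) + m * delta ^+ 2
  <= eta * (delta * S / 2%:R) ^+ 2.
Proof.
move=> m0 /andP[e0 e1] hd n1 hm.
have h1 : l * (2%:R * delta + 2%:R * theta) <= 2%:R by lra.
have md : m * delta ^+ 2 <= eta / 64%:R * S ^+ 2 * delta ^+ 2.
  by rewrite ler_wpM2r ?sqr_ge0.
have md0 : 0 <= m * delta ^+ 2 by rewrite mulr_ge0 ?sqr_ge0.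
have h2 : m * delta ^+ 2 * (1 + l * (2%:R * delta + 2%:R * theta)) <=
    m * delta ^+ 2 * 3%:R by rewrite ler_wpM2l //; lra.
have p0 : 0 <= eta * (delta ^+ 2 * S ^+ 2).
  by apply: mulr_ge0 => //; apply: mulr_ge0; exact: sqr_ge0.
move: h2 md p0; rewrite !exprMn; move: (m * delta ^+ 2 * (1 + _)) => u.
by move: (delta ^+ 2) (S ^+ 2) => x y; lra.
Qed.

(** The limit hypotheses are replaced with inequalities in terms of one small
    parameter [eta].  On each good cell, the initial matrix has to be in good
    position for the power of the matrix of that cell only. *)
Lemma recovery_at_fixed_size (d : measure_display) (T : measurableType d) (P : probability T R)
  (m l k : nat) (kl : (k <= l)%N) (M U : 'M[R]_(m, l)) (s : seq R) (V : 'M[R]_l)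
  (delta : R) (X : T -> 'M[R]_(m, l)) (Om : T -> {set 'I_m * 'I_l})
  (Q0 Vhat : T -> 'M[R]_(l, k)) (Vperp : T -> 'M[R]_(l, l - k)) (eta : R) :
  (l < m)%N -> (0 < k)%N -> 0 < delta <= 1 ->
  (forall i j, 0 <= M i j <= 1) -> is_svd M U s V ->
  random_model P M delta X Om Q0 ->
  (forall t, spca_output (proj_obs (Om t) (M + X t)) (Q0 t) (Vhat t)) ->
  (forall t, is_perp (Vhat t) (Vperp t)) ->
  0 < eta <= 1 / 100%:R ->
  l%:R * delta <= eta ->
  singval s k.+1 <= eta / 2%:R * singval s k ->
  m%:R <= eta / 64%:R * singval s k ^+ 2 ->
  Num.sqrt (m%:R * l%:R * ln l%:R) <=
    eta ^+ 2 / (96%:R * 100%:R) * (delta * singval s k ^+ 2) ->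
  1 <= (ln l%:R : R) -> l%:R^-1 <= eta ->
  exists E : set T, [/\ measurable E, ((1 - 3%:R * eta)%:E <= P E)%E &
    forall t, E t -> opnorm ((first_cols kl V)^T *m Vperp t) <= 12%:R * eta].
Proof.
move=> lm k0 d01 M01 svd model spca perp /andP[e0 e1] hd hgap hm hnoise L1 hl.
have /andP[d0 d1] := d01.
have l0 : (0 < l)%N by exact: leq_trans kl.
have m0 : (0 < m)%N by exact: ltn_trans lm.
have lR : 1 <= l%:R :> R by rewrite ler1n.
have mR : 1 <= m%:R :> R by rewrite ler1n.
set S := singval s k in hgap hm hnoise *; set L := ln l%:R in hnoise L1.
have S2 : 0 < S ^+ 2.
  have : 0 < eta / 64%:R * S ^+ 2 by lra.
  by rewrite pmulr_rgt0 //; lra.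
have S0 : 0 < S.
  rewrite lt0r; have -> : 0 <= S by exact: sval_ge0 svd _.
  by rewrite andbT; apply: contraTneq S2 => ->; rewrite expr0n /= ltxx.
set c := delta * S / 2%:R.
have c0 : 0 < c by rewrite divr_gt0 // mulr_gt0.
pose a := eta * (delta * S) ^+ 2 / 16%:R.
have a0 : 0 < a by rewrite divr_gt0 // mulr_gt0 // exprn_gt0 // mulr_gt0.
have eta01 : 0 <= eta <= 1 / 100%:R by rewrite (ltW e0).
have ml0 : 0 < m%:R * l%:R :> R by rewrite mulr_gt0 ?ltr0n.
have hS := singval_le svd k0 kl M01; rewrite -/S in hS.
have [Lmu dev] : L <= m%:R * (l%:R * (delta * delta)) /\
    600%:R * Num.sqrt (m%:R * (l%:R * (delta * delta)) * L) / a <= eta.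
  apply: noise_budget => //; last by rewrite e0.
  exact: le_trans ler01 L1.
set N := qr_iterations (R := R) l.
set beta := (c ^+ 2 / 2%:R) ^+ N.
have beta0 : 0 < beta by rewrite exprn_gt0 // divr_gt0 // exprn_gt0.
set sigma : R := (2%:R * l%:R ^+ 2 * (l ^ 2)%:R * k%:R)^-1.
have sigma0 : 0 < sigma.
  by rewrite invr_gt0 !mulr_gt0 ?exprn_gt0 ?ltr0n ?expn_gt0 ?l0.
pose D := sigma * beta / 2%:R.
have D0 : 0 < D by rewrite divr_gt0 // mulr_gt0.
pose Lam : R := l%:R * m%:R.
have Lam1 : 1 <= Lam by rewrite /Lam -natrM ler1n muln_gt0 l0.
have K0 : 0 <= 2%:R * l%:R :> R by rewrite mulr_ge0.
have Y0 : 0 <= N%:R * Lam ^+ N * (l%:R * (m%:R * 2%:R)).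
  by rewrite !mulr_ge0 // exprn_ge0 // mulr_ge0.
have [Ng [Ng0 n1 n2 n3]] := fine_grid D0 (exprn_gt0 2 d0) K0 Y0.
have NgR : 0 < Ng%:R :> R by rewrite ltr0n.
pose theta : R := Ng%:R^-1.
have theta0 : 0 <= theta by rewrite invr_ge0 ltW.
rewrite -/theta in n1 n2 n3.
have {}n3 : N%:R * Lam ^+ N * (l%:R * (m%:R * (2%:R * theta))) <= D.
  by move: n3; rewrite -!mulrA.
pose q := @cell_weight R d T P m l M delta X Ng.
pose val := @value R Ng.
have q_ge0 i j o : 0 <= q i j o by apply: cell_weight_ge0; rewrite (ltW d0).
have q_sum i j : \sum_o q i j o = 1 by exact: (cell_weight_sum model Ng0 i j).
have q_obs i j : \sum_o q i j o * (o.2)%:R = delta by exact: (cell_weight_obs model Ng0 i j).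
have q_mean i j : \sum_o q i j o * val o = delta * grid_mean P M X Ng i j.
  exact: cell_weight_mean.
have val_obs o : val o != 0 -> o.2 by exact: value_obs.
have val01 o : 0 <= val o <= 1 by exact: value01.
pose C := kept q val delta M.
have g01 i : 1 / 4%:R <= keep_prob q val i <= 1.
  have /andP[_ ->] := keep_prob01 val q_ge0 q_sum i.
  have := keep_prob_ge q_ge0 q_sum val_obs q_obs i; rewrite andbT; move: hd e1; clear; lra.
pose err := a + m%:R * delta ^+ 2 * (1 + l%:R * (2%:R * delta + 2%:R * theta)).
have err_small : err + m%:R * delta ^+ 2 <= eta * c ^+ 2.
  exact: error_budget.
have md0 : 0 <= m%:R * delta ^+ 2 by rewrite mulr_ge0 ?sqr_ge0.
pose Phi' (w : {ffun 'I_m -> {ffun 'I_l -> outcome Ng}}) := spca_Phi (sample val w).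
pose good w := ~~ far q val a w.
have err' w (x : 'cV[R]_l) : good w -> enorm (Phi' w *m x - C^T *m (C *m x)) <= err * enorm x.
  move=> gw; exact: (not_far q_ge0 q_sum val_obs d01 q_obs q_mean M01
    (grid_mean01 model Ng0) (grid_mean_near model Ng0 M01) x gw).
have ngrows (Phi : 'M[R]_l) : Phi^T = Phi ->
    (forall x, enorm (Phi *m x - C^T *m (C *m x)) <= eta * c ^+ 2 * enorm x) ->
    near_gram Phi C (first_cols kl V) c eta.
  by move=> sP hP; exact (near_gram_rows kl svd k0 d0 S0 eta01 g01 hgap sP hP).
have ng' w : good w -> near_gram (Phi' w) C (first_cols kl V) c eta.
  move=> gw; apply: ngrows => [|x]; first exact: spca_Phi_sym.
  apply: le_trans (err' w x gw) _; rewrite ler_wpM2r ?enorm_ge0 //.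
  by move: err_small md0; clear; lra.
set V1 := first_cols kl V in ngrows ng' *.
have unifQ := init_uniform model.
have exB (w : {ffun 'I_m -> {ffun 'I_l -> outcome Ng}}) : exists B : set 'M[R]_(l, k),
    [/\ borel_mx B, ((1 - eta)%:E <= P (Q0 @^-1` B))%E &
      good w -> forall q0, B q0 -> forall x : 'cV_k,
        sigma * enorm (Phi' w ^+ N *m (V1 *m x)) <=
          enorm (q0^T *m (Phi' w ^+ N *m (V1 *m x)))].
  have [gw|bw] := boolP (good w); last first.
    exists setT; split => //; first exact: borel_setT.
    by rewrite preimage_setT [leRHS](probability_setT P) lee_fin gerBl ltW.
  have [W [B' [orthW YE]]] : exists (W : 'M[R]_(l, k)) (B : 'M[R]_k),
      orthonormal_cols W /\ Phi' w ^+ N *m V1 = W *m B.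
    apply: orthonormal_factor => x; rewrite -mulmxA => Yx.
    have [_] := cone_iter (ng' w gw) N x.
    rewrite -/V1 Yx mulmx0 enorm0 -/beta => hx; apply: enorm_eq0.
    by have := enorm_ge0 x; move: hx beta0; clear; nra.
  have L0 : (0 < l ^ 2)%N by rewrite expn_gt0 l0.
  have [B [bB PB hB]] := uniform_well_conditioned L0 k0 orthW unifQ.
  exists B; split => //.
    apply: le_trans PB; rewrite lee_fin lerD2l lerN2.
    apply: le_trans hl; rewrite natrX expr2 invfM mulrA.
    rewrite -[leRHS]mul1r ler_wpM2r ?invr_ge0 // ler_pdivrMr ?ltr0n //.
    by rewrite mul1r ler_nat.
  move=> _ q0 /hB hq0 x.
  have -> : Phi' w ^+ N *m (V1 *m x) = W *m (B' *m x) by rewrite mulmxA YE -mulmxA.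
  by rewrite enorm_isom //; exact: hq0.
have [Bf hBf] := choice exB.
pose F w : set T := if good w then cell M X Om w `&` (Q0 @^-1` Bf w) else set0.
have mF w : measurable (F w).
  rewrite /F; case: ifP => // _; have [bB _ _] := hBf w.
  by apply: measurableI; [exact: (measurable_cell model Ng0 w)|exact: borel_preimage unifQ bB].
have dF t w w' : F w t -> F w' t -> w = w'.
  by rewrite /F; case: ifP => // _; case: ifP => // _ [h _] [h' _]; exact: cell_uniq h h'.
exists (\bigcup_w F w); split.
- exact: bigcup_measurable_fin.
- rewrite -(prob_disjoint_bigcup P mF dF (bigcup_measurable_fin mF)).
  pose W := fun i => prod_weight (q i).
  have W_ge0 i r : 0 <= W i r by exact: prod_weight_ge0.
  have W_sum i : \sum_r W i r = 1 by exact: prod_weight_sum1.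
  have PF w : ((prod_weight W w * ((1 - eta) * (1 - (far q val a w)%:R)))%:E <= P (F w))%E.
    rewrite /F /good; case: (boolP (far _ _ _ _)) => /= fw.
      by rewrite subrr !mulr0 measure0.
    have [bB PB _] := hBf w.
    rewrite subr0 mulr1 (cell_prob model Ng0 w bB) EFinM.
    by apply: lee_wpmul2l => //; rewrite lee_fin; exact: prod_weight_ge0.
  apply: le_trans; last by apply: lee_sum => w _; exact: PF.
  rewrite sumEFin lee_fin.
  have -> : \sum_w prod_weight W w * ((1 - eta) * (1 - (far q val a w)%:R)) =
      (1 - eta) * (1 - expect W (fun w => (far q val a w)%:R)).
    rewrite -[X in _ * (X - _)](prod_weight_sum1 W_sum) -sumrB mulr_sumr.
    by apply: eq_bigr => w _; ring.
  have := far_prob q_ge0 q_sum val01 val_obs d01 q_obs m0 l0 L1 Lmu a0.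
  rewrite -/L => hfar.
  have : expect W (fun w => (far q val a w)%:R) <= 2%:R * eta.
    by apply: le_trans hfar _; move: dev hd; clear; lra.
  by move=> h; move: (e0) (e1) h; clear; nra.
- move=> t [w _]; rewrite /F; case: (boolP (good w)) => // gw [ct Bt].
  have [_ _ hB] := hBf w.
  have hcell i j := cell_sample model Ng0 i j ct.
  set A := proj_obs (Om t) (M + X t) in hcell *.
  have A01 i j : 0 <= A i j <= 1 by have [] := hcell i j.
  have B01 i j : 0 <= sample val w i j <= 1 by rewrite mxE.
  have near := spca_Phi_near A01 B01
    (fun i j => let: And4 _ h _ _ := hcell i j in h)
    (fun i j => let: And4 _ _ h _ := hcell i j in h)
    (fun i j => let: And4 _ _ _ h := hcell i j in h).
  rewrite -/theta -/(Phi' w) in near.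
  have ng : near_gram (spca_Phi A) C V1 c eta.
    apply: ngrows => [|x]; first exact: spca_Phi_sym.
    have -> : spca_Phi A *m x - C^T *m (C *m x) =
      (spca_Phi A - Phi' w) *m x + (Phi' w *m x - C^T *m (C *m x)).
      by rewrite [(_ - Phi' w) *m x]mulmxBl addrA subrK.
    apply: le_trans (enormD _ _) _.
    have h1 := near x; have h2 := err' w x gw; have x0 := enorm_ge0 x.
    have h3 : l%:R * (m%:R * (2%:R * theta)) * enorm x <= m%:R * delta ^+ 2 * enorm x.
      rewrite ler_wpM2r //.
      have -> : l%:R * (m%:R * (2%:R * theta)) = m%:R * (2%:R * l%:R * theta) by ring.
      by rewrite ler_wpM2l.
    have h4 := ler_wpM2r x0 err_small; rewrite mulrDl in h4.
    by move: h1 h2 h3 h4; clear; lra.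
  have [orthP kerP] := perp t.
  have hperp : (Vhat t)^T *m Vperp t = 0.
    apply: trmx_inj; rewrite trmx_mul trmxK trmx0.
    by apply/sub_kermxP; have /andP[] := kerP.
  have [St hSt] := qr_iterates (spca t); rewrite -/N -/A in hSt.
  apply: opnorm_le => [|x]; first by rewrite mulr_ge0 // ltW.
  rewrite -mulmxA -(enorm_isom x orthP).
  apply: le_trans (perturbed_power_iteration ng (ng' w gw) _ sigma0 _ (hB gw _ Bt) _) _.
  - by case: unifQ.
  - move=> y; apply: le_trans (power_perturbation N Lam1 _ _ _ near y) _.
    + by rewrite !mulr_ge0.
    + exact: spca_Phi_bounded.
    + exact: spca_Phi_bounded.
    + by rewrite ler_wpM2r ?enorm_ge0.
  - by rewrite hSt trmx_mul -mulmxA (mulmxA _ (Vperp t)) hperp mul0mx mulmx0.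
  rewrite ler_wpM2r ?enorm_ge0 //.
  have -> : 12%:R * eta = 8%:R * eta + 4%:R * eta by rewrite -mulrDl -natrD.
  rewrite lerD2l; apply: le_trans (iterations_enough k0 kl eta01) _.
  by rewrite ler_wpM2l.
Qed.

End FixedSizeProbability.

(** * Passing to the limit *)

Section Diagonal.
Context {R : realType}.

(** The best accuracy available at index [n], among the first [n] ones,
    defines the sequence of errors. *)
Lemma whp_o1_of_eventually (d : nat -> measure_display)
    (T : forall n, measurableType (d n)) (P : forall n, probability (T n) R)
    (Y : forall n, T n -> R) :
  (forall eps : R, 0 < eps -> \forall n \near \oo, exists E : set (T n),
     [/\ measurable E, ((1 - eps)%:E <= P n E)%E & forall t, E t -> `|Y n t| <= eps]) ->
  whp_o1 P Y.
Proof.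
move=> h.
pose good n j := exists E : set (T n), [/\ measurable E,
  ((1 - j.+1%:R^-1)%:E <= P n E)%E & forall t, E t -> `|Y n t| <= j.+1%:R^-1].
pose K n := \max_(j < n.+1 | `[< good n j >]) j.+1.
have Kgood n : (0 < K n)%N -> good n (K n).-1.
  move=> K0.
  have [j gj] : exists j : 'I_n.+1, `[< good n j >].
    apply: contrapT => nj; move: K0; rewrite /K big1 // => j gj.
    by exfalso; apply: nj; exists j.
  rewrite /K (bigop.bigmax_eq_arg j) //.
  by case: arg_maxnP => // i /asboolP gi _ /=.
have Kinfty j0 : \forall n \near \oo, (j0 < K n)%N.
  have e0 : 0 < j0.+1%:R^-1 :> R by rewrite invr_gt0 ltr0n.
  near=> n.
  have gn : good n j0 by near: n; exact: h.
  have jn : (j0 < n.+1)%N by rewrite ltnS; near: n; exact: nbhs_infty_ge.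
  apply: (bigop.bigmax_sup (Ordinal jn)) => //; exact/asboolP.
pose eps n : R := (K n)%:R^-1.
have exE n : exists E : set (T n), [/\ measurable E,
    (0 < K n)%N -> ((1 - eps n)%:E <= P n E)%E & forall t, E t -> `|Y n t| <= eps n].
  have [K0|K0] := posnP (K n); first by exists set0; split.
  have [E [mE PE YE]] := Kgood n K0; rewrite prednK // in PE YE.
  by exists E; split.
pose E n := projT1 (cid (exE n)).
have hE n := projT2 (cid (exE n)).
have eps0 : eps @ \oo --> (0 : R).
  apply/cvgrPdist_le => e e0; near=> n.
  rewrite sub0r normrN ger0_norm ?invr_ge0 //.
  have Kn : (Num.truncn e^-1 < K n)%N by near: n; exact: Kinfty.
  have KR : e^-1 <= (K n)%:R.
    apply: (@le_trans _ _ (Num.truncn e^-1).+1%:R); last by rewrite ler_nat.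
    by apply: ltW; exact: truncnS_gt.
  by rewrite /eps invf_ple ?posrE // ltr0n (leq_ltn_trans _ Kn).
exists eps; split => //.
exists E; split.
- by move=> n; have [] := hE n.
- by move=> n t Et; have [_ _ hY] := hE n; exact: hY.
apply: (@squeeze_cvge _ _ _ _ (fun n => (1 - eps n)%:E) _ (cst 1%E)).
- near=> n; have [mE PE _] := hE n.
  rewrite PE ?probability_le1 //; near: n; exact: Kinfty.
- apply: cvg_EFin; first by apply: nearW => n.
  by rewrite -[X in _ --> X](subr0 (1 : R)); apply: cvgB => //; exact: cvg_cst.
- exact: cvg_cst.
Unshelve. all: by end_near.
Qed.

Lemma littleo_near (u v : nat -> R) (e : R) : is_littleo u v -> 0 < e ->
  \forall n \near \oo, `|u n| <= e * `|v n|.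
Proof. by move=> /eqoP h e0; exact: h. Qed.

End Diagonal.

Theorem theorem1 (R : realType)
  (m l k : nat -> nat) (delta : nat -> R)
  (M : forall n, 'M[R]_(m n, l n))
  (U : forall n, 'M[R]_(m n, l n)) (s : nat -> seq R)
  (V : forall n, 'M[R]_(l n))
  (d : nat -> measure_display) (T : forall n, measurableType (d n))
  (P : forall n, probability (T n) R)
  (X : forall n, T n -> 'M[R]_(m n, l n))
  (Om : forall n, T n -> {set 'I_(m n) * 'I_(l n)})
  (Q0 : forall n, T n -> 'M[R]_(l n, k n))
  (Vhat : forall n, T n -> 'M[R]_(l n, k n))
  (Vhat_perp : forall n, T n -> 'M[R]_(l n, l n - k n))
  (m_infty : m @ \oo --> \oo) (l_infty : l @ \oo --> \oo)
  (lm : forall n, (l n < m n)%N)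
  (k0 : forall n, (0 < k n)%N) (kl : forall n, (k n <= l n)%N)
  (delta01 : forall n, 0 < delta n <= 1)
  (l_delta : is_littleo (fun n => (l n)%:R) (fun n => 1 / delta n))
  (M01 : forall n i j, 0 <= M n i j <= 1)
  (svdM : forall n, is_svd (M n) (U n) (s n) (V n))
  (sk_m : is_littleomega (fun n => singval (s n) (k n))
                         (fun n => Num.sqrt (m n)%:R))
  (sk_gap : is_littleomega (fun n => singval (s n) (k n))
                           (fun n => singval (s n) (k n).+1))
  (sk_noise : is_littleomega
     (fun n => delta n * singval (s n) (k n) ^+ 2)
     (fun n => Num.sqrt ((m n)%:R * (l n)%:R * ln (l n)%:R)))
  (model : forall n, random_model (P n) (M n) (delta n) (X n) (Om n) (Q0 n))
  (Vhat_spca : forall n (t : T n),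
     spca_output (proj_obs (Om n t) (M n + X n t)) (Q0 n t) (Vhat n t))
  (Vhat_perpP : forall n (t : T n), is_perp (Vhat n t) (Vhat_perp n t)) :
  whp_o1 P (fun n t => opnorm ((first_cols (kl n) (V n))^T *m Vhat_perp n t)).
Proof.
apply: whp_o1_of_eventually => eps eps0.
pose eta := Num.min (eps / 12%:R) (1 / 100%:R).
have eta0 : 0 < eta by rewrite lt_min !divr_gt0.
have eta1 : eta <= 1 / 100%:R by rewrite ge_min lexx orbT.
have etae : 12%:R * eta <= eps.
  have : eta <= eps / 12%:R by rewrite ge_min lexx.
  lra.
have l_ge A : \forall n \near \oo, (A <= l n)%N.
  by move: A; apply/cvgnyPge.
have e2 : 0 < eta / 2%:R by rewrite divr_gt0.
have e8 : 0 < eta / 8%:R by rewrite divr_gt0.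
have eh : 0 < eta ^+ 2 / (96%:R * 100%:R) by rewrite divr_gt0 ?exprn_gt0 // mulr_gt0.
near=> n.
have /andP[d0 d1] := delta01 n.
have sge i : 0 <= singval (s n) i by exact: sval_ge0 (svdM n) _.
have hd : (l n)%:R * delta n <= eta.
  have : `|(l n)%:R| <= eta * `|1 / delta n| by near: n; exact: littleo_near.
  by rewrite ger0_norm // ger0_norm ?divr_ge0 ?(ltW d0) // mul1r ler_pdivlMr.
have hgap : singval (s n) (k n).+1 <= eta / 2%:R * singval (s n) (k n).
  have : `|singval (s n) (k n).+1| <= eta / 2%:R * `|singval (s n) (k n)|.
    by near: n; exact: littleo_near.
  by rewrite !ger0_norm.
have hm : (m n)%:R <= eta / 64%:R * singval (s n) (k n) ^+ 2.
  have : `|Num.sqrt (m n)%:R| <= eta / 8%:R * `|singval (s n) (k n)|.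
    by near: n; exact: littleo_near.
  rewrite !ger0_norm ?sqrtr_ge0 // => h.
  have : Num.sqrt (m n)%:R ^+ 2 <= (eta / 8%:R * singval (s n) (k n)) ^+ 2.
    by rewrite ler_sqr ?nnegrE ?sqrtr_ge0 // mulr_ge0 // ltW.
  rewrite sqr_sqrtr // exprMn => /le_trans; apply.
  rewrite ler_wpM2r ?sqr_ge0 // exprMn exprVn.
  have : eta ^+ 2 <= eta by rewrite expr2 -[leRHS]mulr1 ler_wpM2l ?(ltW eta0) //; lra.
  have -> : (8%:R ^+ 2)^-1 = 64%:R^-1 :> R by rewrite -natrX.
  by move=> h2; rewrite ler_wpM2r // invr_ge0.
have hnoise : Num.sqrt ((m n)%:R * (l n)%:R * ln (l n)%:R) <=
    eta ^+ 2 / (96%:R * 100%:R) * (delta n * singval (s n) (k n) ^+ 2).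
  have : `|Num.sqrt ((m n)%:R * (l n)%:R * ln (l n)%:R)| <=
    eta ^+ 2 / (96%:R * 100%:R) * `|delta n * singval (s n) (k n) ^+ 2|.
    by near: n; exact: littleo_near.
  by rewrite !ger0_norm ?sqrtr_ge0 // mulr_ge0 ?sqr_ge0 // ltW.
have L1 : 1 <= (ln (l n)%:R : R).
  have l4 : (4 <= l n)%N by near: n; exact: l_ge.
  have lp : 0 < (l n)%:R :> R by rewrite ltr0n (leq_trans _ l4).
  rewrite -ler_expR lnK ?posrE //; apply: le_trans (expR1_le4 (R := R)) _.
  by rewrite ler_nat.
have hl : (l n)%:R^-1 <= eta.
  have lA : ((Num.truncn eta^-1).+1 <= l n)%N by near: n; exact: l_ge.
  have lp : 0 < (l n)%:R :> R by rewrite ltr0n (leq_trans _ lA).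
  rewrite invf_ple ?posrE //.
  apply: (@le_trans _ _ (Num.truncn eta^-1).+1%:R); last by rewrite ler_nat.
  by apply: ltW; exact: truncnS_gt.
have eta01 : 0 < eta <= 1 / 100%:R by rewrite eta0.
have [E [mE PE hE]] := recovery_at_fixed_size (kl n) (lm n) (k0 n) (delta01 n) (M01 n) (svdM n)
  (model n) (@Vhat_spca n) (@Vhat_perpP n) eta01 hd hgap hm hnoise L1 hl.
exists E; split => //.
  by apply: le_trans PE; rewrite lee_fin; lra.
by move=> t Et; rewrite ger0_norm ?opnorm_ge0 //; apply: le_trans (hE t Et) _.
Unshelve. all: by end_near.
Qed.
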